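(* Consider an edge-to-edge dihedral tiling of a flat torus by unit-area tiles, each of which is congruent either to one fixed efficient pentagon or to one fixed Type 2 non-convex pentagon. Then the perimeter per tile of the tiling is not less than the perimeter per tile of a Cairo/Prismatic tiling, i.e. it is not less than half the perimeter of a unit-area Cairo (or Prismatic) pentagon, namely $\sqrt{2+\sqrt3}$.
   Context: All tilings are by unit-area polygons and edge-to-edge: adjacent tiles meet only along entire edges or at vertices. The perimeter per tile of a tiling of a flat torus is the total length of all edges of the tiling (each edge counted once) divided by the number of tiles. A Cairo (respectively Prismatic) pentagon is a pentagon with three angles of $2\pi/3$ and two right angles which are nonadjacent (respectively adjacent), circumscribed about a circle; at unit area both have perimeter $2\sqrt{2+\sqrt3}\approx 3.86$. A unit-area pentagon is efficient if its perimeter is less than or equal to that of a unit-area Cairo pentagon. A Type 2 non-convex pentagon is a pentagon with two interior angles (adjacent or non-adjacent) larger than $\pi$. A dihedral tiling is one with two prototiles. *)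

(* Defs.v *)
From HB Require Import structures.
From mathcomp Require Import all_boot all_order all_algebra.
From mathcomp Require Import all_classical all_reals all_analysis.

Set Implicit Arguments.
Unset Strict Implicit.
Unset Printing Implicit Defensive.

Import Order.TTheory GRing.Theory Num.Theory.
Import numFieldNormedType.Exports.

Local Open Scope classical_set_scope.
Local Open Scope ring_scope.

Section Plane.
Context {R : realType}.

Definition plane : Type := (R * R)%type.

Implicit Types (p q u w x : plane).

Definition dot u w : R := u.1 * w.1 + u.2 * w.2.

Definition cross u w : R := u.1 * w.2 - u.2 * w.1.

(* The library norm on R * R is the sup norm, hence a separate length. *)
Definition enorm u : R := Num.sqrt (dot u u).

Definition edist p q : R := enorm (q - p).

Definition plane_isometry (f : plane -> plane) : Prop :=
  forall p q, edist (f p) (f q) = edist p q.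

Definition segment p q : set plane :=
  [set ((1 - t) * p.1 + t * q.1, (1 - t) * p.2 + t * q.2) | t in `[0, 1] ].

(* For nonzero u and w, the angle in [0, 2pi[ of the counterclockwise rotation
   taking the direction of u to that of w. *)
Definition ccw_angle u w : R :=
  let a := acos (dot u w / (enorm u * enorm w)) in
  if 0 <= cross u w then a else 2 * pi - a.

End Plane.
Arguments plane : clear implicits.

(* A polygon is given by its vertices in cyclic order, in either direction. *)
Definition polygon (R : realType) (n : nat) : Type := 'I_n -> plane R.

Section Polygon.
Context {R : realType} {n : nat}.
Implicit Types (P Q : polygon R n) (k l : 'I_n).

Definition edge P k : set (plane R) := segment (P k) (P (ordS k)).

Definition edge_length P k : R := edist (P k) (P (ordS k)).

Definition perimeter P : R := \sum_k edge_length P k.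

Definition boundary P : set (plane R) := \bigcup_k edge P k.

Definition simple_polygon P : Prop :=
  injective P /\
  forall k l x, k != l -> edge P k x -> edge P l x ->
    (ordS k = l /\ x = P l) \/ (ordS l = k /\ x = P k).

(* The union of the bounded components of the complement of the boundary. *)
Definition inside P : set (plane R) :=
  [set x | (~` boundary P) x /\
           bounded_set (connected_component (~` boundary P) x)].

Definition region P : set (plane R) := inside P `|` boundary P.

Definition area P : \bar R :=
  (@lebesgue_measure R \x @lebesgue_measure R)%E (region P).

(* Positive exactly when the vertices are listed counterclockwise. *)
Definition signed_area P : R := (\sum_k cross (P k) (P (ordS k))) / 2.

(* When the vertices are listed counterclockwise, the polygon near P k is swept
   by rotating the outgoing side counterclockwise onto the incoming one. *)
Definition interior_angle P k : R :=
  let next := P (ordS k) - P k in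
  let prev := P (ord_pred k) - P k in
  if 0 <= signed_area P then ccw_angle next prev else ccw_angle prev next.

Definition circumscribed P : Prop :=
  exists (c : plane R) (r : R), 0 < r /\
    forall k, exists x, [/\ edge P k x, edist c x = r &
      dot (x - c) (P (ordS k) - P k) = 0].

Definition translate P (t : plane R) : polygon R n := fun k => P k + t.

(* Labels are matched: a polygon can be relabelled from any starting vertex in
   either direction, so this does not restrict the underlying figures. *)
Definition congruent P Q : Prop :=
  exists2 f : plane R -> plane R, plane_isometry f & forall k, Q k = f (P k).

End Polygon.

Section Pentagons.
Context {R : realType}.
Implicit Types P C : polygon R 5.

Definition adjacent_vertices (k l : 'I_5) : Prop := ordS k = l \/ ordS l = k.

Definition right_angles_at P (k l : 'I_5) : Prop :=
  forall j, interior_angle P j =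
    if (j == k) || (j == l) then pi / 2 else 2 * pi / 3.

Definition cairo P : Prop :=
  [/\ simple_polygon P, circumscribed P &
      exists k l, [/\ k <> l, ~ adjacent_vertices k l & right_angles_at P k l] ].

Definition prismatic P : Prop :=
  [/\ simple_polygon P, circumscribed P &
      exists k l, [/\ k <> l, adjacent_vertices k l & right_angles_at P k l] ].

Definition efficient P : Prop :=
  [/\ simple_polygon P, area P = 1%:E &
      exists C, [/\ cairo C, area C = 1%:E & perimeter P <= perimeter C] ].

Definition type2_nonconvex P : Prop :=
  simple_polygon P /\
  exists k l, [/\ k <> l, pi < interior_angle P k & pi < interior_angle P l].

End Pentagons.

Section Tilings.
Context {R : realType} {n N : nat}.

Definition lattice (u v : plane R) : set (plane R) :=
  [set t | exists a b : int,
     t = (a%:~R * u.1 + b%:~R * v.1, a%:~R * u.2 + b%:~R * v.2)].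

(* The flat torus is the quotient of the plane by lattice u v.  A tiling of it
   by N tiles is given by one lift T i of each tile; all the lattice translates
   of these lifts form a tiling of the plane. *)
Definition torus_tiling (u v : plane R) (T : 'I_N -> polygon R n) : Prop :=
  [/\ cross u v <> 0,
      forall i, simple_polygon (T i),
      forall x, exists i, exists2 t, lattice u v t & region (translate (T i) t) x
    & forall i j t, lattice u v t -> (i, 0) <> (j, t) ->
        inside (T i) `&` inside (translate (T j) t) = set0].

Definition edge_to_edge (u v : plane R) (T : 'I_N -> polygon R n) : Prop :=
  forall i j t, lattice u v t -> (i, 0) <> (j, t) ->
  forall x, region (T i) x -> region (translate (T j) t) x ->
    exists k l,
      (x = T i k /\ x = translate (T j) t l) \/
      (edge (T i) k x /\ edge (T i) k = edge (translate (T j) t) l).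

(* The pair (i, k) stands for the k-th side of the i-th tile; two sides are the
   same edge of the torus when they have lifts that coincide. *)
Definition same_edge (u v : plane R) (T : 'I_N -> polygon R n) :
    rel ('I_N * 'I_n) :=
  fun e f => `[< exists2 t, lattice u v t &
                 edge (T e.1) e.2 = edge (translate (T f.1) t) f.2 >].

(* One representative side for each edge of the torus. *)
Definition torus_edges (u v : plane R) (T : 'I_N -> polygon R n) :
    {set 'I_N * 'I_n} :=
  transversal (equivalence_partition (same_edge u v T) finset.setT) finset.setT.

Definition perimeter_per_tile (u v : plane R) (T : 'I_N -> polygon R n) : R :=
  (\sum_(e in torus_edges u v T) edge_length (T e.1) e.2) / N%:R.

Definition dihedral (A B : polygon R n) (T : 'I_N -> polygon R n) : Prop :=
  [/\ forall i, congruent A (T i) \/ congruent B (T i),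
      exists i, congruent A (T i) & exists i, congruent B (T i)].

End Tilings.

(* Main.v *)
(** Let [S0 = 2 + sqrt 3], so that a Cairo pentagon has perimeter [2 sqrt S0].  A
    unit-area pentagon of perimeter less than 4 is strictly convex, and by
    Lhuilier's inequality its perimeter is at least [2 sqrt S], where [S] is the
    sum of [cot (a / 2)] over its angles [a].  Moreover [S - S0] is the sum over
    the angles of an excess [cot (a / 2) - (4 - sqrt 3) + slope * a], the angles
    adding up to [3 pi].  The excesses at a vertex surrounded by convex tiles only
    have a nonnegative sum: by convexity of the cotangent, three angles do no
    better than [2 pi / 3] each, four or more no better than right angles.  At a
    vertex of some nonconvex tile the sum is at least [- pi / 18], since only
    angles above [pi / 2] have negative excess.  So the convex tiles lose at most
    [5 pi / 18] of [S - S0] per nonconvex tile, which costs less perimeter than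
    the nonconvex tile brings: a type 2 pentagon of area 1 has perimeter at least
    [9 / 2], because at a reflex angle it can be replaced by the convex hull of the
    other vertices, which is a triangle when there are two reflex angles.
    The angles at a vertex are compared to [2 pi] by measuring the directions that
    they contain, and no edge is shared by more than two tiles because near its
    midpoint each tile contains one of the two sides. *)

Require Import Defs.
From mathcomp Require Import all_boot all_order all_algebra.
From mathcomp Require Import all_classical all_reals all_analysis.
From mathcomp Require Import measurable_realfun ring lra.

Set Implicit Arguments.
Unset Strict Implicit.
Unset Printing Implicit Defensive.

Import Order.TTheory GRing.Theory Num.Theory.
Import numFieldNormedType.Exports.

Local Open Scope classical_set_scope.
Local Open Scope ring_scope.

(** The linear function subtracted in the excess is the chord of [cot (a / 2)] through the two Cairo
    angles [pi / 2] and [2 * pi / 3]: the excess vanishes at both and, by convexity, is negative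
    only between them. The angles of a nonconvex tile cannot be controlled, so they never enter;
    each of its five corners carries the constant charge [pi / 18] instead, and one such corner pays
    for a whole vertex. The obstacle is that [inside] is defined by bounded components, so that
    nonconvex tiles seem to call for the Jordan curve theorem. Two fragments of it suffice: a convex
    pentagon is the intersection of its half-planes, and by the even-odd rule one of the two sides
    of each edge of a simple polygon is locally inside. The second fragment yields at most two tiles
    per edge, which is the direction in which the sum of the perimeters is compared with the total
    edge length. A sign [s] with [s * s = 1] carries the orientation, so that both orders of listing
    the vertices are treated at once. *)

Definition turn {R : realType} (p q z : plane R) : R := cross (q - p) (z - p).

(** * Regions of polygons *)

Section Affine.
Context {R : realType}.
Implicit Types (p q z m u w : plane R).

Lemma plane_eqP p q : p.1 = q.1 -> p.2 = q.2 -> p = q.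
Proof. by case: p q => [a b] [c d] /= -> ->. Qed.

Definition affine (a b c : R) : plane R -> R := fun z => a * z.1 + b * z.2 + c.

Lemma continuous_affine a b c : continuous (affine a b c).
Proof.
move=> z; rewrite /affine; apply: cvgD; last exact: cvg_cst.
by apply: cvgD; apply: cvgMl_tmp; [exact: cvg_fst|exact: cvg_snd].
Qed.

Lemma turnE p q z :
  turn p q z = affine (- (q.2 - p.2)) (q.1 - p.1)
    ((q.2 - p.2) * p.1 - (q.1 - p.1) * p.2) z.
Proof. by rewrite /turn /cross /affine /=; ring. Qed.

Lemma turn_l p q : turn p q p = 0.
Proof. by rewrite /turn /cross /=; ring. Qed.

Lemma turn_r p q : turn p q q = 0.
Proof. by rewrite /turn /cross /=; ring. Qed.

Lemma open_affine_gt0 a b c : open [set z | 0 < affine a b c z].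
Proof.
apply: (open_comp (f := affine a b c) (D := [set x : R | 0 < x])).
  by move=> z _; exact: continuous_affine.
exact: open_gt.
Qed.

Lemma closed_affine_ge0 a b c : closed [set z | 0 <= affine a b c z].
Proof.
have h : {in ~` affine a b c @^-1` [set x : R | 0 <= x], continuous (affine a b c)}.
  by move=> z _; exact: continuous_affine.
exact: (preimage_closed h (@closed_ge R 0)).
Qed.

Lemma continuous_line z m : continuous (fun s : R => (z.1 + s * m.1, z.2 + s * m.2) : plane R).
Proof.
move=> s.
have h1 : z.1 + t * m.1 @[t --> s] --> z.1 + s * m.1.
  by apply: cvgD; [exact: cvg_cst|apply: cvgMr_tmp; exact: cvg_id].
have h2 : z.2 + t * m.2 @[t --> s] --> z.2 + s * m.2.
  by apply: cvgD; [exact: cvg_cst|apply: cvgMr_tmp; exact: cvg_id].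
exact: (cvg_pair h1 h2).
Qed.

Lemma bounded_setP (A : set (plane R)) :
  bounded_set A <-> exists M, forall z, A z -> `|z.1| <= M /\ `|z.2| <= M.
Proof.
split.
  move=> [M [_ HM]]; exists (M + 1) => z Az.
  have := HM (M + 1) _ z Az; rewrite ltrDl ltr01 => /(_ isT).
  by rewrite /= (prod_normE (z : R * R)%type) ge_max => /andP[].
move=> [M HM]; exists M; split; first exact: num_real.
move=> x Mx z Az; have [h1 h2] := HM z Az.
by rewrite /= (prod_normE (z : R * R)%type) ge_max (le_trans h1 (ltW Mx)) (le_trans h2 (ltW Mx)).
Qed.

Lemma segmentP p q z : segment p q z <->
  exists t, [/\ 0 <= t, t <= 1, z.1 = (1 - t) * p.1 + t * q.1 &
                z.2 = (1 - t) * p.2 + t * q.2].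
Proof.
split; first by move=> [t /=]; rewrite in_itv /= => /andP[t0 t1] <-; exists t.
move=> [t [t0 t1 z1 z2]]; exists t => /=; first by rewrite in_itv /= t0 t1.
exact/esym/plane_eqP.
Qed.

Lemma dot_segment m c p q z : dot m p <= c -> dot m q <= c -> segment p q z ->
  dot m z <= c.
Proof.
move=> hp hq /segmentP[t [t0 t1 z1 z2]].
have -> : dot m z = (1 - t) * dot m p + t * dot m q by rewrite /dot z1 z2; ring.
have : 0 <= (1 - t) * (c - dot m p) by rewrite mulr_ge0 // subr_ge0.
have : 0 <= t * (c - dot m q) by rewrite mulr_ge0 // subr_ge0.
lra.
Qed.

Lemma dot_ge0 m : 0 <= dot m m.
Proof. by rewrite /dot -!expr2 addr_ge0 ?sqr_ge0. Qed.

Lemma dot_eq0 m : dot m m = 0 -> m.1 = 0 /\ m.2 = 0.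
Proof.
move=> /eqP; rewrite /dot -!expr2 paddr_eq0 ?sqr_ge0 // !sqrf_eq0.
by move=> /andP[/eqP ? /eqP ?].
Qed.

(* A point beyond the line escapes to infinity along the normal ray. *)
Lemma region_halfplane n (P : polygon R n.+1) m c :
  (forall k, dot m (P k) <= c) -> forall z, region P z -> dot m z <= c.
Proof.
move=> hP z; have bd x : boundary P x -> dot m x <= c.
  by move=> [k _]; exact: dot_segment.
move=> [[_ hb]|]; last exact: bd.
rewrite leNgt; apply/negP => hz.
have mm : 0 < dot m m.
  rewrite lt_neqAle dot_ge0 andbT; apply/eqP => /esym/dot_eq0[m1 m2].
  have := le_lt_trans (hP ord0) hz.
  by rewrite /dot m1 m2 !mul0r ltxx.
pose L s : plane R := (z.1 + s * m.1, z.2 + s * m.2).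
have dL s : dot m (L s) = dot m z + s * dot m m by rewrite /L /dot /=; ring.
have sub : L @` `[0, +oo[ `<=` connected_component (~` boundary P) z.
  apply: connected_component_max.
  - exists 0; first by rewrite /= in_itv /= lexx.
    by apply/plane_eqP; rewrite /= mul0r addr0.
  - move=> _ [s + <-] /bd; rewrite /= in_itv /= andbT dL => s0.
    have : 0 <= s * dot m m by rewrite mulr_ge0 // ltW.
    lra.
  - apply: connected_continuous_connected.
      by apply/connected_intervalP; exact: interval_is_interval.
    by apply: continuous_subspaceT; exact: continuous_line.
have [M HM] := (bounded_setP _).1 hb.
have M0 : 0 <= M.
  have L0 : connected_component (~` boundary P) z (L 0).
    by apply: sub; exists 0; rewrite //= in_itv /= lexx.
  by have [h _] := HM _ L0; exact: le_trans (normr_ge0 _) h.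
pose s := ((`|m.1| + `|m.2|) * M + `|dot m z| + 1) / dot m m.
have s0 : 0 <= s.
  by rewrite divr_ge0 ?dot_ge0 // !addr_ge0 // mulr_ge0 // addr_ge0.
have [h1 h2] : `|(L s).1| <= M /\ `|(L s).2| <= M.
  by apply: HM; apply: sub; exists s => //=; rewrite in_itv /= s0.
have : dot m (L s) = dot m z + ((`|m.1| + `|m.2|) * M + `|dot m z| + 1).
  by rewrite dL /s divfK // gt_eqF.
have : dot m (L s) <= `|m.1| * M + `|m.2| * M.
  by apply: lerD; apply: (le_trans (ler_norm _)); rewrite normrM ler_wpM2l.
have := ler_norm (- dot m z); rewrite normrN.
lra.
Qed.

End Affine.

(** * Triangles as convex hulls *)

Section Hull3.
Context {R : realType}.
Implicit Types (a b c p q z : plane R) (s : R).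

Definition hull3 a b c : set (plane R) := [set z | exists x y w : R,
  [/\ 0 <= x, 0 <= y, 0 <= w, x + y + w = 1 &
      z.1 = x * a.1 + y * b.1 + w * c.1 /\ z.2 = x * a.2 + y * b.2 + w * c.2]].

Let frac3 (T z x y w a b c : R) : T != 0 -> z * T = x * a + y * b + w * c ->
  z = x / T * a + y / T * b + w / T * c.
Proof. by move=> Tn E; apply: (mulIf Tn); rewrite E; field. Qed.

(** The barycentric coordinates are the ratios of the signed areas of the three triangles with apex
    [z] to that of the whole triangle. *)
Lemma turn_hull3 s a b c z : 0 < s * turn a b c -> 0 <= s * turn a b z ->
  0 <= s * turn b c z -> 0 <= s * turn c a z -> hull3 a b c z.
Proof.
move=> T0 h1 h2 h3; pose T := s * turn a b c.
have Tn : T != 0 by rewrite gt_eqF.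
have ET : s * turn b c z + s * turn c a z + s * turn a b z = T.
  by rewrite /T /turn /cross /=; ring.
exists (s * turn b c z / T), (s * turn c a z / T), (s * turn a b z / T).
split; rewrite ?divr_ge0 ?(ltW T0) //; first by rewrite -!mulrDl ET divff.
by split; apply: frac3 => //; rewrite /T /turn /cross /=; ring.
Qed.

Lemma hull3_turn s a b c p q z : hull3 a b c z -> 0 <= s * turn p q a ->
  0 <= s * turn p q b -> 0 <= s * turn p q c -> 0 <= s * turn p q z.
Proof.
move=> [x [y [w [x0 y0 w0 e [z1 z2]]]]] ha hb hc.
have -> : s * turn p q z = x * (s * turn p q a) + y * (s * turn p q b) + w * (s * turn p q c).
  rewrite /turn /cross /= z1 z2.
  have -> : x = 1 - y - w by rewrite -e; ring.
  by ring.
by apply: addr_ge0; first apply: addr_ge0; apply: mulr_ge0.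
Qed.

Lemma hull3_bound a b c z M : hull3 a b c z ->
  `|a.1| <= M -> `|b.1| <= M -> `|c.1| <= M ->
  `|a.2| <= M -> `|b.2| <= M -> `|c.2| <= M -> `|z.1| <= M /\ `|z.2| <= M.
Proof.
move=> [x [y [w [x0 y0 w0 e [-> ->]]]]] a1 b1 c1 a2 b2 c2.
have main u v t : `|u| <= M -> `|v| <= M -> `|t| <= M ->
    `|x * u + y * v + w * t| <= M.
  move=> hu hv ht; have -> : M = x * M + y * M + w * M by rewrite -!mulrDl e mul1r.
  rewrite (le_trans (ler_normD _ _)) // lerD //; last first.
    by rewrite normrM ger0_norm // ler_wpM2l.
  rewrite (le_trans (ler_normD _ _)) // lerD //;
    by rewrite normrM ger0_norm // ler_wpM2l.
by split; apply: main.
Qed.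

End Hull3.

Notation v0 := (@Ordinal 5 0 isT).
Notation v1 := (@Ordinal 5 1 isT).
Notation v2 := (@Ordinal 5 2 isT).
Notation v3 := (@Ordinal 5 3 isT).
Notation v4 := (@Ordinal 5 4 isT).

Notation ordS2 k := (ordS (ordS k)).
Notation ordS3 k := (ordS (ordS2 k)).
Notation ordS4 k := (ordS (ordS3 k)).

Lemma I5P (Q : 'I_5 -> Prop) : Q v0 -> Q v1 -> Q v2 -> Q v3 -> Q v4 ->
  forall k, Q k.
Proof.
move=> q0 q1 q2 q3 q4 [[|[|[|[|[|k]]]]] hk] //;
by rewrite (bool_irrelevance hk isT).
Qed.

Lemma ordS5 : [/\ ordS v0 = v1, ordS v1 = v2, ordS v2 = v3, ordS v3 = v4 & ordS v4 = v0].
Proof. by split; apply/val_inj. Qed.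

(** * Strictly convex pentagons as intersections of half-planes *)

Section Convex.
Context {R : realType}.
Implicit Types (p q z m u w : plane R) (s : R) (P : polygon R 5).

(** Every other vertex, and not only the next one, lies strictly on one side of each side line;
    turning always the same way would also allow a pentagram. *)
Definition sconvex s P := s * s = 1 /\
  forall k j, j != k -> j != ordS k -> 0 < s * turn (P k) (P (ordS k)) (P j).

Definition openhull s P : set (plane R) :=
  [set z | forall k, 0 < s * turn (P k) (P (ordS k)) z].

Definition closedhull s P : set (plane R) :=
  [set z | forall k, 0 <= s * turn (P k) (P (ordS k)) z].

Lemma turn_vertex_ge0 s P k j : sconvex s P -> 0 <= s * turn (P k) (P (ordS k)) (P j).
Proof.
move=> [_ cv]; have [->|jk] := eqVneq j k.
  by rewrite turn_l mulr0.
have [->|jk'] := eqVneq j (ordS k).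
  by rewrite turn_r mulr0.
exact/ltW/cv.
Qed.

Lemma region_closedhull s P : sconvex s P -> region P `<=` closedhull s P.
Proof.
move=> cv z Pz k.
pose p := P k; pose q := P (ordS k).
pose m : plane R := (s * (q.2 - p.2), - (s * (q.1 - p.1))).
have E x : s * turn p q x = dot m p - dot m x.
  by rewrite /turn /cross /dot /m /=; ring.
rewrite E subr_ge0; apply: (region_halfplane _ Pz) => j.
by rewrite -subr_ge0 -E turn_vertex_ge0.
Qed.

Lemma edge_turn0 P k z : edge P k z -> turn (P k) (P (ordS k)) z = 0.
Proof.
by move=> /segmentP[t [_ _ h1 h2]]; rewrite /turn /cross /= h1 h2; ring.
Qed.

Let frac2 (T x p q e : R) : T != 0 -> T * (x - p) = e * (q - p) ->
  x = (1 - e / T) * p + e / T * q.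
Proof.
move=> Tn E; have Ex : x = p + T * (x - p) / T by field.
by rewrite Ex E; field.
Qed.

(** On the line of side [k], the half-planes of the previous and of the next side cut out exactly
    the segment: they bound the parameter of [z] by 0 and by 1. *)
Lemma closedhull_edge s P k z : sconvex s P -> closedhull s P z ->
  turn (P k) (P (ordS k)) z = 0 -> edge P k z.
Proof.
move=> [ss cv] hz h0.
have h1 : 0 < s * turn (P k) (P (ordS k)) (P (ordS2 k)).
  by apply: cv; move: k {h0}; apply: I5P.
have h2 : 0 < s * turn (P (ord_pred k)) (P k) (P (ordS k)).
  rewrite -{2}(ord_predK k); apply: cv; last rewrite ord_predK;
  by move: k {h0 h1}; apply: I5P.
have := hz (ordS k); have := hz (ord_pred k); rewrite ord_predK.
move: h0 h1 h2.
set o := P (ord_pred k); set p := P k; set q := P (ordS k); set r := P _.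
move=> h0 h1 h2 h3 h4; pose T := s * turn o p q.
have Tn : T != 0 by rewrite gt_eqF.
apply/segmentP; exists (s * turn o p z / T); rewrite -/p -/q.
have E1 : T * (z.1 - p.1) = s * turn o p z * (q.1 - p.1).
  have : T * (z.1 - p.1) - s * turn o p z * (q.1 - p.1) = s * turn p q z * (o.1 - p.1).
    by rewrite /T /turn /cross /=; ring.
  by rewrite h0 mulr0 mul0r => /eqP; rewrite subr_eq0 => /eqP.
have E2 : T * (z.2 - p.2) = s * turn o p z * (q.2 - p.2).
  have : T * (z.2 - p.2) - s * turn o p z * (q.2 - p.2) = s * turn p q z * (o.2 - p.2).
    by rewrite /T /turn /cross /=; ring.
  by rewrite h0 mulr0 mul0r => /eqP; rewrite subr_eq0 => /eqP.
have z1 : z.1 = (1 - s * turn o p z / T) * p.1 + s * turn o p z / T * q.1.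
  exact: frac2.
have z2 : z.2 = (1 - s * turn o p z / T) * p.2 + s * turn o p z / T * q.2.
  exact: frac2.
split => //; first by rewrite divr_ge0 // ltW.
have : s * turn q r z = (1 - s * turn o p z / T) * (s * turn p q r).
  move: (_ / T) z1 z2 => t z1 z2.
  by rewrite /turn /cross /= z1 z2; ring.
move=> E; rewrite -subr_ge0 -(pmulr_lge0 _ h1) -E //.
Qed.

(** Sign tests against the two diagonals from [P v0] tell in which triangle of the fan [z] lies.
    This bounds the closed hull. *)
Lemma closedhull_fan s P z : sconvex s P -> closedhull s P z ->
  [\/ hull3 (P v0) (P v1) (P v2) z, hull3 (P v0) (P v2) (P v3) z |
      hull3 (P v0) (P v3) (P v4) z].
Proof.
move=> [ss cv] hz.
have := cv v0 v2 isT isT; have := cv v2 v0 isT isT; have := cv v3 v0 isT isT.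
have := hz v0; have := hz v1; have := hz v2; have := hz v3; have := hz v4.
case: ordS5 => -> -> -> -> -> h4 h3 h2 h1 h0 c3 c2 c0.
have opp p q : s * turn p q z = - (s * turn q p z).
  by rewrite /turn /cross /=; ring.
have rot p q r : turn p q r = turn q r p by rewrite /turn /cross /=; ring.
have [g2|/ltW g2] := lerP (s * turn (P v0) (P v2) z) 0.
  by constructor 1; apply: (@turn_hull3 _ s) => //; rewrite opp oppr_ge0.
have [g3|/ltW g3] := lerP (s * turn (P v0) (P v3) z) 0.
  constructor 2; apply: (@turn_hull3 _ s) => //; first by rewrite rot.
  by rewrite opp oppr_ge0.
by constructor 3; apply: (@turn_hull3 _ s) => //; rewrite rot.
Qed.

Lemma openhull_closedhull s P : openhull s P `<=` closedhull s P.
Proof. by move=> z hz k; exact/ltW/hz. Qed.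

Lemma openhull_boundary s P z : openhull s P z -> ~ boundary P z.
Proof.
move=> hz [k _ /edge_turn0 e]; have := hz k.
by rewrite e mulr0 ltxx.
Qed.

Lemma closedhull_cases s P z : sconvex s P -> closedhull s P z ->
  openhull s P z \/ boundary P z.
Proof.
move=> cv hz; have [|nb] := pselect (boundary P z); first by right.
left=> k; rewrite lt_neqAle hz andbT; apply/eqP => /esym/eqP.
rewrite mulf_eq0; case/orP => /eqP h.
  by case: cv => + _; rewrite h mul0r => /esym/eqP; rewrite oner_eq0.
by apply: nb; exists k => //; exact: (closedhull_edge cv).
Qed.

Lemma scaled_turnE s p q z : s * turn p q z = affine (- s * (q.2 - p.2))
  (s * (q.1 - p.1)) (s * ((q.2 - p.2) * p.1 - (q.1 - p.1) * p.2)) z.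
Proof. by rewrite turnE /affine; ring. Qed.

Lemma open_turn_gt0 s p q : open [set z | 0 < s * turn p q z].
Proof.
have -> : [set z | 0 < s * turn p q z] = [set z | 0 < affine (- s * (q.2 - p.2))
    (s * (q.1 - p.1)) (s * ((q.2 - p.2) * p.1 - (q.1 - p.1) * p.2)) z].
  by apply/funext => z /=; rewrite scaled_turnE.
exact: open_affine_gt0.
Qed.

Lemma closed_turn_ge0 s p q : closed [set z | 0 <= s * turn p q z].
Proof.
have -> : [set z | 0 <= s * turn p q z] = [set z | 0 <= affine (- s * (q.2 - p.2))
    (s * (q.1 - p.1)) (s * ((q.2 - p.2) * p.1 - (q.1 - p.1) * p.2)) z].
  by apply/funext => z /=; rewrite scaled_turnE.
exact: closed_affine_ge0.
Qed.

Lemma open_openhull s P : open (openhull s P).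
Proof.
rewrite openE => z hz.
have h k : nbhs z [set z | 0 < s * turn (P k) (P (ordS k)) z].
  by apply: open_nbhs_nbhs; split; [exact: open_turn_gt0|exact: hz].
exact: (filter_forall _ h).
Qed.

Lemma closed_closedhull s P : closed (closedhull s P).
Proof.
have -> : closedhull s P = \bigcap_(k in [set: 'I_5])
    [set z | 0 <= s * turn (P k) (P (ordS k)) z].
  by apply/seteqP; split=> [z hz k _|z hz k]; exact: hz.
exact: (closed_bigI (fun k _ => closed_turn_ge0 (p := P k) (q := P (ordS k)))).
Qed.

Lemma bounded_closedhull s P : sconvex s P -> bounded_set (closedhull s P).
Proof.
move=> cv; apply/bounded_setP.
pose M := \sum_k (`|(P k).1| + `|(P k).2|).
have b k : `|(P k).1| <= M /\ `|(P k).2| <= M.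
  rewrite /M (bigD1 k) //=.
  have : 0 <= \sum_(i < 5 | i != k) (`|(P i).1| + `|(P i).2|).
    by apply: sumr_ge0 => i _; rewrite addr_ge0.
  by have := normr_ge0 (P k).1; have := normr_ge0 (P k).2; split; lra.
exists M => z /(closedhull_fan cv) [] h; apply: (hull3_bound h);
by [exact: (b _).1|exact: (b _).2].
Qed.

(** Off the boundary the open and the closed hull agree, so the open hull is both open and closed
    there. The component of one of its points therefore stays in it and is bounded. *)
Lemma inside_openhull s P : sconvex s P -> inside P = openhull s P.
Proof.
move=> cv; apply/seteqP; split=> z.
  move=> [nb hb]; have /(closedhull_cases cv)[//|//] : closedhull s P z.
  by apply: (region_closedhull cv); left.
move=> hz; have nb := openhull_boundary hz; split=> //.
set C := connected_component _ _.
have CB : C `<=` ~` boundary P by exact: connected_component_sub.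
have CK : C `&` openhull s P = C.
  apply: component_connected.
  - by exists z; split=> //; exact: connected_component_refl.
  - by exists (openhull s P) => //; exact: open_openhull.
  - exists (closedhull s P); first exact: closed_closedhull.
    apply/seteqP; split=> x [Cx hx]; split=> //; first exact: openhull_closedhull.
    by have /CB := Cx; case: (closedhull_cases cv hx).
have [M HM] := (bounded_setP _).1 (bounded_closedhull cv).
apply/bounded_setP; exists M => x; rewrite -CK => -[_ hx].
exact/HM/openhull_closedhull.
Qed.

Lemma region_convex s P : sconvex s P -> region P = closedhull s P.
Proof.
move=> cv; apply/seteqP; split; first exact: region_closedhull.
by move=> z /(closedhull_cases cv)[h|]; [left; rewrite (inside_openhull cv)|right].
Qed.

End Convex.

(** * Areas of triangles and convex pentagons *)

Section Integral.
Context {R : realType}.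
Notation mu := (@lebesgue_measure R).

Lemma integral_affine (p q a b : R) : a <= b ->
  (\int[mu]_(x in `]a, b[) (p * x + q)%:E = (p * (b ^+ 2 - a ^+ 2) / 2 + q * (b - a))%:E)%E.
Proof.
rewrite le_eqVlt => /predU1P[->|ab].
  rewrite set_itv_ge ?bnd_simp ?ltxx // integral_set0.
  by congr EFin; ring.
pose f (x : R) : R := p * x + q.
have cf : continuous f.
  move=> x; apply: cvgD; last exact: cvg_cst.
  by apply: cvgMl_tmp; exact: cvg_id.
have mf : measurable_fun `]a, b[ (EFin \o f).
  apply/measurable_EFinP; apply: measurable_funTS.
  exact: continuous_measurable_fun.
rewrite -(integral_itv_bndoo true false mf).
pose F (x : R) : R := p / 2 * x ^+ 2 + q * x.
have dF (x : R) : is_derive x (1 : R) F (p * x + q).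
  apply: is_derive_eq; rewrite /GRing.scale /=; lra.
rewrite (@continuous_FTC2 _ _ F) //.
- by rewrite /F -EFinB; congr EFin; ring.
- exact: continuous_subspaceT.
- have cF : continuous F.
    move=> x; apply: differentiable_continuous.
    by apply/derivable1_diffP; have [] := dF x.
  split.
  + by move=> x _; have [] := dF x.
  + by apply: cvg_at_right_filter; exact: cF.
  + by apply: cvg_at_left_filter; exact: cF.
- by move=> x _; rewrite derive1E; have [_ ->] := dF x.
Qed.

Definition area2 (X : set (plane R)) : \bar R := (mu \x mu)%E X.

(** Both integrals are suprema over the simple functions below the integrand, so a pointwise
    comparison of the vertical sections is enough for an arbitrary set [X]. *)
Lemma le_area2_integral (X : set (plane R)) (f : R -> \bar R) :
  (forall x, mu [set y | X (x, y)] <= f x)%E -> (area2 X <= \int[mu]_x f x)%E.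
Proof.
move=> h; rewrite /area2 /product_measure1.
have E x : xsection X x = [set y | X (x, y)].
  by apply/seteqP; split => y; rewrite /xsection /= inE.
have h0 x : (0 <= (mu \o xsection X) x)%E by [].
have f0 x : (0 <= f x)%E by apply: le_trans (h x); exact: measure_ge0.
rewrite !ge0_integralTE //.
apply: ereal_sup_le => _ [g gX <-]; exists g => //= x.
by apply: (le_trans (gX x)); rewrite /= E.
Qed.

Lemma integral_le_area2 (X : set (plane R)) (f : R -> \bar R) :
  (forall x, 0 <= f x <= mu [set y | X (x, y)])%E -> (\int[mu]_x f x <= area2 X)%E.
Proof.
move=> h; rewrite /area2 /product_measure1.
have E x : xsection X x = [set y | X (x, y)].
  by apply/seteqP; split => y; rewrite /xsection /= inE.
have h0 x : (0 <= (mu \o xsection X) x)%E by [].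
have f0 x : (0 <= f x)%E by case/andP: (h x).
rewrite !ge0_integralTE //.
apply: ereal_sup_le => _ [g gX <-]; exists g => //= x.
by apply: (le_trans (gX x)); rewrite /= E; case/andP: (h x).
Qed.

(** [mu] is the restriction of an outer measure, and an outer measure is monotone on all sets. *)
Lemma le_mu (A B : set R) : A `<=` B -> (mu A <= mu B)%E.
Proof.
rewrite /lebesgue_measure /lebesgue_stieltjes_measure /measure_extension => AB.
exact: (@le_mu_ext _ _ R (wlength idfun) A B AB).
Qed.

Lemma le_area2 (X Y : set (plane R)) : X `<=` Y -> (area2 X <= area2 Y)%E.
Proof.
move=> XY; rewrite [X in (_ <= X)%E]/area2 /product_measure1.
apply: le_area2_integral => x; apply: le_mu => y; rewrite /xsection /= inE.
exact: XY.
Qed.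

Lemma sign_cases (s : R) : s * s = 1 -> s = 1 \/ s = -1.
Proof.
move=> /eqP; rewrite -expr2 sqrf_eq1 => /orP[/eqP->|/eqP->]; by [left|right].
Qed.

Lemma strip_le (X : set R) (s lo hi : R) : s * s = 1 -> lo <= hi ->
  (forall y, X y -> lo <= s * y <= hi) -> (mu X <= (hi - lo)%:E)%E.
Proof.
move=> /sign_cases ss lh h.
have {ss} [t Xt] : exists t, X `<=` `[t, t + (hi - lo)].
  case: ss h => -> h.
    by exists lo => y /h; rewrite /= in_itv /= => /andP[]; lra.
  by exists (- hi) => y /h; rewrite /= in_itv /= => /andP[]; lra.
apply: (le_trans (le_mu Xt)); rewrite lebesgue_measure_itv /= lte_fin.
by case: ifPn => _; rewrite -?EFinD lee_fin; lra.
Qed.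

Lemma strip_ge (X : set R) (s lo hi : R) : s * s = 1 ->
  (forall y, lo < s * y < hi -> X y) -> ((hi - lo)%:E <= mu X)%E.
Proof.
move=> /sign_cases ss h.
have [lh|lh] := leP hi lo.
  by apply: (@le_trans _ _ 0%E); rewrite ?measure_ge0 // lee_fin; lra.
have {ss} [t Xt] : exists t, `]t, t + (hi - lo)[ `<=` X.
  case: ss h => -> h.
    by exists lo => y; rewrite /= in_itv /= => /andP[? ?]; apply: h; lra.
  by exists (- hi) => y; rewrite /= in_itv /= => /andP[? ?]; apply: h; lra.
apply: le_trans (le_mu Xt); rewrite lebesgue_measure_itv /= lte_fin.
by case: ifPn => h2; rewrite -?EFinD lee_fin; lra.
Qed.

Lemma integral_ramp (p x0 a b : R) (A : set R) : measurable A -> a <= b ->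
  (\int[mu]_(x in A) (p * (x - x0))%:E = \int[mu]_(x in `]a, b[) (p * (x - x0))%:E)%E ->
  (\int[mu]_x ((fun x => (p * (x - x0))%:E) \_ A) x)%E =
  (p * ((b - x0) ^+ 2 - (a - x0) ^+ 2) / 2)%:E.
Proof.
move=> mA ab E; rewrite -integral_mkcond E.
under eq_integral do rewrite mulrBr -mulrN.
by rewrite integral_affine //; congr EFin; field.
Qed.

Lemma measurable_ramp (p x0 : R) (A : set R) : measurable A ->
  measurable_fun setT ((fun x => (p * (x - x0))%:E) \_ A).
Proof.
move=> mA; apply/(measurable_restrict _ mA measurableT); rewrite setTI.
apply/measurable_EFinP; apply: measurable_funTS.
apply: continuous_measurable_fun => x; apply: cvgMl_tmp.
by apply: cvgB; [exact: cvg_id|exact: cvg_cst].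
Qed.

Lemma integral_ramp_itv (p x0 a b : R) (b0 b1 : bool) : a <= b ->
  (\int[mu]_x ((fun x => (p * (x - x0))%:E) \_ [set` Interval (BSide b0 a) (BSide b1 b)]) x)%E =
  (p * ((b - x0) ^+ 2 - (a - x0) ^+ 2) / 2)%:E.
Proof.
move=> ab; apply: integral_ramp => //.
apply: integral_itv_bndoo.
apply/measurable_EFinP; apply: measurable_funTS.
apply: continuous_measurable_fun => x; apply: cvgMl_tmp.
by apply: cvgB; [exact: cvg_id|exact: cvg_cst].
Qed.

End Integral.

Section TriangleArea.
Context {R : realType}.
Notation mu := (@lebesgue_measure R).
Implicit Types (a b c z : plane R) (s : R).

(** Areas are bounded above by covering with closed triangles and below by packing disjoint open
    triangles, which disposes of the common sides. *)
Definition ctri s a b c : set (plane R) :=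
  [set z | [/\ 0 <= s * turn a b z, 0 <= s * turn b c z & 0 <= s * turn c a z]].

Definition otri s a b c : set (plane R) :=
  [set z | [/\ 0 < s * turn a b z, 0 < s * turn b c z & 0 < s * turn c a z]].

Lemma turn_rot a b c : turn a b c = turn b c a.
Proof. by rewrite /turn /cross /=; ring. Qed.

Lemma turn_swap a b c : turn a b c = - turn b a c.
Proof. by rewrite /turn /cross /=; ring. Qed.

Let slope a b : R := (b.2 - a.2) / (b.1 - a.1).
Let lineat a b x : R := a.2 + slope a b * (x - a.1).

Let turn_line a b x y : a.1 < b.1 ->
  turn a b (x, y) = (b.1 - a.1) * (y - lineat a b x).
Proof.
move=> ab; rewrite /turn /cross /lineat /slope /=; field.
by rewrite gt_eqF // subr_gt0.
Qed.

Let le_pmul (k u v : R) : 0 < k -> 0 <= k * (u - v) -> v <= u.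
Proof. by move=> k0; rewrite pmulr_rge0 // subr_ge0. Qed.

Let turn_diff1 a b c x : a.1 < b.1 -> a.1 < c.1 ->
  lineat a c x - lineat a b x =
  turn a b c / ((b.1 - a.1) * (c.1 - a.1)) * (x - a.1).
Proof.
move=> ab ac; rewrite /turn /cross /lineat /slope /=; field.
by rewrite !gt_eqF ?subr_gt0.
Qed.

Let turn_diff2 a b c x : b.1 < c.1 -> a.1 < c.1 ->
  lineat a c x - lineat b c x =
  turn a b c / ((c.1 - b.1) * (c.1 - a.1)) * (c.1 - x).
Proof.
move=> ab ac; rewrite /turn /cross /lineat /slope /=; field.
by rewrite !gt_eqF ?subr_gt0.
Qed.

Let turn_diff3 a b c : a.1 < c.1 ->
  lineat a c b.1 - b.2 = turn a b c / (c.1 - a.1).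
Proof.
move=> ac; rewrite /turn /cross /lineat /slope /=; field.
by rewrite !gt_eqF ?subr_gt0.
Qed.

Let sorted_lt s a b c : 0 < s * turn a b c -> a.1 <= b.1 -> b.1 <= c.1 -> a.1 < c.1.
Proof.
move=> T0 ab bc; rewrite ltNge; apply/negP => ca.
have eb : b.1 = a.1 by lra.
have ec : c.1 = a.1 by lra.
suff E : turn a b c = 0 by move: T0; rewrite E mulr0 ltxx.
by rewrite /turn /cross /= eb ec; ring.
Qed.

Let ramp_ge0 (T k u w : R) : 0 < T -> 0 <= k -> 0 <= u -> 0 <= w ->
  0 <= T / (k * u) * w.
Proof.
move=> T0 k0 u0 w0; apply: mulr_ge0 => //; apply: divr_ge0; first exact: ltW.
exact: mulr_ge0.
Qed.

Let total s a b c : a.1 <= b.1 -> b.1 <= c.1 -> a.1 < c.1 ->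
  (s * turn a b c / ((b.1 - a.1) * (c.1 - a.1)) *
     ((b.1 - a.1) ^+ 2 - (a.1 - a.1) ^+ 2) / 2) +
  (- (s * turn a b c / ((c.1 - b.1) * (c.1 - a.1))) *
     ((c.1 - c.1) ^+ 2 - (b.1 - c.1) ^+ 2) / 2) = s * turn a b c / 2.
Proof.
move=> ab bc ac; rewrite !subrr expr0n /= subr0 sub0r.
have e1 : s * turn a b c / ((b.1 - a.1) * (c.1 - a.1)) * (b.1 - a.1) ^+ 2 =
    s * turn a b c * ((b.1 - a.1) / (c.1 - a.1)).
  have [->|n] := eqVneq b.1 a.1; first by rewrite subrr !mul0r expr0n /= !mulr0.
  by field; rewrite gt_eqF ?subr_gt0 // subr_eq0 n.
have e2 : s * turn a b c / ((c.1 - b.1) * (c.1 - a.1)) * (b.1 - c.1) ^+ 2 =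
    s * turn a b c * ((c.1 - b.1) / (c.1 - a.1)).
  have [->|n] := eqVneq b.1 c.1; first by rewrite subrr !mul0r expr0n /= !mulr0.
  by field; rewrite gt_eqF ?subr_gt0 // subr_eq0 eq_sym n.
rewrite e1 mulrNN e2; field.
by rewrite gt_eqF ?subr_gt0.
Qed.

Let turn_conv a b c z : (b.1 - a.1) * turn b c z =
  (c.1 - b.1) * turn a b z + turn a b c * (b.1 - z.1).
Proof. by rewrite /turn /cross /=; ring. Qed.

Let otri_sorted s a b c : s * s = 1 -> 0 < s * turn a b c ->
  a.1 <= b.1 -> b.1 <= c.1 ->
  ((s * turn a b c / 2)%:E <= area2 (otri s a b c))%E.
Proof.
move=> ss T0 ab bc; have ac := sorted_lt T0 ab bc.
(* On each side of the abscissa of [b] the vertical section has a length affine in [x], vanishing at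
   [a.1] and at [c.1] respectively. If [b] has the same abscissa as [a] or [c], the corresponding
   ramp lives on an empty interval. *)
pose H1 (x : R) : \bar R := (s * turn a b c / ((b.1 - a.1) * (c.1 - a.1)) * (x - a.1))%:E.
pose H2 (x : R) : \bar R := (- (s * turn a b c / ((c.1 - b.1) * (c.1 - a.1))) * (x - c.1))%:E.
pose f x := ((H1 \_ `]a.1, b.1[) x + (H2 \_ `]b.1, c.1[) x)%E.
have p0 x : (0 <= (H1 \_ `]a.1, b.1[) x)%E.
  rewrite patchE; case: ifPn => //; rewrite inE /= in_itv /= => /andP[h1 h2].
  by rewrite lee_fin; apply: ramp_ge0 => //; lra.
have q0 x : (0 <= (H2 \_ `]b.1, c.1[) x)%E.
  rewrite patchE; case: ifPn => //; rewrite inE /= in_itv /= => /andP[h1 h2].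
  by rewrite lee_fin mulNr -mulrN; apply: ramp_ge0 => //; lra.
have -> : ((s * turn a b c / 2)%:E = \int[mu]_x f x)%E.
  rewrite ge0_integralD //; [|exact: measurable_ramp|exact: measurable_ramp].
  by rewrite !integral_ramp_itv // -EFinD total.
apply: integral_le_area2 => x; apply/andP; split; first exact: adde_ge0.
rewrite /f !patchE; case: ifPn => [|h1].
  rewrite inE /= in_itv /= => /andP[h1 h2]; rewrite ifF ?adde0; last first.
    by apply/negbTE/negP; rewrite inE /= in_itv /= => /andP[]; lra.
  have ab' : a.1 < b.1 by lra.
  have -> : H1 x = (s * lineat a c x - s * lineat a b x)%:E.
    by rewrite /H1 -mulrBr turn_diff1 // !mulrA.
  apply: (strip_ge ss) => y /andP[y1 y2].
  have t1 : 0 < s * turn a b (x, y).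
    by rewrite turn_line // mulrCA mulr_gt0 ?subr_gt0 //; lra.
  split => //; last first.
    by rewrite turn_swap turn_line // -mulrN mulrCA mulr_gt0 ?subr_gt0 //; lra.
  rewrite -(pmulr_rgt0 _ (_ : 0 < b.1 - a.1)) ?subr_gt0 //.
  rewrite mulrCA turn_conv -/(turn a b c) mulrDr ltr_wpDl //.
    by rewrite mulrCA mulr_ge0 ?subr_ge0 // ltW.
  by rewrite mulrA mulr_gt0 // subr_gt0.
rewrite add0e; case: ifPn => [|_]; last exact: measure_ge0.
rewrite inE /= in_itv /= => /andP[h2 h3].
have bc' : b.1 < c.1 by lra.
have -> : H2 x = (s * lineat a c x - s * lineat b c x)%:E.
  by rewrite /H2 -mulrBr turn_diff2 // !mulrA; congr EFin; ring.
apply: (strip_ge ss) => y /andP[y1 y2].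
have t1 : 0 < s * turn b c (x, y).
  by rewrite turn_line // mulrCA mulr_gt0 ?subr_gt0 //; lra.
split => //; last first.
  by rewrite turn_swap turn_line // -mulrN mulrCA mulr_gt0 ?subr_gt0 //; lra.
rewrite -(pmulr_rgt0 _ (_ : 0 < c.1 - b.1)) ?subr_gt0 //.
rewrite mulrCA; have -> : (c.1 - b.1) * turn a b (x, y) =
    (b.1 - a.1) * turn b c (x, y) + turn a b c * (x - b.1).
  by rewrite turn_conv /=; ring.
rewrite mulrDr ltr_wpDl //.
  by rewrite mulrCA mulr_ge0 ?subr_ge0 // ltW.
by rewrite mulrA mulr_gt0 // subr_gt0.
Qed.

Let hull3_range a b c z : hull3 a b c z -> a.1 <= b.1 -> b.1 <= c.1 ->
  a.1 <= z.1 <= c.1.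
Proof.
move=> [x [y [w [x0 y0 w0 e [-> _]]]]] ab bc.
have -> : x = 1 - y - w by lra.
have : 0 <= y * (b.1 - a.1) by apply: mulr_ge0; lra.
have : 0 <= w * (c.1 - a.1) by apply: mulr_ge0; lra.
have : 0 <= (1 - y - w) * (c.1 - a.1) by apply: mulr_ge0; lra.
have : 0 <= y * (c.1 - b.1) by apply: mulr_ge0; lra.
by move=> *; apply/andP; split; lra.
Qed.

Let ctri_sorted s a b c : s * s = 1 -> 0 < s * turn a b c ->
  a.1 <= b.1 -> b.1 <= c.1 ->
  (area2 (ctri s a b c) <= (s * turn a b c / 2)%:E)%E.
Proof.
move=> ss T0 ab bc; have ac := sorted_lt T0 ab bc.
pose H1 (x : R) : \bar R := (s * turn a b c / ((b.1 - a.1) * (c.1 - a.1)) * (x - a.1))%:E.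
pose H2 (x : R) : \bar R := (- (s * turn a b c / ((c.1 - b.1) * (c.1 - a.1))) * (x - c.1))%:E.
(* At the abscissa of [b] a vertical side makes the slope of a ramp meaningless, so this one section
   gets its own bound; it contributes nothing to the integral. *)
pose H (x : R) : \bar R := (s * turn a b c / (c.1 - a.1))%:E.
pose f x := ((H1 \_ `[a.1, b.1[) x + (H2 \_ `]b.1, c.1]) x + (H \_ [set b.1]) x)%E.
have p0 x : (0 <= (H1 \_ `[a.1, b.1[) x)%E.
  rewrite patchE; case: ifPn => //; rewrite inE /= in_itv /= => /andP[h1 h2].
  by rewrite lee_fin; apply: ramp_ge0 => //; lra.
have q0 x : (0 <= (H2 \_ `]b.1, c.1]) x)%E.
  rewrite patchE; case: ifPn => //; rewrite inE /= in_itv /= => /andP[h1 h2].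
  by rewrite lee_fin mulNr -mulrN; apply: ramp_ge0 => //; lra.
have r0 x : (0 <= (H \_ [set b.1]) x)%E.
  rewrite patchE; case: ifPn => //; rewrite inE /= => h1.
  by rewrite lee_fin; apply: divr_ge0; lra.
have mH : measurable_fun setT (H \_ [set b.1]).
  apply/(measurable_restrict _ _ measurableT) => //; exact: measurable_cst.
have <- : (\int[mu]_x f x = (s * turn a b c / 2)%:E)%E.
  rewrite ge0_integralD //; last 2 first.
  - by move=> x _; exact: adde_ge0.
  - by apply: emeasurable_funD; exact: measurable_ramp.
  rewrite ge0_integralD //; [|exact: measurable_ramp|exact: measurable_ramp].
  rewrite !integral_ramp_itv // -EFinD total // -integral_mkcond.
  by rewrite integral_set1 adde0.
apply: le_area2_integral => x; rewrite /f !patchE.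
have key y : ctri s a b c (x, y) -> s * y <= s * lineat a c x.
  move=> [_ _]; rewrite turn_swap turn_line // -mulrN mulrCA opprB mulrBr.
  by move=> h; apply: (le_pmul _ h); rewrite subr_gt0.
have range y : ctri s a b c (x, y) -> a.1 <= x <= c.1.
  by move=> [h1 h2 h3]; exact: (hull3_range (turn_hull3 T0 h1 h2 h3) ab bc).
have [xb|xb|xb] := ltgtP x b.1.
- rewrite [X in (_ <= _ + X + _)%E]ifF; last first.
    by apply/negbTE/negP; rewrite inE /= in_itv /= => /andP[]; lra.
  rewrite [X in (_ <= _ + _ + X)%E]ifF; last first.
    by apply/negbTE/negP; rewrite inE /=; lra.
  rewrite !adde0; case: ifPn => [|h1].
    rewrite inE /= in_itv /= => /andP[h1 _]; have ab' : a.1 < b.1 by lra.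
    have E : s * turn a b c / ((b.1 - a.1) * (c.1 - a.1)) * (x - a.1)
        = s * lineat a c x - s * lineat a b x.
      by rewrite -mulrBr turn_diff1 // !mulrA.
    rewrite /H1 E; apply: (strip_le ss).
      by rewrite -subr_ge0 -E; apply: ramp_ge0 => //; lra.
    move=> y h; rewrite (key _ h) andbT; case: h => + _ _.
    rewrite turn_line // mulrCA mulrBr => h; apply: (le_pmul _ h); lra.
  have {}h1 : x < a.1.
    by move: h1; rewrite notin_setE /= in_itv /= xb andbT => /negP; rewrite -ltNge.
  rewrite (_ : [set y | _] = set0) ?measure0 //.
  by apply/seteqP; split => // y /= /range; lra.
- rewrite [X in (X + _ + _)%E]ifF; last first.
    by apply/negbTE/negP; rewrite inE /= in_itv /= => /andP[]; lra.
  rewrite [X in (_ <= _ + _ + X)%E]ifF; last first.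
    by apply/negbTE/negP; rewrite inE /=; lra.
  rewrite adde0 add0e; case: ifPn => [|h1].
    rewrite inE /= in_itv /= => /andP[_ h1]; have bc' : b.1 < c.1 by lra.
    have E : - (s * turn a b c / ((c.1 - b.1) * (c.1 - a.1))) * (x - c.1)
        = s * lineat a c x - s * lineat b c x.
      by rewrite -mulrBr turn_diff2 // !mulrA; ring.
    rewrite /H2 E; apply: (strip_le ss).
      by rewrite -subr_ge0 -E mulNr -mulrN; apply: ramp_ge0 => //; lra.
    move=> y h; rewrite (key _ h) andbT; case: h => _ + _.
    rewrite turn_line // mulrCA mulrBr => h; apply: (le_pmul _ h); lra.
  have {}h1 : c.1 < x.
    by move: h1; rewrite notin_setE /= in_itv /= xb /= => /negP; rewrite -ltNge.
  rewrite (_ : [set y | _] = set0) ?measure0 //.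
  by apply/seteqP; split => // y /= /range; lra.
- rewrite [X in (X + _ + _)%E]ifF; last first.
    by apply/negbTE/negP; rewrite inE /= in_itv /= => /andP[]; lra.
  rewrite [X in (_ <= _ + X + _)%E]ifF; last first.
    by apply/negbTE/negP; rewrite inE /= in_itv /= => /andP[]; lra.
  rewrite ifT; last by rewrite inE.
  have E : s * turn a b c / (c.1 - a.1) = s * lineat a c x - s * b.2.
    by rewrite xb -mulrBr turn_diff3 // !mulrA.
  rewrite !add0e /H E; apply: (strip_le ss).
    by rewrite -subr_ge0 -E; apply: divr_ge0; lra.
  move=> y h; rewrite (key _ h) andbT; case: h => h1 h2 _.
  have [ab'|ba] := ltP a.1 b.1.
    have : 0 <= (b.1 - a.1) * (s * y - s * b.2).
      by move: h1; rewrite /turn /cross /= xb; lra.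
    by move=> h; apply: (le_pmul _ h); lra.
  have : 0 <= (c.1 - b.1) * (s * y - s * b.2).
    by move: h2; rewrite /turn /cross /= xb; lra.
  by move=> h; apply: (le_pmul _ h); lra.
Qed.

Let otri_rot s a b c : otri s a b c = otri s b c a.
Proof. by apply/seteqP; split=> z []. Qed.

Let ctri_rot s a b c : ctri s a b c = ctri s b c a.
Proof. by apply/seteqP; split=> z []. Qed.

Let otri_swap s a b c : otri s a b c = otri (- s) b a c.
Proof.
have e p q z : - s * turn q p z = s * turn p q z.
  by rewrite (turn_swap q) mulrNN.
apply/funext => z; apply/propext; rewrite /otri /= !e.
by split=> -[? ? ?]; split.
Qed.

Let ctri_swap s a b c : ctri s a b c = ctri (- s) b a c.
Proof.
have e p q z : - s * turn q p z = s * turn p q z.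
  by rewrite (turn_swap q) mulrNN.
apply/funext => z; apply/propext; rewrite /ctri /= !e.
by split=> -[? ? ?]; split.
Qed.

(** Rotating the vertices changes nothing and exchanging two of them turns [s] into [- s], so the
    vertices may be sorted by abscissa. *)
Lemma area_tri s a b c : s * s = 1 -> 0 < s * turn a b c ->
  (area2 (ctri s a b c) <= (s * turn a b c / 2)%:E)%E /\
  ((s * turn a b c / 2)%:E <= area2 (otri s a b c))%E.
Proof.
pose Q s a b c := s * s = 1 -> 0 < s * turn a b c ->
  (area2 (ctri s a b c) <= (s * turn a b c / 2)%:E)%E /\
  ((s * turn a b c / 2)%:E <= area2 (otri s a b c))%E.
have main s' p q r : p.1 <= q.1 -> q.1 <= r.1 -> Q s' p q r.
  by move=> pq qr ss T0; split; [exact: ctri_sorted|exact: otri_sorted].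
have rot s' p q r : Q s' q r p -> Q s' p q r.
  by rewrite /Q -turn_rot -otri_rot -ctri_rot.
have swap s' p q r : Q (- s') q p r -> Q s' p q r.
  by rewrite /Q -otri_swap -ctri_swap mulrNN (turn_swap p) mulrN -mulNr.
rewrite -/(Q s a b c).
have [ab|/ltW ba] := leP a.1 b.1; have [bc|/ltW cb] := leP b.1 c.1;
  have [ca|/ltW ac] := leP c.1 a.1.
- by apply/rot/rot/main.
- exact: main.
- by apply/rot/rot/main.
- by apply/swap/rot/main.
- by apply/rot/main.
- exact/swap/main.
- by apply/rot/swap/main.
- by apply/rot/swap/main.
Qed.

End TriangleArea.

Lemma sum5 (V : nmodType) (F : 'I_5 -> V) :
  \sum_k F k = F v0 + F v1 + F v2 + F v3 + F v4.
Proof.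
rewrite !big_ord_recl big_ord0 addr0 !addrA.
by congr (_ + _ + _ + _ + _); congr F; apply/val_inj.
Qed.

Section ConvexArea.
Context {R : realType}.
Notation mu := (@lebesgue_measure R).
Implicit Types (a b c d z : plane R) (s : R) (P : polygon R 5).

Let mplane (X : set (plane R)) :=
  measurable (X : set (measurableTypeR R * measurableTypeR R)%type).

Let measurable_turn s a b : measurable_fun setT
  (fun z : (measurableTypeR R * measurableTypeR R)%type => s * turn a b z : measurableTypeR R).
Proof.
have -> : (fun z : plane R => s * turn a b z) = (fun z : plane R => - s * (b.2 - a.2) * z.1 +
   s * (b.1 - a.1) * z.2 + s * ((b.2 - a.2) * a.1 - (b.1 - a.1) * a.2)).
  by apply/funext => z; rewrite scaled_turnE.
apply: measurable_funD; last exact: measurable_cst.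
apply: measurable_funD; apply: measurable_funM; try exact: measurable_cst.
  exact: measurable_fst.
exact: measurable_snd.
Qed.

Let measurable_gt0 s a b : mplane [set z | 0 < s * turn a b z].
Proof.
rewrite /mplane (_ : [set _ | _] = setT `&` (fun z => s * turn a b z) @^-1` `]0, +oo[).
  exact: measurable_turn.
by rewrite setTI; apply/seteqP; split=> z /=; rewrite in_itv /= andbT.
Qed.

Let measurable_ge0 s a b : mplane [set z | 0 <= s * turn a b z].
Proof.
rewrite /mplane (_ : [set _ | _] = setT `&` (fun z => s * turn a b z) @^-1` `[0, +oo[).
  exact: measurable_turn.
by rewrite setTI; apply/seteqP; split=> z /=; rewrite in_itv /= andbT.
Qed.

Let measurable_otri s a b c : mplane (otri s a b c).
Proof.
rewrite /mplane (_ : otri s a b c = [set z | 0 < s * turn a b z] `&`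
  [set z | 0 < s * turn b c z] `&` [set z | 0 < s * turn c a z]).
  by apply: measurableI; first apply: measurableI; exact: measurable_gt0.
by apply/seteqP; split=> z [] => [? ? ?|[]].
Qed.

Let measurable_ctri s a b c : mplane (ctri s a b c).
Proof.
rewrite /mplane (_ : ctri s a b c = [set z | 0 <= s * turn a b z] `&`
  [set z | 0 <= s * turn b c z] `&` [set z | 0 <= s * turn c a z]).
  by apply: measurableI; first apply: measurableI; exact: measurable_ge0.
by apply/seteqP; split=> z [] => [? ? ?|[]].
Qed.

Let area2U (A B : set (plane R)) : mplane A -> mplane B -> A `&` B = set0 ->
  area2 (A `|` B) = (area2 A + area2 B)%E.
Proof.
move=> mA mB AB.
exact: (@measureU _ _ _ (mu \x mu)%E _ _ mA mB AB).
Qed.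

Let mplaneU (A B : set (plane R)) : mplane A -> mplane B -> mplane (A `|` B).
Proof. exact: measurableU. Qed.

Lemma area2_ctriU s a b c a' b' c' X :
  X `<=` ctri s a b c `|` ctri s a' b' c' ->
  s * s = 1 -> 0 < s * turn a b c -> 0 < s * turn a' b' c' ->
  (area2 X <= (s * turn a b c / 2 + s * turn a' b' c' / 2)%:E)%E.
Proof.
move=> XU ss h h'; apply: (le_trans (le_area2 XU)).
apply: (@le_trans _ _ (area2 (ctri s a b c) + area2 (ctri s a' b' c'))%E).
  by apply: measureU2; exact: measurable_ctri.
by rewrite EFinD; apply: leeD; [have [] := area_tri ss h|have [] := area_tri ss h'].
Qed.

Lemma area2_ctri s a b c X : X `<=` ctri s a b c ->
  s * s = 1 -> 0 < s * turn a b c -> (area2 X <= (s * turn a b c / 2)%:E)%E.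
Proof.
by move=> XU ss h; apply: (le_trans (le_area2 XU)); have [] := area_tri ss h.
Qed.

Lemma signed_area_fan s P : s * signed_area P =
  s * turn (P v0) (P v1) (P v2) / 2 + s * turn (P v0) (P v2) (P v3) / 2 +
  s * turn (P v0) (P v3) (P v4) / 2.
Proof.
rewrite /signed_area sum5; case: ordS5 => -> -> -> -> ->.
by rewrite /turn /cross /=; field.
Qed.

(** The fan from [P v0] gives three closed triangles that cover the region and three disjoint open
    triangles inside it, with the same total area. *)
Lemma area_convex s P : sconvex s P -> area P = (s * signed_area P)%:E.
Proof.
move=> cv; have [ss cv'] := cv.
have c1 : 0 < s * turn (P v0) (P v1) (P v2).
  by have := cv' v0 v2 isT isT; case: ordS5 => ->.
have c2 : 0 < s * turn (P v0) (P v2) (P v3).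
  by have := cv' v2 v0 isT isT; case: ordS5 => _ _ ->; rewrite -turn_rot.
have c3 : 0 < s * turn (P v0) (P v3) (P v4).
  by have := cv' v3 v0 isT isT; case: ordS5 => _ _ _ -> _; rewrite -turn_rot.
have c4 : 0 < s * turn (P v0) (P v1) (P v3).
  by have := cv' v0 v3 isT isT; case: ordS5 => ->.
have [A1 B1] := area_tri ss c1; have [A2 B2] := area_tri ss c2.
have [A3 B3] := area_tri ss c3.
rewrite signed_area_fan -[LHS]/(area2 (region P)) (region_convex cv).
apply/eqP; rewrite eq_le; apply/andP; split.
  apply: (@le_trans _ _ (area2 (ctri s (P v0) (P v1) (P v2) `|`
     ctri s (P v0) (P v2) (P v3) `|` ctri s (P v0) (P v3) (P v4)))).
    apply: le_area2 => z hz.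
    have w k := hz k.
    have := w v0; have := w v1; have := w v2; have := w v3; have := w v4.
    case: ordS5 => -> -> -> -> -> h4 h3 h2 h1 h0.
    have [g2|/ltW g2] := lerP (s * turn (P v0) (P v2) z) 0.
      by left; left; split => //; rewrite turn_swap mulrN oppr_ge0.
    have [g3|/ltW g3] := lerP (s * turn (P v0) (P v3) z) 0.
      by left; right; split => //; rewrite turn_swap mulrN oppr_ge0.
    by right; split.
  rewrite !EFinD; apply: le_trans.
    by apply: measureU2; [apply: measurableU; exact: measurable_ctri|exact: measurable_ctri].
  apply: leeD => //; apply: le_trans.
    by apply: measureU2; exact: measurable_ctri.
  exact: leeD.
apply: (@le_trans _ _ (area2 (otri s (P v0) (P v1) (P v2) `|`
     otri s (P v0) (P v2) (P v3) `|` otri s (P v0) (P v3) (P v4)))).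
  set t1 := otri s _ _ _; set t2 := otri s _ _ _; set t3 := otri s _ _ _.
  have m1 : mplane t1 := measurable_otri _ _ _ _.
  have m2 : mplane t2 := measurable_otri _ _ _ _.
  have m3 : mplane t3 := measurable_otri _ _ _ _.
  have d12 : t1 `&` t2 = set0.
    apply/seteqP; split=> // z [[_ _ h] [h' _ _]].
    by move: h; rewrite turn_swap mulrN oppr_gt0 ltNge ltW.
  have d23 : t2 `&` t3 = set0.
    apply/seteqP; split=> // z [[_ _ h] [h' _ _]].
    by move: h; rewrite turn_swap mulrN oppr_gt0 ltNge ltW.
  (* The diagonal from [P v0] to [P v3] separates the first triangle of the fan from the third,
     since [P v1] and [P v2] lie on the same side of it. *)
  have d13 : t1 `&` t3 = set0.
    apply/seteqP; split=> // z [[g1 g2 h] [h' _ _]].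
    have hz : hull3 (P v0) (P v1) (P v2) z by apply: (turn_hull3 c1); exact: ltW.
    have : 0 <= s * turn (P v3) (P v0) z.
      apply: (hull3_turn hz); first by rewrite turn_r mulr0.
        by rewrite turn_rot ltW.
      by rewrite turn_rot ltW.
    by rewrite turn_swap mulrN oppr_ge0 leNgt h'.
  have d123 : (t1 `|` t2) `&` t3 = set0 by rewrite setIUl d13 d23 setU0.
  rewrite (area2U (mplaneU m1 m2) m3 d123) (area2U m1 m2 d12) !EFinD.
  exact: (leeD (leeD B1 B2) B3).
apply: le_area2 => z.
have sub i j l : 0 < s * turn (P i) (P j) (P l) -> otri s (P i) (P j) (P l) z -> closedhull s P z.
  move=> T0 [h1 h2 h3] k.
  have h : hull3 (P i) (P j) (P l) z by apply: (turn_hull3 T0); exact: ltW.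
  by apply: (hull3_turn h); exact: turn_vertex_ge0.
by move=> [[|]|]; exact: sub.
Qed.

End ConvexArea.

(** * Lhuilier's inequality *)

Section Lhuilier.
Context {R : realType}.
Implicit Types (a b e p q z w : plane R) (s l r : R).

(** The sine addition formula for the angle from [a] to [w], split at the unit vector [b]. *)
Lemma cross_unit s a b w : dot b b = 1 ->
  s * cross a w = dot a b * (s * cross b w) + s * cross a b * dot b w.
Proof.
move=> b1; rewrite -[LHS]mulr1 -b1 /dot /cross; ring.
Qed.

(** Equating the three distances gives a linear system for [c], solved by Cramer's rule; up to the
    sign [s] its determinant is the sum of the three cross products in the hypotheses, hence
    positive. *)
Let equidistant_point s e0 e2 e3 p0 p2 p3 :
  0 < s * cross e2 e3 -> 0 <= s * cross e0 e2 -> 0 <= s * cross e3 e0 ->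
  exists c r, [/\ s * cross e0 (c - p0) = r, s * cross e2 (c - p2) = r &
    s * cross e3 (c - p3) = r].
Proof.
move=> h23 h02 h30.
pose u := e0 - e2; pose v := e2 - e3; pose D := cross u v.
have Dn : D != 0.
  have : 0 < s * D.
    have -> : s * D = s * cross e0 e2 + s * cross e3 e0 + s * cross e2 e3.
      by rewrite /D /u /v /cross /=; ring.
    lra.
  by apply: contraTneq => ->; rewrite mulr0 ltxx.
pose b1 := cross e0 p0 - cross e2 p2; pose b2 := cross e2 p2 - cross e3 p3.
pose c : plane R := ((b1 * v.1 - b2 * u.1) / D, (b1 * v.2 - b2 * u.2) / D).
have h1 : cross u c = b1.
  have -> : cross u c = b1 * (D / D) by rewrite {1}/D /cross /c /=; ring.
  by rewrite divff // mulr1.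
have h2 : cross v c = b2.
  have -> : cross v c = b2 * (D / D) by rewrite {1}/D /cross /c /=; ring.
  by rewrite divff // mulr1.
exists c, (s * cross e0 (c - p0)); split => //.
- congr (_ * _); apply/eqP; rewrite eq_sym -subr_eq0; apply/eqP.
  have -> : cross e0 (c - p0) - cross e2 (c - p2) = cross u c - b1.
    by rewrite /b1 /u /cross /=; ring.
  by rewrite h1 subrr.
- congr (_ * _); apply/eqP; rewrite eq_sym -subr_eq0; apply/eqP.
  have -> : cross e0 (c - p0) - cross e3 (c - p3) = cross u c + cross v c - b1 - b2.
    by rewrite /b1 /b2 /u /v /cross /=; ring.
  by rewrite h1 h2; ring.
Qed.

(* The length of a side, from the distances of a point to the lines of that side
   and of its two neighbours. *)
Lemma side_length s d d' d'' a b e p q z l : s * s = 1 ->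
  dot b b = 1 -> s * cross a b != 0 -> s * cross b e != 0 ->
  q.1 - p.1 = l * b.1 -> q.2 - p.2 = l * b.2 ->
  s * cross a (z - p) = d -> s * cross b (z - p) = d' -> s * cross e (z - q) = d'' ->
  l = (d - dot a b * d') / (s * cross a b) + (d'' - dot b e * d') / (s * cross b e).
Proof.
move=> ss b1 ab be q1 q2 hd hd' hd''.
have h1 : d - dot a b * d' = s * cross a b * dot b (z - p).
  by rewrite -hd -hd' (cross_unit s a (z - p) b1); ring.
have h2 : d'' - dot b e * d' = s * cross b e * dot b (q - z).
  have e' : s * cross b (z - q) = d'.
    rewrite -hd' /cross /=.
    have -> : q.1 = p.1 + l * b.1 by lra.
    have -> : q.2 = p.2 + l * b.2 by lra.
    by ring.
  by rewrite -hd'' -e' (cross_unit s e (z - q) b1) /dot /cross /=; ring.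
rewrite h1 h2 ![s * cross _ _ * dot _ _]mulrC !mulfK //.
have -> : l = l * dot b b by rewrite b1 mulr1.
have -> : l * dot b b = b.1 * (l * b.1) + b.2 * (l * b.2) by rewrite /dot; ring.
by rewrite -q1 -q2 /dot /=; ring.
Qed.

(* Lhuilier's inequality: split the area from a point c at the same distance r
   from three sides; the two remaining distances r + g1, r + g4 only enter through
   squares with the favourable sign. *)
Lemma lhuilier_points s p0 p1 p2 p3 p4 e0 e1 e2 e3 e4 l0 l1 l2 l3 l4 :
  s * s = 1 ->
  p1 = (p0.1 + l0 * e0.1, p0.2 + l0 * e0.2) ->
  p2 = (p1.1 + l1 * e1.1, p1.2 + l1 * e1.2) ->
  p3 = (p2.1 + l2 * e2.1, p2.2 + l2 * e2.2) ->
  p4 = (p3.1 + l3 * e3.1, p3.2 + l3 * e3.2) ->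
  p0 = (p4.1 + l4 * e4.1, p4.2 + l4 * e4.2) ->
  dot e0 e0 = 1 -> dot e1 e1 = 1 -> dot e2 e2 = 1 -> dot e3 e3 = 1 -> dot e4 e4 = 1 ->
  0 < s * cross e4 e0 -> 0 < s * cross e0 e1 -> 0 < s * cross e1 e2 ->
  0 < s * cross e2 e3 -> 0 < s * cross e3 e4 ->
  0 <= s * cross e0 e2 -> 0 <= s * cross e3 e0 ->
  4 * ((1 - dot e4 e0) / (s * cross e4 e0) + (1 - dot e0 e1) / (s * cross e0 e1) +
       (1 - dot e1 e2) / (s * cross e1 e2) + (1 - dot e2 e3) / (s * cross e2 e3) +
       (1 - dot e3 e4) / (s * cross e3 e4)) *
    (s * ((cross p0 p1 + cross p1 p2 + cross p2 p3 + cross p3 p4 + cross p4 p0) / 2))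
  <= (l0 + l1 + l2 + l3 + l4) ^+ 2.
Proof.
move=> ss q1 q2 q3 q4 q0 u0 u1 u2 u3 u4 s0 s1 s2 s3 s4 h02 h30.
have [c [r [d0 d2 d3]]] := equidistant_point p0 p2 p3 s3 h02 h30.
have [D1 hD1] : exists d, s * cross e1 (c - p1) = d by eexists.
have [D4 hD4] : exists d, s * cross e4 (c - p4) = d by eexists.
have next e p q l : q = (p.1 + l * e.1, p.2 + l * e.2) ->
    s * cross e (c - q) = s * cross e (c - p).
  by move=> ->; rewrite /cross /=; ring.
have e1' := next _ _ _ _ q1; have e2' := next _ _ _ _ q2; have e3' := next _ _ _ _ q3.
have e4' := next _ _ _ _ q4; have e0' := next _ _ _ _ q0.
have n0 : s * cross e4 e0 != 0 by rewrite gt_eqF.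
have n1 : s * cross e0 e1 != 0 by rewrite gt_eqF.
have n2 : s * cross e1 e2 != 0 by rewrite gt_eqF.
have n3 : s * cross e2 e3 != 0 by rewrite gt_eqF.
have n4 : s * cross e3 e4 != 0 by rewrite gt_eqF.
have diff p q e l : q = (p.1 + l * e.1, p.2 + l * e.2) ->
    q.1 - p.1 = l * e.1 /\ q.2 - p.2 = l * e.2.
  by move=> -> /=; split; ring.
have [a1 b1] := diff _ _ _ _ q1; have [a2 b2] := diff _ _ _ _ q2.
have [a3 b3] := diff _ _ _ _ q3; have [a4 b4] := diff _ _ _ _ q4.
have [a0 b0] := diff _ _ _ _ q0.
have L0 := side_length ss u0 n0 n1 a1 b1 (etrans e0' hD4) d0 hD1.
have L1 := side_length ss u1 n1 n2 a2 b2 (etrans e1' d0) hD1 d2.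
have L2 := side_length ss u2 n2 n3 a3 b3 (etrans e2' hD1) d2 d3.
have L3 := side_length ss u3 n3 n4 a4 b4 (etrans e3' d2) d3 hD4.
have L4 := side_length ss u4 n4 n0 a0 b0 (etrans e4' d3) hD4 d0.
have area : s * ((cross p0 p1 + cross p1 p2 + cross p2 p3 + cross p3 p4 + cross p4 p0) / 2)
   = (l0 * r + l1 * D1 + l2 * r + l3 * r + l4 * D4) / 2.
  have tri p q e l d : q = (p.1 + l * e.1, p.2 + l * e.2) ->
      s * cross e (c - p) = d -> s * cross (p - c) (q - c) = l * d.
    by move=> -> <-; rewrite /cross /=; ring.
  rewrite -(tri _ _ _ _ _ q1 d0) -(tri _ _ _ _ _ q2 hD1) -(tri _ _ _ _ _ q3 d2).
  rewrite -(tri _ _ _ _ _ q4 d3) -(tri _ _ _ _ _ q0 hD4).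
  by rewrite /cross /=; ring.
(* A sum of cotangents of two consecutive exterior angles is the sine of their sum over the product
   of their sines. It is nonnegative because the direction turns by at most a half-turn from side 0
   to side 2; likewise from side 3 to side 0 in [K4]. *)
have K1 : 0 <= dot e0 e1 / (s * cross e0 e1) + dot e1 e2 / (s * cross e1 e2).
  have -> : dot e0 e1 / (s * cross e0 e1) + dot e1 e2 / (s * cross e1 e2) =
      (dot e0 e1 * (s * cross e1 e2) + s * cross e0 e1 * dot e1 e2) /
      ((s * cross e0 e1) * (s * cross e1 e2)).
    by field; apply/andP; move: n1 n2; rewrite !mulf_eq0 !negb_or => /andP[-> ->] /andP[].
  by rewrite -(cross_unit s e0 e2 u1) divr_ge0 // mulr_ge0 // ltW.
have K4 : 0 <= dot e3 e4 / (s * cross e3 e4) + dot e4 e0 / (s * cross e4 e0).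
  have -> : dot e3 e4 / (s * cross e3 e4) + dot e4 e0 / (s * cross e4 e0) =
      (dot e3 e4 * (s * cross e4 e0) + s * cross e3 e4 * dot e4 e0) /
      ((s * cross e3 e4) * (s * cross e4 e0)).
    by field; apply/andP; move: n4 n0; rewrite !mulf_eq0 !negb_or => /andP[-> ->] /andP[].
  by rewrite -(cross_unit s e3 e0 u4) divr_ge0 // mulr_ge0 // ltW.
rewrite area.
have T k m : 0 < s * cross k m -> dot k k = 1 -> dot m m = 1 ->
    0 <= (1 - dot k m) / (s * cross k m).
  move=> h k1 m1; apply: divr_ge0; last exact: ltW.
  have : 0 <= (k.1 - m.1) ^+ 2 + (k.2 - m.2) ^+ 2 by rewrite addr_ge0 ?sqr_ge0.
  have -> : (k.1 - m.1) ^+ 2 + (k.2 - m.2) ^+ 2 = dot k k + dot m m - 2 * dot k m.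
    by rewrite /dot; ring.
  by rewrite k1 m1; lra.
have := T _ _ s0 u4 u0; have := T _ _ s1 u0 u1; have := T _ _ s2 u1 u2.
have := T _ _ s3 u2 u3; have := T _ _ s4 u3 u4.
move: K1 K4 L0 L1 L2 L3 L4 {area T e1' e2' e3' e4' e0' hD1 hD4}.
move: n0 n1 n2 n3 n4 {s0 s1 s2 s3 s4}.
move: (s * cross e4 e0) (s * cross e0 e1) (s * cross e1 e2) (s * cross e2 e3) (s * cross e3 e4).
move: (dot e4 e0) (dot e0 e1) (dot e1 e2) (dot e2 e3) (dot e3 e4).
move=> c0 c1 c2 c3 c4 s0 s1 s2 s3 s4 n0 n1 n2 n3 n4 K1 K4 L0 L1 L2 L3 L4 t4 t3 t2 t1 t0.
set S := _ + (1 - c4) / s4.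
have S0 : 0 <= S by rewrite /S; do 4 (apply: addr_ge0 => //).
rewrite -subr_ge0.
suff -> : (l0 + l1 + l2 + l3 + l4) ^+ 2 - 4 * S * ((l0 * r + l1 * D1 + l2 * r + l3 * r + l4 * D4) / 2)
  = (l0 + l1 + l2 + l3 + l4 - 2 * r * S) ^+ 2 +
    2 * S * ((D1 - r) ^+ 2 * (c1 / s1 + c2 / s2) + (D4 - r) ^+ 2 * (c4 / s4 + c0 / s0)).
  apply: addr_ge0; first exact: sqr_ge0.
  apply: mulr_ge0; first lra.
  by apply: addr_ge0; apply: mulr_ge0 => //; exact: sqr_ge0.
have E1 : l1 = r * ((1 - c1) / s1 + (1 - c2) / s2) - (D1 - r) * (c1 / s1 + c2 / s2).
  by rewrite L1; ring.
have E4 : l4 = r * ((1 - c4) / s4 + (1 - c0) / s0) - (D4 - r) * (c4 / s4 + c0 / s0).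
  by rewrite L4; ring.
have EP : l0 + l1 + l2 + l3 + l4 = 2 * r * S +
    (D1 - r) * ((1 - c1) / s1 + (1 - c2) / s2) +
    (D4 - r) * ((1 - c4) / s4 + (1 - c0) / s0).
  by rewrite L0 L1 L2 L3 L4 /S; ring.
set A := (1 - c1) / s1 + (1 - c2) / s2 in EP E1.
set B := (1 - c4) / s4 + (1 - c0) / s0 in EP E4.
set k1 := c1 / s1 + c2 / s2 in E1 *; set k4 := c4 / s4 + c0 / s0 in E4 *.
have -> : l0 * r + l1 * D1 + l2 * r + l3 * r + l4 * D4 =
  (l0 + l1 + l2 + l3 + l4) * r + l1 * (D1 - r) + l4 * (D4 - r) by ring.
rewrite {}EP {}E1 {}E4; clearbody S A B k1 k4; by field.
Qed.

End Lhuilier.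

(** * Angles *)

Section Angle.
Context {R : realType}.
Notation mu := (@lebesgue_measure R).
Implicit Types (e f u w x : plane R) (s : R).

Definition vangle u w : R := acos (dot u w / (enorm u * enorm w)).

Lemma enorm_sqr u : enorm u * enorm u = dot u u.
Proof. by rewrite -expr2 sqr_sqrtr // dot_ge0. Qed.

Lemma enorm_ge0 u : 0 <= enorm u. Proof. exact: sqrtr_ge0. Qed.

Lemma dotC u w : dot u w = dot w u.
Proof. by rewrite /dot; ring. Qed.

Lemma vangleC u w : vangle u w = vangle w u.
Proof. by rewrite /vangle dotC [enorm u * _]mulrC. Qed.

Lemma cross_enorm_gt0 s u w : 0 < s * cross u w -> 0 < enorm u /\ 0 < enorm w.
Proof.
have z (v : plane R) : enorm v = 0 -> v.1 = 0 /\ v.2 = 0.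
  by have := enorm_sqr v; move=> + v0; rewrite v0 mul0r => /esym/dot_eq0.
move=> h; split; rewrite lt_neqAle enorm_ge0 andbT eq_sym; apply/eqP => /z[a b];
  by move: h; rewrite /cross a b !(mul0r, mulr0, subrr) ltxx.
Qed.

Lemma dot_cross_sqr u w : dot u w ^+ 2 + cross u w ^+ 2 = (enorm u * enorm w) ^+ 2.
Proof.
by rewrite exprMn !expr2 !enorm_sqr /dot /cross; ring.
Qed.

Lemma vangleP s u w : s * s = 1 -> 0 < s * cross u w ->
  [/\ 0 < vangle u w, vangle u w < pi,
      dot u w = enorm u * enorm w * cos (vangle u w) &
      s * cross u w = enorm u * enorm w * sin (vangle u w)].
Proof.
move=> ss h; have [u0 w0] := cross_enorm_gt0 h.
have n0 : 0 < enorm u * enorm w by rewrite mulr_gt0.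
have nn : enorm u * enorm w != 0 by rewrite gt_eqF.
set c := dot u w / (enorm u * enorm w).
have c2 : c ^+ 2 = 1 - (s * cross u w / (enorm u * enorm w)) ^+ 2.
  rewrite /c !expr_div_n [(s * _) ^+ 2]exprMn [s ^+ 2]expr2 ss mul1r.
  have : dot u w ^+ 2 / (enorm u * enorm w) ^+ 2 +
      cross u w ^+ 2 / (enorm u * enorm w) ^+ 2 = 1.
    by rewrite -mulrDl dot_cross_sqr divff // expf_neq0.
  lra.
have q0 : 0 < s * cross u w / (enorm u * enorm w) by rewrite divr_gt0.
have c1 : -1 < c < 1.
  rewrite -ltr_norml -(@expr_lt1 _ 2) // real_normK ?num_real // c2.
  by rewrite ltrBlDr ltrDl exprn_gt0.
have c1' : -1 <= c <= 1 by case/andP: c1 => *; apply/andP; split; exact: ltW.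
split.
- by apply: acos_gt0; case/andP: c1 => /ltW -> ->.
- by apply: acos_ltpi; case/andP: c1 => -> /ltW ->.
- rewrite /vangle -/c acosK ?in_itv //= /c [RHS]mulrC divfK //.
- rewrite /vangle -/c sin_acos // c2 opprB addrCA subrr addr0 sqrtr_sqr gtr0_norm //.
  by rewrite [RHS]mulrC divfK.
Qed.

(** For [0 < s * cross e f] this is the open sector between [e] and [f], of opening less than [pi].
    Open sectors serve for packing, the closed ones below for covering. *)
Definition cone s e f : set (plane R) :=
  [set x | 0 < s * cross e x /\ 0 < s * cross x f].

Definition ccone s e f : set (plane R) :=
  [set x | 0 <= s * cross e x /\ 0 <= s * cross x f].

Definition circle (t : R) : plane R := (cos t, sin t).

Lemma polar u : 0 < enorm u -> exists t, 0 <= t < 2 * pi /\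
  u = (enorm u * cos t, enorm u * sin t).
Proof.
move=> u0; have un : enorm u != 0 by rewrite gt_eqF.
have n2 : (u.1 / enorm u) ^+ 2 + (u.2 / enorm u) ^+ 2 = 1.
  rewrite !expr_div_n -mulrDl [enorm u ^+ 2]expr2 enorm_sqr /dot -!expr2 divff //.
  by rewrite !expr2 -/(dot u u) -enorm_sqr mulf_neq0.
set c := u.1 / enorm u in n2; set d := u.2 / enorm u in n2.
have c1 : -1 <= c <= 1.
  rewrite -ler_norml -(@expr_le1 _ 2) // real_normK ?num_real // -n2.
  by rewrite lerDl sqr_ge0.
have E t : cos t = c -> sin t = d -> u = (enorm u * cos t, enorm u * sin t).
  by move=> -> ->; apply/plane_eqP; rewrite /= mulrC divfK.
have sa : sin (acos c) = `|d|.
  by rewrite sin_acos // -n2 addrAC subrr add0r sqrtr_sqr.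
have p0 := @pi_gt0 R.
have a0 := acos_ge0 c1; have a1 := acos_lepi c1.
have [d0|d0] := leP 0 d.
  exists (acos c); split; first by apply/andP; split => //; lra.
  by apply: E; [rewrite acosK ?in_itv|rewrite sa ger0_norm].
exists (2 * pi - acos c); split.
  apply/andP; split; first lra.
  suff : 0 < acos c by lra.
  rewrite lt_neqAle a0 andbT eq_sym; apply/eqP => a.
  by move: sa; rewrite a sin0 => /esym/eqP; rewrite normr_eq0 => /eqP d0'; rewrite d0' ltxx in d0.
have E2 : 2 * pi - acos c = - acos c + pi *+ 2 by rewrite mulr2n; ring.
apply: E; rewrite E2.
  by rewrite cosD2pi cosN acosK ?in_itv.
by rewrite sinD2pi sinN sa ltr0_norm // opprK.
Qed.

Lemma sin_gt0_itv (y : R) : - (2 * pi) < y < 2 * pi -> 0 < sin y ->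
  0 < y < pi \/ - (2 * pi) < y < - pi.
Proof.
move=> /andP[y1 y2] sy; have p0 := @pi_gt0 R.
have neg (z : R) : 0 <= z <= pi -> sin (- z) <= 0.
  by move=> /sin_ge0_pi; rewrite sinN oppr_le0.
have [y0|y0] := leP y 0.
  right; apply/andP; split=> //; rewrite ltNge; apply/negP => yp.
  have : sin y <= 0 by rewrite -(opprK y); apply: neg; apply/andP; split; lra.
  by rewrite leNgt sy.
left; apply/andP; split=> //; rewrite ltNge; apply/negP => yp.
have : sin y <= 0.
  have -> : y = - (2 * pi - y) + pi *+ 2 by rewrite mulr2n; ring.
  by rewrite sinD2pi; apply: neg; apply/andP; split; lra.
by rewrite leNgt sy.
Qed.

Lemma sin_ge0_itv (y : R) : - (2 * pi) <= y <= 2 * pi -> 0 <= sin y ->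
  0 <= y <= pi \/ - (2 * pi) <= y <= - pi \/ y = 2 * pi.
Proof.
move=> /andP[y1 y2] sy; have p0 := @pi_gt0 R.
have neg (z : R) : 0 < z < pi -> sin (- z) < 0.
  by move=> /sin_gt0_pi; rewrite sinN oppr_lt0.
have [y0|y0] := ltP y 0.
  right; left; apply/andP; split=> //; rewrite leNgt; apply/negP => yp.
  have : sin y < 0 by rewrite -(opprK y); apply: neg; apply/andP; split; lra.
  by rewrite ltNge sy.
have [->|yn] := eqVneq y (2 * pi); first by right; right.
have {}y2 : y < 2 * pi by rewrite lt_neqAle yn.
left; apply/andP; split=> //; rewrite leNgt; apply/negP => yp.
have : sin y < 0.
  have -> : y = - (2 * pi - y) + pi *+ 2 by rewrite mulr2n; ring.
  by rewrite sinD2pi; apply: neg; apply/andP; split; lra.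
by rewrite ltNge sy.
Qed.

(** Here [t] is the polar angle of the side from which the sector is swept counterclockwise, and the
    second case is the part of the arc that wraps past [2 * pi]. Exchanging [e] and [f] reverses the
    orientation, which reduces the proof to [s = 1]. *)
Lemma cone_arc s e f : s * s = 1 -> 0 < s * cross e f -> exists t,
  let a := vangle e f in
  [/\ 0 <= t < 2 * pi,
     forall y, 0 <= y < 2 * pi -> cone s e f (circle y) <->
       (t < y < t + a \/ y < t + a - 2 * pi) &
     forall y, 0 <= y < 2 * pi -> ccone s e f (circle y) ->
       (t <= y <= t + a \/ y <= t + a - 2 * pi)].
Proof.
wlog -> : s e f / s = 1.
  move=> H ss h; case: (sign_cases ss) => s1; first exact: H.
  have [] := H 1 f e erefl; rewrite ?mulr1 //.
    by move: h; rewrite s1 /cross; lra.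
  move=> t /=; rewrite vangleC => -[h1 h2 h3]; exists t; split => //.
    move=> y hy; rewrite -(h2 y hy) /cone /= s1 /cross /=.
    by split=> -[? ?]; split; lra.
  move=> y hy [c1 c2]; apply: h3 => //; split; move: c1 c2; rewrite s1 /cross /=; lra.
move=> ss h; have [a0 ap hd hc] := vangleP ss h.
set a := vangle e f in a0 ap hd hc *.
have [e0 f0] := cross_enorm_gt0 h.
have [t [/andP[t0 t2] et]] := polar e0.
have p0 := @pi_gt0 R.
have ef : f = (enorm f * cos (t + a), enorm f * sin (t + a)).
  have ee : enorm e != 0 by rewrite gt_eqF.
  have e1 : e.1 = enorm e * cos t by rewrite {1}et.
  have e2 : e.2 = enorm e * sin t by rewrite {1}et.
  move: hd hc; rewrite /dot /cross e1 e2 mul1r => hd hc.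
  have {}hd : cos t * f.1 + sin t * f.2 = enorm f * cos a.
    by apply: (mulfI ee); rewrite !mulrA -hd; ring.
  have {}hc : cos t * f.2 - sin t * f.1 = enorm f * sin a.
    by apply: (mulfI ee); rewrite !mulrA -hc; ring.
  have cs := cos2Dsin2 t.
  apply/plane_eqP => /=.
    rewrite cosD mulrBr [X in _ = X - _]mulrCA -hd [X in _ = _ - X]mulrCA -hc.
    by rewrite -[LHS]mul1r -cs; ring.
  rewrite sinD mulrDr [X in _ = X + _]mulrCA -hd [X in _ = _ + X]mulrCA -hc.
  by rewrite -[LHS]mul1r -cs; ring.
have C1 (y : R) : cross e (circle y) = enorm e * sin (y - t).
  by rewrite {1}et /cross /circle /= sinB; ring.
have C2 (y : R) : cross (circle y) f = enorm f * sin (t + a - y).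
  by rewrite {1}ef /cross /circle /= (sinB (t + a)); ring.
have c2p (y : R) : sin (y + 2 * pi) = sin y.
  by have := sinD2pi y; rewrite mulr2n -[pi + pi](_ : 2 * pi = _) //; ring.
have shift1 (y : R) : sin (y - t) = sin (y + 2 * pi - t).
  by rewrite -c2p; congr sin; ring.
have shift2 (y : R) : sin (t + a - y) = sin (t + a - 2 * pi - y).
  by rewrite -(c2p (_ - _ - y)); congr sin; ring.
exists t; rewrite t0 t2; split=> // y /andP[y0 y2].
  rewrite /cone /= !mul1r C1 C2 !pmulr_rgt0 //; split.
    move=> [s1 s2].
    have [|/andP[h1 h2]|/andP[h1 h2]] := sin_gt0_itv _ s1.
    - by apply/andP; split; lra.
    - left; have [] := sin_gt0_itv _ s2; first by apply/andP; split; lra.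
        by move=> /andP[? ?]; apply/andP; split; lra.
      by move=> /andP[? ?]; lra.
    - right; rewrite shift2 in s2.
      have [] := sin_gt0_itv _ s2; first by apply/andP; split; lra.
        by move=> /andP[? ?]; lra.
      by move=> /andP[? ?]; lra.
  move=> [/andP[h1 h2]|h1].
    by split; apply: sin_gt0_pi; apply/andP; split; lra.
  rewrite shift1 shift2.
  by split; apply: sin_gt0_pi; apply/andP; split; lra.
rewrite /ccone /= !mul1r C1 C2 !pmulr_rge0 //; move=> [s1 s2].
have [|/andP[h1 h2]|[/andP[h1 h2]|h1]] := sin_ge0_itv _ s1.
- by apply/andP; split; lra.
- left; have [] := sin_ge0_itv _ s2; first by apply/andP; split; lra.
    by move=> /andP[? ?]; apply/andP; split; lra.
  by move=> [/andP[? ?]|?]; lra.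
- right; rewrite shift2 in s2.
  have [] := sin_ge0_itv _ s2; first by apply/andP; split; lra.
    by move=> /andP[? ?]; lra.
  by move=> [/andP[? ?]|?]; lra.
- lra.
Qed.

End Angle.

(** * Sums of openings of sectors *)

Section ConeSum.
Context {R : realType}.
Notation mu := (@lebesgue_measure R).
Implicit Types (e f u w x : plane R) (s : R).

Lemma mu_cone s e f : s * s = 1 -> 0 < s * cross e f ->
  measurable (`[0, 2 * pi[ `&` [set y | cone s e f (circle y)]) /\
  mu (`[0, 2 * pi[ `&` [set y | cone s e f (circle y)]) = (vangle e f)%:E.
Proof.
move=> ss h; have [t /= [/andP[t0 t2] ht _]] := cone_arc ss h.
have [a0 ap _ _] := vangleP ss h.
move: (vangle e f) a0 ap ht => a a0 ap ht.
have p0 := @pi_gt0 R.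
have [ta|ta] := leP (t + a) (2 * pi).
  have -> : `[0, 2 * pi[ `&` [set y | cone s e f (circle y)] = `]t, t + a[%classic.
    apply/seteqP; split=> y /=; rewrite !in_itv /=.
      by move=> [hy /(ht y hy)[//|h']]; move/andP: hy => [? ?]; exfalso; lra.
    move=> h'; have hy : 0 <= y < 2 * pi.
      by move/andP: h' => [? ?]; apply/andP; split; lra.
    by split=> //; apply/(ht y hy); left.
  split=> //; rewrite lebesgue_measure_itv /= lte_fin ifT; last lra.
  by rewrite -EFinD; congr EFin; ring.
have -> : `[0, 2 * pi[ `&` [set y | cone s e f (circle y)] =
    `[0, t + a - 2 * pi[%classic `|` `]t, 2 * pi[%classic.
  apply/seteqP; split=> y /=; rewrite !in_itv /=.
    move=> [hy /(ht y hy)]; move/andP: hy => [y0 y2] [/andP[h1 h2]|h1].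
      by right; apply/andP.
    by left; apply/andP.
  move=> h'; have hy : 0 <= y < 2 * pi.
    by move: h' => [|] /andP[? ?]; apply/andP; split; lra.
  split=> //; apply/(ht y hy); move: h' => [|] /andP[h1 h2]; first by right.
  by left; apply/andP; split => //; lra.
split; first exact: measurableU.
set A1 : set R := `[0, t + a - 2 * pi[%classic; set A2 : set R := `]t, 2 * pi[%classic.
have -> : mu (A1 `|` A2) = (mu A1 + mu A2)%E.
  apply: measureU; [exact: measurable_itv|exact: measurable_itv|].
  by apply/seteqP; split=> // y; rewrite /A1 /A2 /=; rewrite !in_itv /= => -[/andP[? ?] /andP[? ?]]; lra.
rewrite /A1 /A2 !lebesgue_measure_itv /= !lte_fin ifT; last lra.
rewrite ifT; last lra.
by rewrite -!EFinD; congr EFin; ring.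
Qed.

Lemma mu_ccone s e f : s * s = 1 -> 0 < s * cross e f ->
  exists G : set R, [/\ measurable G,
    `[0, 2 * pi[ `&` [set y | ccone s e f (circle y)] `<=` G &
     (mu G <= (vangle e f)%:E)%E].
Proof.
move=> ss h; have [t /= [/andP[t0 t2] _ ht]] := cone_arc ss h.
have [a0 ap _ _] := vangleP ss h.
move: (vangle e f) a0 ap ht => a a0 ap ht.
have p0 := @pi_gt0 R.
have [ta|ta] := ltP (t + a) (2 * pi).
  exists `[t, t + a]%classic; split=> //.
    move=> y /=; rewrite !in_itv /= => -[hy /(ht y hy)[//|h']].
    by move/andP: hy => [? ?]; exfalso; lra.
  rewrite lebesgue_measure_itv /= lte_fin ifT; last lra.
  by rewrite -EFinD lee_fin; lra.
exists (`[0, t + a - 2 * pi]%classic `|` `[t, 2 * pi]%classic); split; first exact: measurableU.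
  move=> y /=; rewrite !in_itv /= => -[hy /(ht y hy)].
  move/andP: hy => [y0 y2] [/andP[h1 h2]|h1].
    by right; apply/andP; split=> //; lra.
  by left; apply/andP.
set A1 : set R := `[0, t + a - 2 * pi]%classic; set A2 : set R := `[t, 2 * pi]%classic.
apply: (@le_trans _ _ (mu A1 + mu A2)%E).
  by apply: measureU2; exact: measurable_itv.
rewrite /A1 /A2 !lebesgue_measure_itv /= !lte_fin [X in (_ + X)%E]ifT; last lra.
by case: ifPn => _; rewrite ?add0e -?EFinD lee_fin; lra.
Qed.

Context (I : finType) (A : {set I}) (s : I -> R) (e f : I -> plane R).
Hypothesis proper : forall i, i \in A -> s i * s i = 1 /\ 0 < s i * cross (e i) (f i).

Let fsum (F : I -> \bar R) :
  (\sum_(i \in [set` A]) F i)%R = \sum_(i in A) F i.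
Proof.
have -> : [set` A] = [set` enum A].
  by apply/seteqP; split=> i /=; rewrite mem_enum.
by rewrite -fsbig_seq ?enum_uniq // big_enum.
Qed.

Let mu2pi : mu `[0, 2 * pi[ = (2 * pi)%:E.
Proof.
have p0 := @pi_gt0 R.
rewrite lebesgue_measure_itv /= lte_fin ifT; last lra.
by rewrite -EFinD; congr EFin; ring.
Qed.

(** Additivity of the measure on disjoint sets of directions replaces any cyclic ordering of the
    sectors. It is applied to the outer normal cones of one pentagon and to the corners around a
    vertex. *)
Lemma cone_sum_le :
  (forall i j x, i \in A -> j \in A -> cone (s i) (e i) (f i) x ->
     cone (s j) (e j) (f j) x -> i = j) ->
  \sum_(i in A) vangle (e i) (f i) <= 2 * pi.
Proof.
move=> dis; pose F i := `[0, 2 * pi[ `&` [set y | cone (s i) (e i) (f i) (circle y)].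
have mF i : [set` A] i -> measurable (F i).
  by move=> /= iA; have [ss h] := proper iA; have [] := mu_cone ss h.
have tF : trivIset [set` A] F.
  by move=> i j /= iA jA [y [[_ yi] [_ yj]]]; exact: (dis i j (circle y)).
have E := measure_fin_bigcup mu (finite_finset (X := [set` A])) tF mF.
rewrite -lee_fin -sumEFin -mu2pi.
apply: (@le_trans _ _ (mu (\bigcup_(i in [set` A]) F i))).
  rewrite E fsum le_eqVlt; apply/orP; left; apply/eqP; apply: eq_bigr => i iA.
  by have [ss h] := proper iA; have [_ <-] := mu_cone ss h.
by apply: le_mu => y [i _ []].
Qed.

(** Closed sectors may share their sides, so this direction rests on subadditivity, through
    measurable sets that contain the arcs. *)
Lemma cone_sum_ge :
  (forall y, exists2 i, i \in A & ccone (s i) (e i) (f i) (circle y)) ->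
  2 * pi <= \sum_(i in A) vangle (e i) (f i).
Proof.
move=> cov.
have /choice[G HG] : forall i, exists G : set R, i \in A -> [/\ measurable G,
    `[0, 2 * pi[ `&` [set y | ccone (s i) (e i) (f i) (circle y)] `<=` G &
     (mu G <= (vangle (e i) (f i))%:E)%E].
  move=> i; have [iA|iA] := boolP (i \in A); last by exists set0.
  have [ss h] := proper iA; have [G HG] := mu_ccone ss h.
  by exists G.
rewrite -lee_fin -sumEFin -mu2pi.
apply: (@le_trans _ _ (\sum_(i in A) mu (G i))); last first.
  by apply: lee_sum => i iA; have [] := HG i iA.
rewrite -fsum; apply: content_sub_fsum => //.
  by move=> i /= iA; have [] := HG i iA.
move=> y hy; have [i iA hi] := cov y; exists i => //.
by have [_ + _] := HG i iA; apply.
Qed.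

End ConeSum.

(** * Angles and side lengths of convex pentagons *)

Section Pentagon.
Context {R : realType}.
Implicit Types (p q u w x : plane R) (s : R) (P Q : polygon R 5).

(** Unsigned, between 0 and [pi]: the interior angle at a convex corner only. Unlike
    [interior_angle] it depends on nothing but distances, so it is transported by congruence. *)
Definition ang P (k : 'I_5) : R := vangle (P (ordS k) - P k) (P (ord_pred k) - P k).

(** This is [cot (a / 2)], in the form that the dot and cross products of unit side vectors
    produce. *)
Definition hcot (a : R) : R := (1 + cos a) / sin a.

Lemma sum5_rot (F : 'I_5 -> R) (i : 'I_5) :
  \sum_k F k = F i + F (ordS i) + F (ordS2 i) + F (ordS3 i) +
    F (ordS4 i).
Proof.
by move: i; rewrite sum5; apply: I5P; case: ordS5 => h0 h1 h2 h3 h4;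
  rewrite !(h0, h1, h2, h3, h4); ring.
Qed.

Lemma ordS_cycle (i : 'I_5) : ordS (ordS4 i) = i.
Proof. by move: i; apply: I5P; apply/val_inj. Qed.

Lemma ord_pred_ordS4 (i : 'I_5) : ord_pred i = ordS4 i.
Proof. by move: i; apply: I5P; apply/val_inj. Qed.

Lemma turn_corner_gt0 s P k : sconvex s P ->
  0 < s * cross (P k - P (ord_pred k)) (P (ordS k) - P k).
Proof.
move=> [_ cv]; have : 0 < s * turn (P (ord_pred k)) (P k) (P (ordS k)).
  rewrite -{2}(ord_predK k); apply: cv; last rewrite ord_predK;
  by move: k; apply: I5P.
by rewrite /turn /cross /=; lra.
Qed.

Lemma enormN u : enorm (- u) = enorm u.
Proof. by rewrite /enorm /dot /= !mulrNN. Qed.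

Lemma vangleN s u w : s * s = 1 -> 0 < s * cross u w -> vangle u (- w) = pi - vangle u w.
Proof.
move=> ss h; rewrite /vangle enormN.
have -> : dot u (- w) = - dot u w by rewrite /dot /=; ring.
rewrite mulNr acosN //.
have [u0 w0] := cross_enorm_gt0 h.
have [_ _ -> _] := vangleP ss h.
rewrite mulrAC divff ?mul1r ?mulf_neq0 ?gt_eqF //.
by rewrite cos_geN1 cos_le1.
Qed.

Lemma ang_exterior s P k : sconvex s P ->
  ang P k = pi - vangle (P k - P (ord_pred k)) (P (ordS k) - P k).
Proof.
move=> cv; have [ss _] := cv; have h := turn_corner_gt0 k cv.
have -> : ang P k = vangle (P (ordS k) - P k) (- (P k - P (ord_pred k))).
  by rewrite /ang opprB.
rewrite (@vangleN (- s)) ?mulrNN // 1?vangleC //.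
by move: h; rewrite /cross /=; lra.
Qed.

Lemma ang_itv s P k : sconvex s P -> 0 < ang P k < pi.
Proof.
move=> cv; have [ss _] := cv; have h := turn_corner_gt0 k cv.
rewrite (ang_exterior _ cv); have [h1 h2 _ _] := vangleP ss h.
by apply/andP; split; lra.
Qed.

Let outer u : plane R := (u.2, - u.1).

(* The outer normal cones at the five vertices fill up the circle. *)
Lemma sum_ang s P : sconvex s P -> \sum_k ang P k = 3 * pi.
Proof.
move=> cv; have [ss cv'] := cv.
pose AT : {set 'I_5} := finset.setT.
pose ein k := P k - P (ord_pred k); pose eout k := P (ordS k) - P k.
have cross_outer u w : cross (outer u) w = dot u w by rewrite /cross /dot /outer /=; ring.
have cross_outer' u w : cross w (outer u) = - dot u w by rewrite /cross /dot /outer /=; ring.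
have proper k : k \in AT ->
    s * s = 1 /\ 0 < s * cross (outer (ein k)) (outer (eout k)).
  move=> _; split=> //; have := turn_corner_gt0 k cv.
  by rewrite /ein /eout /cross /outer /=; lra.
have sumE : \sum_(k in AT) vangle (outer (ein k)) (outer (eout k)) =
    5 * pi - \sum_k ang P k.
  have -> : 5 * pi = \sum_(k : 'I_5) pi :> R by rewrite sum5; ring.
  rewrite -sumrB; apply: eq_big => [k|k _]; first by rewrite finset.in_setT.
  rewrite (ang_exterior _ cv) subKr /vangle.
  have enorm_outer u : enorm (outer u) = enorm u.
    by rewrite /enorm /dot /outer /= mulrNN addrC.
  by rewrite !enorm_outer /dot /outer /= mulrNN addrC.
have eq2 k : turn (P (ord_pred k)) (P k) (P (ordS k)) = cross (ein k) (eout k).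
  by rewrite /turn /cross /ein /eout /=; ring.
(* Cramer's rule for [P l - P k] in the basis of the two sides at [P k]. It shows that a direction
   in the normal cone of a corner is maximized over the vertices at that corner. *)
have dec k l d : s * cross (ein k) (eout k) * (s * dot d (P l) - s * dot d (P k)) =
    s * turn (P (ord_pred k)) (P k) (P l) * (s * dot (eout k) d) -
    s * turn (P k) (P (ordS k)) (P l) * (s * dot (ein k) d).
  by rewrite /turn /cross /dot /ein /eout /=; ring.
have pos k := turn_corner_gt0 k cv.
have tin k l : 0 <= s * turn (P (ord_pred k)) (P k) (P l).
  by have := turn_vertex_ge0 (ord_pred k) l cv; rewrite ord_predK.
have tout k l : 0 <= s * turn (P k) (P (ordS k)) (P l) by exact: turn_vertex_ge0.
have le2 : \sum_(k in AT) vangle (outer (ein k)) (outer (eout k)) <= 2 * pi.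
  apply: (cone_sum_le proper) => k l d _ _.
  rewrite /cone /= !cross_outer !cross_outer' !mulrN => -[k1 k2] [l1 l2].
  have key i j : 0 < s * dot (ein i) d -> 0 < - (s * dot (eout i) d) ->
      s * dot d (P j) <= s * dot d (P i).
    move=> i1 i2; rewrite -subr_le0 -(pmulr_rle0 _ (pos i)) dec subr_le0.
    apply: (@le_trans _ _ 0); last by apply: mulr_ge0; [exact: tout|exact: ltW].
    by rewrite -oppr_ge0 -mulrN; apply: mulr_ge0; [exact: tin|exact: ltW].
  have E : s * dot d (P l) = s * dot d (P k).
    by apply/eqP; rewrite eq_le (key k l) // (key l k).
  have := dec k l d; rewrite E subrr mulr0 => /esym/eqP; rewrite subr_eq0 => /eqP E2.
  have A0 : 0 <= s * turn (P (ord_pred k)) (P k) (P l) * - (s * dot (eout k) d).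
    by apply: mulr_ge0; [exact: tin|exact: ltW].
  have B0 : 0 <= s * turn (P k) (P (ordS k)) (P l) * (s * dot (ein k) d).
    by apply: mulr_ge0; [exact: tout|exact: ltW].
  rewrite mulrN E2 in A0.
  have B1 : s * turn (P k) (P (ordS k)) (P l) * (s * dot (ein k) d) = 0 by lra.
  have {B1} B1 : s * turn (P k) (P (ordS k)) (P l) = 0.
    by move/eqP: B1; rewrite mulf_eq0 (gt_eqF k1) orbF => /eqP.
  have {E2} A1 : s * turn (P (ord_pred k)) (P k) (P l) = 0.
    move/eqP: E2; rewrite B1 mul0r mulf_eq0 => /orP[/eqP//|/eqP e].
    by move: k2; rewrite e oppr0 ltxx.
  apply/eqP; rewrite eq_sym; apply/negPn/negP => lk.
  have [lk'|lk'] := eqVneq l (ordS k).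
    by have := pos k; rewrite -eq2 // -lk' A1 ltxx.
  by have := cv' k l lk lk'; rewrite B1 ltxx.
have ge2 : 2 * pi <= \sum_(k in AT) vangle (outer (ein k)) (outer (eout k)).
  apply: (cone_sum_ge proper) => y; set d := circle y.
  (* A vertex that is farthest in the direction [d], up to the sign [s], has this direction in its
     outer normal cone. *)
  have [k kmax] : exists k, forall j, s * dot d (P j) <= s * dot d (P k).
    case: (@arg_maxP _ _ _ v0 xpredT (fun j => s * dot d (P j)) isT) => k _ h.
    by exists k => j; exact: h.
  exists k; first by rewrite finset.in_setT.
  rewrite /ccone /= cross_outer cross_outer'.
  have := kmax (ordS k); have := kmax (ord_pred k).
  by rewrite /dot /ein /eout /=; split; lra.
by move: le2 ge2; rewrite sumE; lra.
Qed.

Definition unit_edge P k : plane R :=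
  ((P (ordS k) - P k).1 / edge_length P k, (P (ordS k) - P k).2 / edge_length P k).

Lemma edge_length_gt0 s P k : sconvex s P -> 0 < edge_length P k.
Proof. by move=> cv; have [] := cross_enorm_gt0 (turn_corner_gt0 k cv). Qed.

Lemma hcot_unit_edge s P k : sconvex s P -> let u := unit_edge P (ord_pred k) in
  let w := unit_edge P k in
  [/\ 0 < s * cross u w, dot u w = - cos (ang P k), s * cross u w = sin (ang P k) &
  (1 - dot u w) / (s * cross u w) = hcot (ang P k)].
Proof.
move=> cv u w; have [ss _] := cv; have h := turn_corner_gt0 k cv.
have := ang_exterior k cv; have [a0 ap hd hc] := vangleP ss h.
have l1 := edge_length_gt0 (ord_pred k) cv; have l2 := edge_length_gt0 k cv.
have n1 : edge_length P (ord_pred k) != 0 by rewrite gt_eqF.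
have n2 : edge_length P k != 0 by rewrite gt_eqF.
have E1 : enorm (P k - P (ord_pred k)) = edge_length P (ord_pred k).
  by rewrite /edge_length ord_predK.
have E2 : enorm (P (ordS k) - P k) = edge_length P k by [].
move: hd hc; rewrite E1 E2; set phi := vangle _ _ => hd hc ea.
have du : dot u w = cos phi.
  apply: (mulfI (mulf_neq0 n1 n2)); rewrite -hd /u /w /unit_edge /dot ord_predK /=.
  by field; rewrite n1 n2.
have cu : s * cross u w = sin phi.
  apply: (mulfI (mulf_neq0 n1 n2)); rewrite -hc /u /w /unit_edge /cross ord_predK /=.
  by field; rewrite n1 n2.
have ca : cos (ang P k) = - cos phi.
  by rewrite ea addrC cosDpi cosN.
have sa : sin (ang P k) = sin phi.
  by rewrite ea addrC sinDpi sinN opprK.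
rewrite du cu /hcot ca sa opprK; split=> //.
by apply: sin_gt0_pi; rewrite a0.
Qed.

Lemma dot_unit_edge s P k : sconvex s P -> dot (unit_edge P k) (unit_edge P k) = 1.
Proof.
move=> cv; have n : edge_length P k != 0 by rewrite gt_eqF // (edge_length_gt0 _ cv).
have -> : dot (unit_edge P k) (unit_edge P k) =
    dot (P (ordS k) - P k) (P (ordS k) - P k) / (edge_length P k * edge_length P k).
  by rewrite /dot /unit_edge /=; field.
by rewrite -enorm_sqr divff // mulf_neq0.
Qed.

Lemma unit_edge_step s P k : sconvex s P -> P (ordS k) =
  ((P k).1 + edge_length P k * (unit_edge P k).1,
   (P k).2 + edge_length P k * (unit_edge P k).2).
Proof.
move=> cv; have n : edge_length P k != 0 by rewrite gt_eqF // (edge_length_gt0 _ cv).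
by apply/plane_eqP; rewrite /unit_edge /= mulrC divfK //; ring.
Qed.

Lemma lhuilier s P : sconvex s P ->
  4 * (\sum_k hcot (ang P k)) * (s * signed_area P) <= perimeter P ^+ 2.
Proof.
move=> cv; have [ss _] := cv.
pose a := ang P; have ai k : 0 < a k < pi by exact: (ang_itv k cv).
(* The sign conditions of [lhuilier_points] ask for two disjoint pairs of adjacent angles, each with
   sum at least [pi]. They exist because the total is [3 * pi]: if an adjacent pair has a smaller
   sum, the other three angles exceed [2 * pi], and any two of those exceed [pi]. *)
have [i [h1 h2]] : exists i, pi <= a (ordS i) + a (ordS2 i) /\
    pi <= a (ordS4 i) + a i.
  have := sum_ang cv; rewrite sum5 -/a => S.
  move: (ai v0) (ai v1) (ai v2) (ai v3) (ai v4).
  move=> /andP[? ?] /andP[? ?] /andP[? ?] /andP[? ?] /andP[? ?].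
  case: ordS5 => o0 o1 o2 o3 o4.
  have [b01|b01] := leP pi (a v0 + a v1).
    have [b23|b23] := leP pi (a v2 + a v3); first by exists v1; rewrite !(o0, o1, o2, o3, o4).
    have [b34|b34] := leP pi (a v3 + a v4); first by exists v4; rewrite !(o0, o1, o2, o3, o4).
    by exists v0; rewrite !(o0, o1, o2, o3, o4); split; lra.
  have [b12|b12] := leP pi (a v1 + a v2).
    by exists v2; rewrite !(o0, o1, o2, o3, o4); split; lra.
  by exists v3; rewrite !(o0, o1, o2, o3, o4); split; lra.
have sa : signed_area P = (\sum_k cross (P k) (P (ordS k))) / 2 by [].
have pe : perimeter P = \sum_k edge_length P k by [].
rewrite sa pe 3!(sum5_rot _ i) !ordS_cycle.
set i1 := ordS i; set i2 := ordS i1; set i3 := ordS i2; set i4 := ordS i3.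
have i40 : ordS i4 = i by exact: ordS_cycle.
have step k := unit_edge_step k cv.
have q4 := step i4; rewrite i40 in q4.
have pk k : ord_pred (ordS k) = k by rewrite ordSK.
have p0 : ord_pred i = i4 by rewrite -i40 pk.
have [s0 d0 c0 t0] := hcot_unit_edge i cv.
have [s1 d1 c1 t1] := hcot_unit_edge i1 cv.
have [s2 d2 c2 t2] := hcot_unit_edge i2 cv.
have [s3 d3 c3 t3] := hcot_unit_edge i3 cv.
have [s4 d4 c4 t4] := hcot_unit_edge i4 cv.
move: s0 d0 c0 t0 s1 d1 c1 t1 s2 d2 c2 t2 s3 d3 c3 t3 s4 d4 c4 t4.
rewrite p0 !pk => s0 d0 c0 t0 s1 d1 c1 t1 s2 d2 c2 t2 s3 d3 c3 t3 s4 d4 c4 t4.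
have un k := dot_unit_edge k cv.
rewrite -t0 -t1 -t2 -t3 -t4.
have sinsum (x y : R) : pi <= x + y -> 0 < x < pi -> 0 < y < pi ->
    0 <= - cos x * sin y + sin x * - cos y.
  move=> xy /andP[? ?] /andP[? ?].
  have -> : - cos x * sin y + sin x * - cos y = - sin (x + y) by rewrite sinD; ring.
  have -> : x + y = (x + y - pi) + pi by ring.
  by rewrite sinDpi opprK; apply: sin_ge0_pi; apply/andP; split; lra.
apply: (lhuilier_points (s := s) ss (step i) (step i1) (step i2) (step i3) q4) => //.
- by rewrite (cross_unit s _ _ (un i1)) d1 c1 d2 c2 sinsum.
- by rewrite (cross_unit s _ _ (un i4)) d4 c4 d0 c0 sinsum.
Qed.

Lemma congruent_edist P Q : congruent P Q -> forall i j, Defs.edist (Q i) (Q j) = Defs.edist (P i) (P j).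
Proof. by move=> [f hf hQ] i j; rewrite !hQ hf. Qed.

Section Congruent.
Context (P Q : polygon R 5).
Hypothesis PQ : forall i j, Defs.edist (Q i) (Q j) = Defs.edist (P i) (P j).

(** Polarization: the distances between the vertices determine the dot products of their
    differences, so the isometry is used through distances alone. *)
Let polar4 p q u w : dot (q - p) (w - u) =
  (Defs.edist p w ^+ 2 + Defs.edist q u ^+ 2 - Defs.edist q w ^+ 2 - Defs.edist p u ^+ 2) / 2.
Proof. by rewrite /Defs.edist !expr2 !enorm_sqr /dot /=; field. Qed.

Let dotE i j k l : dot (Q j - Q i) (Q l - Q k) = dot (P j - P i) (P l - P k).
Proof. by rewrite !polar4 !PQ. Qed.

Lemma congruent_ang k : ang Q k = ang P k.
Proof. by rewrite /ang /vangle /enorm !dotE. Qed.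

Lemma congruent_perimeter : perimeter Q = perimeter P.
Proof. by apply: eq_bigr => k _; exact: PQ. Qed.

(** A product of two turns is a Gram determinant, hence fixed by the distances. So all turns of [Q]
    have the signs of those of [P], up to one common sign. *)
Lemma congruent_sconvex s : sconvex s P -> exists t, sconvex t Q.
Proof.
move=> [ss cv].
have turnM (X : polygon R 5) i j k i' j' k' :
    turn (X i) (X j) (X k) * turn (X i') (X j') (X k') =
    dot (X j - X i) (X j' - X i') * dot (X k - X i) (X k' - X i') -
    dot (X j - X i) (X k' - X i') * dot (X k - X i) (X j' - X i').
  by rewrite /turn /cross /dot; ring.
have T0 : 0 < s * turn (P v0) (P v1) (P v2).
  by have := cv v0 v2 isT isT; case: ordS5 => ->.
have E i j k : turn (Q i) (Q j) (Q k) * turn (Q v0) (Q v1) (Q v2) =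
    (s * turn (P i) (P j) (P k)) * (s * turn (P v0) (P v1) (P v2)).
  by rewrite turnM !dotE -turnM mulrACA ss mul1r.
pose t : R := if 0 <= turn (Q v0) (Q v1) (Q v2) then 1 else -1.
have tt : t * t = 1 by rewrite /t; case: ifP => _; ring.
have t0 : 0 <= t * turn (Q v0) (Q v1) (Q v2).
  rewrite /t; case: ifPn => [|]; first by rewrite mul1r.
  by rewrite -ltNge mulN1r oppr_ge0 => /ltW.
exists t; split=> // k j jk jk'.
have : 0 < t * turn (Q k) (Q (ordS k)) (Q j) * (t * turn (Q v0) (Q v1) (Q v2)).
  by rewrite mulrACA tt mul1r E mulr_gt0 // cv.
move: t0; rewrite le_eqVlt => /predU1P[<-|t0]; first by rewrite mulr0 ltxx.
by rewrite pmulr_lgt0.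
Qed.

End Congruent.

End Pentagon.

(** * Isoperimetry for pentagons that are not strictly convex *)

Section Metric.
Context {R : realType}.
Implicit Types (a b c d p q u w x y z : plane R) (s : R).

Lemma dot_enorm_le u w : dot u w <= enorm u * enorm w.
Proof.
have := dot_cross_sqr u w; have := sqr_ge0 (cross u w) => h e.
have n0 : 0 <= enorm u * enorm w by rewrite mulr_ge0 ?enorm_ge0.
have [d0|d0] := leP (dot u w) 0; first exact: le_trans n0.
rewrite -(@ler_pXn2r _ 2) ?nnegrE ?(ltW d0) //; lra.
Qed.

Lemma cross_enorm_le s u w : s * s = 1 -> s * cross u w <= enorm u * enorm w.
Proof.
move=> ss; have := dot_cross_sqr u w; have := sqr_ge0 (dot u w) => h e.
have n0 : 0 <= enorm u * enorm w by rewrite mulr_ge0 ?enorm_ge0.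
have [d0|d0] := leP (s * cross u w) 0; first exact: le_trans n0.
rewrite -(@ler_pXn2r _ 2) ?nnegrE ?(ltW d0) //.
by rewrite exprMn [s ^+ 2]expr2 ss mul1r; lra.
Qed.

Lemma enormD u w : enorm (u + w) <= enorm u + enorm w.
Proof.
have h := dot_enorm_le u w.
have s0 : 0 <= enorm u + enorm w by rewrite addr_ge0 ?enorm_ge0.
rewrite -(@ler_pXn2r _ 2) ?nnegrE ?enorm_ge0 // sqrrD !expr2 !enorm_sqr.
have -> : dot (u + w) (u + w) = dot u u + dot w w + 2 * dot u w by rewrite /dot /=; ring.
rewrite mulr2n; lra.
Qed.

Lemma plane_edistC p q : Defs.edist p q = Defs.edist q p.
Proof. by rewrite /Defs.edist -enormN opprB. Qed.

Lemma plane_edist_triangle p q z : Defs.edist p z <= Defs.edist p q + Defs.edist q z.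
Proof.
rewrite /Defs.edist; have -> : z - p = (q - p) + (z - q) by apply/plane_eqP => /=; ring.
exact: enormD.
Qed.

Lemma plane_edist_ge0 p q : 0 <= Defs.edist p q. Proof. exact: enorm_ge0. Qed.

Lemma turn_edist_le s a b c : s * s = 1 ->
  s * turn a b c <= Defs.edist a b * Defs.edist b c.
Proof.
move=> ss; have -> : turn a b c = cross (b - a) (c - b) by rewrite /turn /cross /=; ring.
exact: cross_enorm_le.
Qed.

Lemma heron a b c : 4 * turn a b c ^+ 2 =
  (Defs.edist a b + Defs.edist b c + Defs.edist c a) *
  (Defs.edist a b + Defs.edist b c - Defs.edist c a) *
  (Defs.edist b c + Defs.edist c a - Defs.edist a b) *
  (Defs.edist c a + Defs.edist a b - Defs.edist b c).
Proof.
have e p q : Defs.edist p q * Defs.edist p q = dot (q - p) (q - p) by exact: enorm_sqr.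
have := e a b; have := e b c; have := e c a.
move: (Defs.edist a b) (Defs.edist b c) (Defs.edist c a) => x y z ez ey ex.
have -> : (x + y + z) * (x + y - z) * (y + z - x) * (z + x - y) =
  4 * (x * x) * (y * y) - (x * x + y * y - z * z) ^+ 2 by ring.
by rewrite ex ey ez /turn /cross /dot /=; ring.
Qed.

(* Heron's formula and the AM-GM inequality for its three last factors. *)
Lemma triangle_isoperimetric a b c :
  108 * turn a b c ^+ 2 <= (Defs.edist a b + Defs.edist b c + Defs.edist c a) ^+ 4.
Proof.
have := heron a b c; have := plane_edist_triangle a b c; have := plane_edist_triangle b c a.
have := plane_edist_triangle c a b; rewrite (plane_edistC a c) (plane_edistC b a) (plane_edistC c b).
move: (Defs.edist a b) (Defs.edist b c) (Defs.edist c a) => x y z h1 h2 h3 h.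
set u := x + y - z in h; set v := y + z - x in h; set w := z + x - y in h.
have u0 : 0 <= u by rewrite /u; lra.
have v0' : 0 <= v by rewrite /v; lra.
have w0 : 0 <= w by rewrite /w; lra.
have e : x + y + z = u + v + w by rewrite /u /v /w; ring.
clearbody u v w.
have amgm : 27 * (u * v * w) <= (u + v + w) ^+ 3.
  have k1 : 0 <= u * (v - w) ^+ 2 by rewrite mulr_ge0 ?sqr_ge0.
  have k2 : 0 <= v * (w - u) ^+ 2 by rewrite mulr_ge0 ?sqr_ge0.
  have k3 : 0 <= w * (u - v) ^+ 2 by rewrite mulr_ge0 ?sqr_ge0.
  have k4 : 0 <= (u + v + w) * ((u - v) ^+ 2 + (v - w) ^+ 2 + (w - u) ^+ 2).
    apply: mulr_ge0; first by rewrite !addr_ge0.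
    by do 2?apply: addr_ge0; exact: sqr_ge0.
  have -> : (u + v + w) ^+ 3 = 27 * (u * v * w) + 3 * (u * (v - w) ^+ 2 + v * (w - u) ^+ 2 + w * (u - v) ^+ 2) + (u + v + w) * ((u - v) ^+ 2 + (v - w) ^+ 2 + (w - u) ^+ 2) / 2 by field.
  lra.
rewrite e in h *.
have -> : 108 * turn a b c ^+ 2 = (u + v + w) * (27 * (u * v * w)).
  by transitivity (27 * (4 * turn a b c ^+ 2)); [ring|rewrite h; ring].
by rewrite [_ ^+ 4]exprS; apply: ler_wpM2l => //; rewrite !addr_ge0.
Qed.

(** Cutting along one diagonal bounds twice the area by [x * y + z * w], cutting along the other by
    [y * z + w * x]. The two bounds add up to [(x + z) * (y + w)], at most a quarter of the squared
    perimeter. *)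
Lemma quad_isoperimetric s a b c d : s * s = 1 ->
  16 * (s * turn a b c / 2 + s * turn a c d / 2) <=
  (Defs.edist a b + Defs.edist b c + Defs.edist c d + Defs.edist d a) ^+ 2.
Proof.
move=> ss.
have h1 := turn_edist_le a b c ss; have h2 := turn_edist_le c d a ss.
have h3 := turn_edist_le b c d ss; have h4 := turn_edist_le d a b ss.
have e : s * turn a b c + s * turn a c d = s * turn b c d + s * turn d a b.
  by rewrite /turn /cross /=; ring.
have e' : s * turn c d a = s * turn a c d by rewrite turn_rot turn_rot.
rewrite e' in h2.
move: (Defs.edist a b) (Defs.edist b c) (Defs.edist c d) (Defs.edist d a) h1 h2 h3 h4.
move=> x y z w h1 h2 h3 h4.
have := sqr_ge0 (x + z - y - w).
have -> : (x + z - y - w) ^+ 2 = (x + y + z + w) ^+ 2 - 4 * (x * y + z * w + y * z + w * x) by ring.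
lra.
Qed.

Lemma area2_line m (k : R) (X : set (plane R)) : m <> 0 ->
  X `<=` [set z | dot m z = k] -> (area2 X <= 0)%E.
Proof.
move=> m0 Xm; have [m2|m2] := eqVneq m.2 0.
  have m1 : m.1 != 0 by apply/eqP => m1; apply: m0; exact: plane_eqP.
  pose f : R -> \bar R := (cst +oo%E) \_ [set k / m.1].
  apply: (@le_trans _ _ (\int[lebesgue_measure]_x f x)%E).
    apply: le_area2_integral => x; rewrite /f patchE; case: ifPn => [_|].
      exact: leey.
    rewrite notin_setE /= => hx; rewrite (_ : [set y | _] = set0) ?measure0 //.
    apply/seteqP; split=> // y /= /Xm /=; rewrite /dot /= m2 mul0r addr0 => e.
    by apply: hx; rewrite -e mulrC mulKf.
  by rewrite /f -integral_mkcond integral_set1.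
apply: (@le_trans _ _ (\int[lebesgue_measure]_x (cst 0%E : R -> \bar R) x)%E); last first.
  by rewrite integral0.
apply: le_area2_integral => x.
apply: (le_trans (le_mu (_ : _ `<=` [set (k - m.1 * x) / m.2]))); last first.
  by rewrite lebesgue_measure_set1.
move=> y /= /Xm /=; rewrite /dot /= => <-.
by rewrite addrC addKr mulrC mulKf.
Qed.

End Metric.

(** * Radon partitions of four points *)

Section FivePoints.
Context {R : realType}.
Implicit Types (a b c d p q u w x y z : plane R) (s : R) (P : polygon R 5).

Lemma region_turn s p q P z : (forall k, 0 <= s * turn p q (P k)) -> region P z ->
  0 <= s * turn p q z.
Proof.
move=> h Pz; pose m : plane R := (s * (q.2 - p.2), - (s * (q.1 - p.1))).
have E v : s * turn p q v = dot m p - dot m v.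
  by rewrite /turn /cross /dot /m /=; ring.
rewrite E subr_ge0; apply: (region_halfplane _ Pz) => j.
by rewrite -subr_ge0 -E.
Qed.

Let meet_alg (A B A' B' u w x y : R) : A - B != 0 -> A' - B' = - (A - B) ->
  - B * u + A * w = (A - B + A') * x - A' * y ->
  (1 - A / (A - B)) * u + A / (A - B) * w =
  (1 - A' / (A' - B')) * x + A' / (A' - B') * y.
Proof.
move=> n e h; rewrite e.
have -> : (1 - A / (A - B)) * u + A / (A - B) * w = (- B * u + A * w) / (A - B) by field.
rewrite h invrN; by field.
Qed.

(** Each segment meets the line of the other, and the last hypothesis says that these lines are not
    parallel; the ratios of turns then give the same point on both segments. *)
Lemma segments_meet x y u w : turn x y u * turn x y w <= 0 ->
  turn u w x * turn u w y <= 0 -> turn x y u != turn x y w ->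
  exists z, segment x y z /\ segment u w z.
Proof.
move=> h1 h2 n; have D0 : turn x y u - turn x y w != 0 by rewrite subr_eq0.
have E : turn u w x - turn u w y = - (turn x y u - turn x y w).
  by rewrite /turn /cross /=; ring.
have D0' : turn u w x - turn u w y != 0 by rewrite E oppr_eq0.
have t01 (A B : R) : A * B <= 0 -> A - B != 0 -> 0 <= A / (A - B) /\ A / (A - B) <= 1.
  move=> AB n0.
  have s0 : 0 < (A - B) ^+ 2 by rewrite lt_neqAle sqr_ge0 andbT eq_sym sqrf_eq0.
  split.
    have -> : A / (A - B) = (A ^+ 2 - A * B) / (A - B) ^+ 2 by field.
    by apply: divr_ge0; [have := sqr_ge0 A; lra|exact: ltW].
  rewrite -subr_ge0; have -> : 1 - A / (A - B) = (B ^+ 2 - A * B) / (A - B) ^+ 2 by field.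
  by apply: divr_ge0; [have := sqr_ge0 B; lra|exact: ltW].
have [t0 t1] := t01 _ _ h1 D0; have [r0 r1] := t01 _ _ h2 D0'.
pose t := turn x y u / (turn x y u - turn x y w).
pose r := turn u w x / (turn u w x - turn u w y).
pose z : plane R := ((1 - t) * u.1 + t * w.1, (1 - t) * u.2 + t * w.2).
exists z; split; apply/segmentP; last by exists t.
by exists r; split=> //; apply: meet_alg => //; rewrite /turn /cross /=; ring.
Qed.

Let hull3_weights a b c d (k0 k1 k2 k3 : R) : 0 < k0 -> k1 <= 0 -> k2 <= 0 -> k3 <= 0 ->
  k0 + k1 + k2 + k3 = 0 ->
  k0 * a.1 + k1 * b.1 + k2 * c.1 + k3 * d.1 = 0 ->
  k0 * a.2 + k1 * b.2 + k2 * c.2 + k3 * d.2 = 0 -> hull3 b c d a.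
Proof.
move=> p0 p1 p2 p3 e e1 e2; have n0 : k0 != 0 by rewrite gt_eqF.
exists (- k1 / k0), (- k2 / k0), (- k3 / k0).
split; rewrite ?divr_ge0 ?oppr_ge0 ?(ltW p0) //.
  by rewrite -!mulrDl (_ : - k1 - k2 - k3 = k0) ?divff //; lra.
have g (a1 b1 c1 d1 : R) : k0 * a1 + k1 * b1 + k2 * c1 + k3 * d1 = 0 ->
    a1 = - k1 / k0 * b1 + - k2 / k0 * c1 + - k3 / k0 * d1.
  move=> h; have -> : - k1 / k0 * b1 + - k2 / k0 * c1 + - k3 / k0 * d1 =
    a1 - (k0 * a1 + k1 * b1 + k2 * c1 + k3 * d1) / k0 by field.
  by rewrite h mul0r subr0.
by split; exact: g.
Qed.

Let hull3_ends b c d : [/\ hull3 b c d b, hull3 b c d c & hull3 b c d d].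
Proof.
split; [exists 1, 0, 0|exists 0, 1, 0|exists 0, 0, 1]; split=> //; try ring;
  by split; ring.
Qed.

Let hull3_collinear a b c : turn a b c = 0 ->
  [\/ forall d, hull3 b c d a, forall d, hull3 a c d b | forall d, hull3 a b d c].
Proof.
move=> h; have [ab|ab] := boolP ((a.1 == b.1) && (a.2 == b.2)).
  constructor 1 => d; case/andP: ab => /eqP h1 /eqP h2.
  by have [+ _ _] := hull3_ends b c d; rewrite (plane_eqP h1 h2).
pose u := b - a; have uu : 0 < dot u u.
  rewrite lt_neqAle dot_ge0 andbT eq_sym; apply: contra ab => /eqP/dot_eq0[].
  by rewrite /u /= => h1 h2; apply/andP; split; rewrite eq_sym -subr_eq0; apply/eqP.
have un : dot u u != 0 by rewrite gt_eqF.
pose t := dot u (c - a) / dot u u.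
have c1 : c.1 = (1 - t) * a.1 + t * b.1.
  have : dot u u * (c.1 - a.1) = dot u (c - a) * u.1 - turn a b c * u.2.
    by rewrite /turn /cross /dot /u /=; ring.
  rewrite h mul0r subr0 => e; have -> : c.1 = a.1 + dot u u * (c.1 - a.1) / dot u u by field.
  by rewrite e /t /u /=; field.
have c2 : c.2 = (1 - t) * a.2 + t * b.2.
  have : dot u u * (c.2 - a.2) = dot u (c - a) * u.2 + turn a b c * u.1.
    by rewrite /turn /cross /dot /u /=; ring.
  rewrite h mul0r addr0 => e; have -> : c.2 = a.2 + dot u u * (c.2 - a.2) / dot u u by field.
  by rewrite e /t /u /=; field.
move: c1 c2; clearbody t => c1 c2.
have [t0|t0] := ltP t 0.
  constructor 1 => d; apply: (@hull3_weights _ _ _ _ (1 - t) t (-1) 0); rewrite ?c1 ?c2; lra.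
have [t1|t1] := leP t 1.
  constructor 3 => d; apply: (@hull3_weights _ _ _ _ 1 (t - 1) (- t) 0); rewrite ?c1 ?c2; lra.
by constructor 2 => d; apply: (@hull3_weights _ _ _ _ t (1 - t) (-1) 0); rewrite ?c1 ?c2; lra.
Qed.

(** Four weights of sum 0 without a split of one against three must split two against two; the
    conclusion tells whether the first two weights agree in sign. *)
Let two_two (k0 k1 k2 k3 : R) : k0 + k1 + k2 + k3 = 0 -> k3 < 0 ->
  (0 < k0 -> k1 <= 0 -> k2 <= 0 -> k3 <= 0 -> False) ->
  (0 < k1 -> k0 <= 0 -> k2 <= 0 -> k3 <= 0 -> False) ->
  (0 < k2 -> k0 <= 0 -> k1 <= 0 -> k3 <= 0 -> False) ->
  (k3 < 0 -> 0 <= k0 -> 0 <= k1 -> 0 <= k2 -> False) ->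
  (k0 * k1 >= 0 /\ k2 * k3 >= 0 /\ k2 + k3 != 0) \/ (k0 * k1 < 0 /\ k2 * k3 < 0).
Proof.
move=> e g3 A B C D; have h3 := ltW g3.
have [h2|g2] := leP k2 0.
  have g0 : 0 < k0.
    by rewrite ltNge; apply/negP => h0; apply: B => //; lra.
  have g1 : 0 < k1 by rewrite ltNge; apply/negP => h1; exact: A.
  left; split; first by rewrite mulr_ge0 // ltW.
  split; first by rewrite mulr_le0.
  by apply/eqP; lra.
right; rewrite (pmulr_rlt0 _ g2); split=> //.
have [h0|g0] := leP k0 0.
  have g1 : 0 < k1 by rewrite ltNge; apply/negP => h1; exact: C.
  rewrite (pmulr_llt0 _ g1) ltNge; apply/negP => h0'.
  by apply: D => //; exact: ltW.
rewrite (pmulr_rlt0 _ g0) ltNge; apply/negP => h1.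
by apply: D => //; exact: ltW.
Qed.

(** Radon's theorem, the turns of the triples being the weights of an affine dependence. One weight
    against three puts a point in the hull of the others; two against two makes two segments cross,
    and in the last alternative [a b] and [c d] are opposite sides of the convex quadrilateral. *)
Lemma four_points a b c d :
  [\/ hull3 b c d a, hull3 a c d b, hull3 a b d c | hull3 a b c d] \/
  (exists z, segment a b z /\ segment c d z) \/
  (0 < turn b c d * turn a c d /\ 0 < turn a b c * turn a b d).
Proof.
have [H|H] := pselect ([\/ hull3 b c d a, hull3 a c d b, hull3 a b d c | hull3 a b c d]).
  by left.
right.
have Ha : ~ hull3 b c d a by move=> h; apply: H; constructor 1.
have Hb : ~ hull3 a c d b by move=> h; apply: H; constructor 2.
have Hc : ~ hull3 a b d c by move=> h; apply: H; constructor 3.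
have Hd : ~ hull3 a b c d by move=> h; apply: H; constructor 4.
have Hn : turn a b c <> 0.
  move=> /hull3_collinear [/(_ d)//|/(_ d)//|/(_ d) h].
  by apply: Hc.
pose k0 := turn b c d; pose k1 := - turn a c d; pose k2 := turn a b d; pose k3 := - turn a b c.
have e : k0 + k1 + k2 + k3 = 0 by rewrite /k0 /k1 /k2 /k3 /turn /cross /=; ring.
have e1 : k0 * a.1 + k1 * b.1 + k2 * c.1 + k3 * d.1 = 0.
  by rewrite /k0 /k1 /k2 /k3 /turn /cross /=; ring.
have e2 : k0 * a.2 + k1 * b.2 + k2 * c.2 + k3 * d.2 = 0.
  by rewrite /k0 /k1 /k2 /k3 /turn /cross /=; ring.
have n3 : k3 <> 0 by rewrite /k3 => /eqP; rewrite oppr_eq0 => /eqP.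
have X : k0 * k1 >= 0 -> k2 * k3 >= 0 -> k2 + k3 != 0 -> exists z, segment a b z /\ segment c d z.
  move=> h1 h2 h3; apply: segments_meet.
  - by move: h2; rewrite /k2 /k3; lra.
  - by move: h1; rewrite /k0 /k1 (turn_rot c d b) (turn_rot d b c) (turn_rot c d a) (turn_rot d a c); lra.
  - by move: h3; rewrite /k2 /k3 subr_eq0 eq_sym.
suff : (k0 * k1 >= 0 /\ k2 * k3 >= 0 /\ k2 + k3 != 0) \/ (k0 * k1 < 0 /\ k2 * k3 < 0).
  move=> [[h1 [h2 h3]]|[h1 h2]]; first by left; exact: X.
  by right; move: h1 h2; rewrite /k0 /k1 /k2 /k3; split; lra.
have Wa s : s * s = 1 -> 0 < s * k0 -> s * k1 <= 0 -> s * k2 <= 0 -> s * k3 <= 0 -> False.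
  move=> _ h0 h1 h2 h3; apply: Ha; apply: (hull3_weights h0 h1 h2 h3).
  - by rewrite -!mulrDr e mulr0.
  - by rewrite -!mulrA -!mulrDr e1 mulr0.
  - by rewrite -!mulrA -!mulrDr e2 mulr0.
have Wb s : s * s = 1 -> 0 < s * k1 -> s * k0 <= 0 -> s * k2 <= 0 -> s * k3 <= 0 -> False.
  move=> _ h0 h1 h2 h3; apply: Hb; apply: (hull3_weights h0 h1 h2 h3).
  - by rewrite -!mulrDr (addrC k1) e mulr0.
  - by rewrite -!mulrA -!mulrDr (addrC (k1 * _)) e1 mulr0.
  - by rewrite -!mulrA -!mulrDr (addrC (k1 * _)) e2 mulr0.
have Wc s : s * s = 1 -> 0 < s * k2 -> s * k0 <= 0 -> s * k1 <= 0 -> s * k3 <= 0 -> False.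
  move=> _ h0 h1 h2 h3; apply: Hc; apply: (hull3_weights h0 h1 h2 h3).
  - by rewrite -!mulrDr (_ : _ + _ = 0) ?mulr0 //; lra.
  - by rewrite -!mulrA -!mulrDr (_ : _ + _ = 0) ?mulr0 //; lra.
  - by rewrite -!mulrA -!mulrDr (_ : _ + _ = 0) ?mulr0 //; lra.
have Wd s : s * s = 1 -> 0 < s * k3 -> s * k0 <= 0 -> s * k1 <= 0 -> s * k2 <= 0 -> False.
  move=> _ h0 h1 h2 h3; apply: Hd; apply: (hull3_weights h0 h1 h2 h3).
  - by rewrite -!mulrDr (_ : _ + _ = 0) ?mulr0 //; lra.
  - by rewrite -!mulrA -!mulrDr (_ : _ + _ = 0) ?mulr0 //; lra.
  - by rewrite -!mulrA -!mulrDr (_ : _ + _ = 0) ?mulr0 //; lra.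
clearbody k0 k1 k2 k3.
have s1 : (1 : R) * 1 = 1 by rewrite mulr1.
have s2 : (-1 : R) * -1 = 1 by rewrite mulrNN mulr1.
have {Wa} [A1 A2] := (Wa 1 s1, Wa (-1) s2).
have {Wb} [B1 B2] := (Wb 1 s1, Wb (-1) s2).
have {Wc} [C1 C2] := (Wc 1 s1, Wc (-1) s2).
have {Wd} [D1 D2] := (Wd 1 s1, Wd (-1) s2).
move: A1 A2 B1 B2 C1 C2 D1 D2; rewrite !mul1r !mulN1r !oppr_gt0 !oppr_le0.
move: e n3; clear -two_two; move: k0 k1 k2 k3 => k0 k1 k2 k3 e n3 A1 A2 B1 B2 C1 C2 D1 D2.
have [g3|g3|//] := ltgtP k3 0; first exact: (two_two e g3 A1 B1 C1 D2).
have := @two_two (- k0) (- k1) (- k2) (- k3).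
rewrite !oppr_gt0 !oppr_lt0 !oppr_le0 !oppr_ge0 !mulrNN -(opprD k2) oppr_eq0; apply => //.
lra.
Qed.

End FivePoints.

(** * Simple pentagons and their convex hulls *)

Section SimplePentagon.
Context {R : realType}.
Implicit Types (a b c d p q u w x y z : plane R) (s : R) (P : polygon R 5).

Lemma simple_disjoint P (k l : 'I_5) z : simple_polygon P -> k != l ->
  ordS k != l -> ordS l != k -> edge P k z -> edge P l z -> False.
Proof.
move=> [_ h] kl kl1 kl2 zk zl.
by have [[e _]|[e _]] := h k l z kl zk zl; [rewrite e eqxx in kl1|rewrite e eqxx in kl2].
Qed.

Lemma others (m i : 'I_5) : i != m -> [\/ i = ordS m, i = ordS2 m,
  i = ordS3 m | i = ordS4 m].
Proof.
move: m i; apply: I5P; apply: I5P => // _; do ?[by constructor 1; apply/val_inj|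
 by constructor 2; apply/val_inj|by constructor 3; apply/val_inj|
 by constructor 4; apply/val_inj].
Qed.

Definition in_hull_of_others P m := exists i j l,
  [/\ i != m, j != m, l != m & hull3 (P i) (P j) (P l) (P m)].

(** Leaving out a vertex [m], the other four span two disjoint sides of the pentagon. These cannot
    cross, and no vertex is in the hull of others, so only the last alternative of [four_points]
    remains. *)
Lemma simple_extreme_convex P : simple_polygon P ->
  (forall m, ~ in_hull_of_others P m) -> exists s, sconvex s P.
Proof.
move=> sP H.
have key m : 0 < turn (P (ordS2 m)) (P (ordS3 m)) (P (ordS4 m)) *
    turn (P (ordS m)) (P (ordS3 m)) (P (ordS4 m)) /\
    0 < turn (P (ordS m)) (P (ordS2 m)) (P (ordS3 m)) *
    turn (P (ordS m)) (P (ordS2 m)) (P (ordS4 m)).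
  have := four_points (P (ordS m)) (P (ordS2 m)) (P (ordS3 m))
     (P (ordS4 m)).
  case=> [h|[[z [z1 z2]]|//]]; exfalso.
    have ne : [/\ ordS m != ordS2 m, ordS m != ordS3 m,
      ordS m != ordS4 m, ordS2 m != ordS3 m &
      ordS2 m != ordS4 m] /\
      ordS3 m != ordS4 m.
      by move: m {h}; apply: I5P.
    case: ne => -[n1 n2 n3 n4 n5] n6.
    case: h => h; [apply: (H (ordS m))|apply: (H (ordS2 m))|
      apply: (H (ordS3 m))|apply: (H (ordS4 m))].
    - by do 3 eexists; split; [| | |exact: h]; rewrite // eq_sym.
    - by do 3 eexists; split; [| | |exact: h]; rewrite // eq_sym.
    - by do 3 eexists; split; [| | |exact: h]; rewrite // eq_sym.
    - by do 3 eexists; split; [| | |exact: h]; rewrite // eq_sym.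
  apply: (simple_disjoint sP _ _ _ z1 z2); move: m {z1 z2}; exact: I5P.
have := key v0; have := key v1; have := key v2; have := key v3; have := key v4.
case: ordS5 => o0 o1 o2 o3 o4; rewrite !(o0, o1, o2, o3, o4).
move=> [a1 a2] [b1 b2] [c1 c2] [d1 d2] [e1 e2].
pose t : R := if 0 <= turn (P v0) (P v1) (P v2) then 1 else -1.
have tt : t * t = 1 by rewrite /t; case: ifP => _; ring.
have t0 : 0 < t * turn (P v0) (P v1) (P v2).
  rewrite lt_neqAle; apply/andP; split.
    rewrite eq_sym mulf_eq0 negb_or; apply/andP; split.
      by rewrite /t; case: ifP => _; rewrite ?oppr_eq0 oner_eq0.
    apply/eqP => e.
    by move: a2; rewrite e mul0r ltxx.
  by rewrite /t; case: ifPn => [|]; [rewrite mul1r|rewrite -ltNge mulN1r oppr_ge0 => /ltW].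
(* Each product in [key] ties the signs of two triples of vertices. From the triple of [v0], [v1],
   [v2] these ties reach all ten triples. *)
have step (x y : R) : 0 < x * y -> 0 < t * x -> 0 < t * y.
  move=> xy tx; have : 0 < t * x * (t * y) by rewrite mulrACA tt mul1r.
  by rewrite pmulr_rgt0.
have step' (x y : R) : 0 < x * y -> 0 < t * y -> 0 < t * x.
  by rewrite mulrC; exact: step.
have s013 := step _ _ a2 t0.
have s412 := step _ _ b1 t0.
have s301 : 0 < t * turn (P v3) (P v0) (P v1) by rewrite turn_rot.
have s401 := step' _ _ c1 s301.
have s402 := step _ _ b2 s401.
have s124 : 0 < t * turn (P v1) (P v2) (P v4) by rewrite -turn_rot.
have s123 := step' _ _ e2 s124.
have s023 := step _ _ a1 s123.
have s230 : 0 < t * turn (P v2) (P v3) (P v0) by rewrite -turn_rot.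
have s234 := step' _ _ d2 s230.
have s134 := step _ _ e1 s234.
have s240 : 0 < t * turn (P v2) (P v4) (P v0) by rewrite -2!turn_rot.
have s340 := step' _ _ d1 s240.
have s341 := step _ _ c2 s340.
exists t; split=> //; apply: I5P; rewrite ?(o0, o1, o2, o3, o4); apply: I5P => // _ _.
all: by [|rewrite turn_rot|rewrite 2!turn_rot].
Qed.

Section AreaOne.
Context (P : polygon R 5).
Hypotheses (sP : simple_polygon P) (aP : area P = 1%:E).

Let inj (i j : 'I_5) : i != j -> P i <> P j.
Proof. by move=> ij e; move/eqP: ij; apply; case: sP => + _; apply. Qed.

(* [dhull a b c d p] says that p lies in the convex hull of a, b, c, d, through
   the half-planes containing these points. *)
Definition dhull a b c d p := forall s x y, 0 <= s * turn x y a -> 0 <= s * turn x y b ->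
  0 <= s * turn x y c -> 0 <= s * turn x y d -> 0 <= s * turn x y p.

(** The region lies in the triangle, whose [turn], twice its area, is therefore at least 2; whence
    [432 = 108 * 2 ^ 2]. A flat triangle would put the region on a line and make its area 0. *)
Lemma triangle_hull_perimeter x y z : x <> y ->
  (forall k, dhull x y z z (P k)) ->
  Defs.edist x y + Defs.edist y z + Defs.edist z x <= perimeter P ->
  432 <= perimeter P ^+ 4.
Proof.
move=> xy hP le.
have [T0|Tn] := eqVneq (turn x y z) 0.
  pose m : plane R := ((y - x).2, - (y - x).1).
  have m0 : m <> 0.
    move=> e; apply: xy; have e1 := congr1 fst e; have e2 := congr1 snd e.
    by move: e1 e2; rewrite /m /= => e1 e2; apply: plane_eqP; lra.
  have E v : turn x y v = dot m x - dot m v.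
    by rewrite /turn /cross /dot /m /=; ring.
  have PE k : turn x y (P k) = 0.
    have h s : 0 <= s * turn x y (P k).
      by apply: hP; rewrite ?turn_l ?turn_r ?T0 mulr0.
    by have := h 1; have := h (-1); rewrite mulN1r mul1r; lra.
  have : (area2 (region P) <= 0)%E.
    apply: (area2_line (m := m) (k := dot m x)) => // w Pw /=.
    have h s : 0 <= s * turn x y w.
      by apply: (region_turn _ Pw) => k; rewrite PE mulr0.
    by have := h 1; have := h (-1); rewrite E mulN1r mul1r; lra.
  by rewrite -[area2 _]/(area P) aP lee_fin ler10.
pose s : R := if 0 <= turn x y z then 1 else -1.
have ss : s * s = 1 by rewrite /s; case: ifP => _; ring.
have sT : 0 < s * turn x y z.
  rewrite lt_neqAle eq_sym mulf_eq0 negb_or Tn andbT /s; case: ifPn => h.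
    by rewrite oner_eq0 mul1r h.
  by rewrite oppr_eq0 oner_eq0 mulN1r oppr_ge0 ltW // ltNge.
have sub : region P `<=` ctri s x y z.
  have h0 := ltW sT.
  have h1 : 0 <= s * turn y z x by rewrite -turn_rot.
  have h2 : 0 <= s * turn z x y by rewrite turn_rot.
  by move=> w Pw; split; apply: (region_turn _ Pw) => k; apply: hP;
    rewrite ?turn_l ?turn_r ?mulr0.
have := area2_ctri sub ss sT; rewrite -[area2 _]/(area P) aP lee_fin => A1.
have T2 : 4 <= turn x y z ^+ 2.
  have -> : turn x y z ^+ 2 = (s * turn x y z) ^+ 2 by rewrite exprMn [s ^+ 2]expr2 ss mul1r.
  have -> : 4 = 2 ^+ 2 :> R by ring.
  by rewrite ler_pXn2r // ?nnegrE; lra.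
have I := triangle_isoperimetric x y z.
apply: le_trans (_ : (Defs.edist x y + Defs.edist y z + Defs.edist z x) ^+ 4 <= _); first lra.
by rewrite ler_pXn2r // ?nnegrE ?(le_trans _ le) // !addr_ge0 // plane_edist_ge0.
Qed.

Lemma dhull_absorb a b c d p : hull3 a b c d -> dhull a b c d p -> dhull a b c c p.
Proof. by move=> hd h s x y ha hb hc _; apply: h => //; apply: (hull3_turn hd). Qed.

Let vertex_dhull m k (a := P (ordS m)) (b := P (ordS2 m)) (c := P (ordS3 m))
    (d := P (ordS4 m)) :
  dhull a b c d (P m) -> dhull a b c d (P k).
Proof.
by move=> h; have [->//|/others[] ->] := eqVneq k m; move=> s x y.
Qed.

Let perimeterE m : perimeter P =
  Defs.edist (P m) (P (ordS m)) + Defs.edist (P (ordS m)) (P (ordS2 m)) +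
  Defs.edist (P (ordS2 m)) (P (ordS3 m)) +
  Defs.edist (P (ordS3 m)) (P (ordS4 m)) +
  Defs.edist (P (ordS4 m)) (P m).
Proof. by rewrite /perimeter (sum5_rot _ m) /edge_length ordS_cycle. Qed.

(** Skipping [P m] shortens the perimeter and keeps the hull, so the isoperimetric inequality for
    the hull applies. In the quadrilateral case the signs at the other corners are recorded because
    they leave [m] as the only possible reflex corner. *)
Lemma reducible_pentagon m : in_hull_of_others P m ->
  432 <= perimeter P ^+ 4 \/
  (16 <= perimeter P ^+ 2 /\ exists s, [/\ s * s = 1, 0 < s * signed_area P &
    forall k, k != m -> 0 <= s * turn (P (ord_pred k)) (P k) (P (ordS k))]).
Proof.
move=> [i [j [l [im jm lm hm]]]].
have D : dhull (P (ordS m)) (P (ordS2 m)) (P (ordS3 m))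
    (P (ordS4 m)) (P m).
  move=> s x y ha hb hc hd.
  have g k : k != m -> 0 <= s * turn x y (P k) by move=> /others[] ->.
  by apply: (hull3_turn hm); exact: g.
have D' k := vertex_dhull k D.
have pe := perimeterE m.
have ne : [/\ ordS m != ordS2 m, ordS m != ordS3 m &
    ordS2 m != ordS3 m].
  by move: m {i j l im jm lm hm D D' pe}; apply: I5P.
case: ne => /inj nab /inj nac /inj nbc.
have npb : P m <> P (ordS2 m).
  by apply: inj; move: m {i j l im jm lm hm D D' pe nab nac nbc}; apply: I5P.
have da := plane_edist_triangle (P (ordS4 m)) (P m) (P (ordS m)).
have cross1 z : edge P (ordS m) z -> edge P (ordS3 m) z -> False.
  by apply: (simple_disjoint sP); move: m {i j l im jm lm hm D D' pe nab nac nbc npb da}; exact: I5P.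
have cross2 z : edge P (ordS2 m) z -> edge P (ordS4 m) z -> False.
  by apply: (simple_disjoint sP); move: m {i j l im jm lm hm D D' pe nab nac nbc npb da cross1}; exact: I5P.
have cross3 z : edge P m z -> edge P (ordS2 m) z -> False.
  by apply: (simple_disjoint sP); move: m {i j l im jm lm hm D D' pe nab nac nbc npb da cross1 cross2}; exact: I5P.
have area1 s : s * s = 1 -> 0 < s * turn (P (ordS m)) (P (ordS2 m)) (P (ordS3 m)) ->
   0 < s * turn (P (ordS m)) (P (ordS3 m)) (P (ordS4 m)) ->
   0 < s * turn (P (ordS2 m)) (P (ordS3 m)) (P (ordS4 m)) ->
   0 < s * turn (P (ordS m)) (P (ordS2 m)) (P (ordS4 m)) ->
   2 <= s * turn (P (ordS m)) (P (ordS2 m)) (P (ordS3 m)) +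
    s * turn (P (ordS m)) (P (ordS3 m)) (P (ordS4 m)).
  move: D' => /=; set a := P (ordS m); set b := P _; set c := P _; set d := P _.
  move=> D' ss abc acd bcd abd.
  have sub : region P `<=` ctri s a b c `|` ctri s a c d.
    move=> w Pw.
    have w1 : 0 <= s * turn a b w.
      by apply: (region_turn _ Pw) => k; apply: D'; rewrite ?turn_l ?turn_r ?mulr0 // ltW.
    have w2 : 0 <= s * turn b c w.
      apply: (region_turn _ Pw) => k; apply: D'; rewrite ?turn_l ?turn_r ?mulr0 // ?ltW //.
      by rewrite -turn_rot.
    have w3 : 0 <= s * turn c d w.
      apply: (region_turn _ Pw) => k; apply: D'; rewrite ?turn_l ?turn_r ?mulr0 // ?ltW //.
        by rewrite -turn_rot.
      by rewrite -turn_rot.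
    have w4 : 0 <= s * turn d a w.
      apply: (region_turn _ Pw) => k; apply: D'; rewrite ?turn_l ?turn_r ?mulr0 // ?ltW //.
        by rewrite turn_rot.
      by rewrite turn_rot.
    have [h|/ltW h] := leP (s * turn a c w) 0.
      by left; split=> //; rewrite turn_swap mulrN oppr_ge0.
    by right; split.
  have := area2_ctriU sub ss abc acd; rewrite -[area2 _]/(area P) aP lee_fin; lra.
move: D' pe nab nac nbc npb da cross1 cross2 cross3 area1 D.
have sgA : signed_area P = (turn (P m) (P (ordS m)) (P (ordS2 m)) +
    turn (P m) (P (ordS2 m)) (P (ordS3 m)) +
    turn (P m) (P (ordS3 m)) (P (ordS4 m))) / 2.
  rewrite /signed_area (sum5_rot _ m) !ordS_cycle.
  by congr (_ / 2); rewrite /turn /cross /=; ring.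
have corners s : 0 <= s * turn (P m) (P (ordS m)) (P (ordS2 m)) ->
    0 <= s * turn (P (ordS m)) (P (ordS2 m)) (P (ordS3 m)) ->
    0 <= s * turn (P (ordS2 m)) (P (ordS3 m)) (P (ordS4 m)) ->
    0 <= s * turn (P (ordS3 m)) (P (ordS4 m)) (P m) ->
    forall k, k != m -> 0 <= s * turn (P (ord_pred k)) (P k) (P (ordS k)).
  move=> h1 h2 h3 h4 k /others[] ->; rewrite ordSK // ordS_cycle //.
rewrite sgA /edge ordS_cycle; move: corners.
move: (P m) (P (ordS m)) (P (ordS2 m)) (P (ordS3 m))
  (P (ordS4 m)) => p a b c d.
move=> corners D' pe nab nac nbc npb da cross1 cross2 cross3 area1 D.
case: (four_points a b c d) => [hull|[[z [z1 z2]]|[h1 h2]]]; last first.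
- pose s : R := if 0 <= turn a b c then 1 else -1.
  have ss : s * s = 1 by rewrite /s; case: ifP => _; ring.
  have abc : 0 < s * turn a b c.
    rewrite lt_neqAle; apply/andP; split.
      rewrite eq_sym mulf_eq0 negb_or; apply/andP; split.
        by rewrite /s; case: ifP => _; rewrite ?oppr_eq0 oner_eq0.
      by apply/eqP => e; move: h2; rewrite e mul0r ltxx.
    by rewrite /s; case: ifPn => [|]; [rewrite mul1r|rewrite -ltNge mulN1r oppr_ge0 => /ltW].
  have abd : 0 < s * turn a b d.
    have : 0 < s * turn a b c * (s * turn a b d) by rewrite mulrACA ss mul1r.
    by rewrite pmulr_rgt0.
  have prod : 0 < s * turn b c d * (s * turn a c d) by rewrite mulrACA ss mul1r.
  have DD x y : 0 <= s * turn x y a -> 0 <= s * turn x y b -> 0 <= s * turn x y c ->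
    0 <= s * turn x y d -> 0 <= s * turn x y p by exact: D.
  move: {D} DD => D; have abp : 0 <= s * turn a b p.
    by apply: D; rewrite ?turn_l ?turn_r ?mulr0 // ltW.
  have [bcd|bcd] := ltP 0 (s * turn b c d).
    have acd : 0 < s * turn a c d by move: prod; rewrite pmulr_rgt0.
    have A2 := area1 s ss abc acd bcd abd; right; split.
      have Q := quad_isoperimetric a b c d ss.
      apply: le_trans (_ : (Defs.edist a b + Defs.edist b c + Defs.edist c d + Defs.edist d a) ^+ 2 <= _).
        lra.
      by rewrite ler_pXn2r // ?nnegrE ?pe ?addr_ge0 ?plane_edist_ge0 //; lra.
    have bcp : 0 <= s * turn b c p.
      apply: D; rewrite ?turn_l ?turn_r ?mulr0 //; last exact: ltW.
      by rewrite -turn_rot ltW.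
    have cdp : 0 <= s * turn c d p.
      apply: D; rewrite ?turn_l ?turn_r ?mulr0 //; by rewrite -turn_rot ltW.
    exists s; split=> //; last first.
      by apply: corners => //; [rewrite turn_rot|exact: ltW|exact: ltW].
    have -> : s * ((turn p a b + turn p b c + turn p c d) / 2) =
      (s * turn a b p + s * turn b c p + s * turn c d p) / 2.
      by rewrite -!(turn_rot p); field.
    (* The signed area is a sum of three nonnegative fan triangles at [p]. If the first two were
       both flat, [p] would lie on the lines [a b] and [b c], hence be [b]. *)
    suff : ~ (s * turn a b p <= 0 /\ s * turn b c p <= 0).
      move=> n; apply: divr_gt0 => //.
      have [x0|x0] := ltP 0 (s * turn a b p); first by lra.
      have [y0|y0] := ltP 0 (s * turn b c p); first by lra.
      by exfalso; apply: n.
    move=> [x0 y0]; apply: npb.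
    have {x0} x0 : s * turn a b p = 0 by lra.
    have {y0} y0 : s * turn b c p = 0 by lra.
    have tn : s * turn a b c != 0 by rewrite gt_eqF.
    apply: plane_eqP; apply: (mulfI tn); apply/eqP; rewrite -subr_eq0 -mulrBr; apply/eqP.
      have -> : s * turn a b c * (p.1 - b.1) = s * turn a b p * (c.1 - b.1) -
        s * turn b c p * (b.1 - a.1) by rewrite /turn /cross /=; ring.
      by rewrite x0 y0 !mul0r subrr.
    have -> : s * turn a b c * (p.2 - b.2) = s * turn a b p * (c.2 - b.2) -
      s * turn b c p * (b.2 - a.2) by rewrite /turn /cross /=; ring.
    by rewrite x0 y0 !mul0r subrr.
  (* Here b c is a diagonal of the convex quadrilateral a b d c, which the two
     sides through p cannot avoid. *)
  have {bcd} bcd : s * turn b c d < 0.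
    by rewrite lt_neqAle bcd andbT; apply: contraTneq prod => ->; rewrite mul0r ltxx.
  have acd : s * turn a c d < 0 by move: prod; rewrite nmulr_rgt0.
  have sM (x y : R) : (s * x) * (s * y) <= 0 -> x * y <= 0 by rewrite mulrACA ss mul1r.
  have [bcp|bcp] := leP 0 (s * turn b c p).
    have bdp : 0 <= s * turn b d p.
      apply: D; rewrite ?turn_l ?turn_r ?mulr0 //; first by rewrite -turn_rot ltW.
      by rewrite -turn_rot turn_swap mulrN oppr_ge0 ltW.
    have dcp : 0 <= s * turn d c p.
      by apply: D; rewrite ?turn_l ?turn_r ?mulr0 //;
        rewrite turn_swap -turn_rot mulrN oppr_ge0 ltW.
    have [|||z [z1 z2]] := @segments_meet _ b c d p.
    - by apply: sM; rewrite nmulr_rle0.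
    - apply: sM; rewrite -(turn_rot b d p).
      have -> : turn d p c = - turn d c p by rewrite -turn_rot turn_swap.
      by apply: mulr_ge0_le0; rewrite ?mulrN ?oppr_le0.
    - by apply/eqP => e; move: bcp; rewrite -e leNgt bcd.
    - by exfalso; exact: (cross2 z).
  have cap : 0 <= s * turn c a p.
    apply: D; rewrite ?turn_l ?turn_r ?mulr0 //; first by rewrite turn_rot ltW.
    by rewrite turn_swap mulrN oppr_ge0 ltW.
  have [|||z [z1 z2]] := @segments_meet _ b c p a.
  - by apply: sM; rewrite nmulr_rle0 // -turn_rot ltW.
  - apply: sM; rewrite (turn_rot p a b).
    have -> : turn p a c = - turn c a p by rewrite /turn /cross /=; ring.
    by apply: mulr_ge0_le0; rewrite ?mulrN ?oppr_le0.
  - by apply/eqP => e; move: bcp; rewrite e -turn_rot ltNge ltW.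
  - by exfalso; exact: (cross3 z).
- by exfalso; exact: (cross1 z).
left; case: hull => h.
- apply: (@triangle_hull_perimeter b c d) => //.
    by move=> k; apply: (dhull_absorb h) => t x y ? ? ? ?; apply: (D' k t x y).
  have := plane_edist_triangle d a b; lra.
- apply: (@triangle_hull_perimeter a c d) => //.
    by move=> k; apply: (dhull_absorb h) => t x y ? ? ? ?; apply: (D' k t x y).
  have := plane_edist_triangle a b c; lra.
- apply: (@triangle_hull_perimeter a b d) => //.
    by move=> k; apply: (dhull_absorb h) => t x y ? ? ? ?; apply: (D' k t x y).
  have := plane_edist_triangle b c d; lra.
- apply: (@triangle_hull_perimeter a b c) => //.
    by move=> k; apply: (dhull_absorb h) => t x y ? ? ? ?; apply: (D' k t x y).
  have := plane_edist_triangle c d a; lra.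
Qed.

End AreaOne.
End SimplePentagon.

(** * Reflex angles and lower bounds for perimeters *)

Section Reflex.
Context {R : realType}.
Implicit Types (u w : plane R) (s : R) (P : polygon R 5).

Lemma cosine_itv u w : -1 <= dot u w / (enorm u * enorm w) <= 1.
Proof.
have [->|n] := eqVneq (enorm u * enorm w) 0.
  by rewrite invr0 mulr0 lerN10 ler01.
have p : 0 < enorm u * enorm w by rewrite lt_neqAle eq_sym n mulr_ge0 ?enorm_ge0.
rewrite -ler_norml -(@expr_le1 _ 2) // real_normK ?num_real //.
rewrite expr_div_n -dot_cross_sqr ler_pdivrMr ?mul1r ?lerDl ?sqr_ge0 //.
by rewrite dot_cross_sqr exprn_gt0.
Qed.

(** It repeats the test in [interior_angle], so a zero signed area counts as counterclockwise. *)
Definition orientation P : R := if 0 <= signed_area P then 1 else -1.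

Lemma orientation_sqr P : orientation P * orientation P = 1.
Proof. by rewrite /orientation; case: ifP => _; ring. Qed.

Lemma orientationP s P : s * s = 1 -> 0 < s * signed_area P -> orientation P = s.
Proof.
rewrite /orientation => /sign_cases[->|->]; first by rewrite mul1r => /ltW ->.
by rewrite mulN1r oppr_gt0 ltNge => /negbTE ->.
Qed.

Lemma interior_angleE P k (s := orientation P)
    (t := s * turn (P (ord_pred k)) (P k) (P (ordS k))) :
  interior_angle P k = if 0 <= t then ang P k else 2 * pi - ang P k.
Proof.
have e1 : cross (P (ordS k) - P k) (P (ord_pred k) - P k) =
    turn (P (ord_pred k)) (P k) (P (ordS k)).
  by rewrite /turn /cross /=; ring.
have e2 : cross (P (ord_pred k) - P k) (P (ordS k) - P k) =
    - turn (P (ord_pred k)) (P k) (P (ordS k)).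
  by rewrite -e1 /cross; ring.
rewrite /interior_angle /ccw_angle /t /s /orientation.
case: ifP => _; first by rewrite e1 mul1r.
by rewrite e2 mulN1r -[acos _]/(vangle _ _) vangleC.
Qed.

Lemma ang_pi P k : 0 <= ang P k <= pi.
Proof.
have := cosine_itv (P (ordS k) - P k) (P (ord_pred k) - P k) => h.
by rewrite /ang /vangle acos_ge0 // acos_lepi.
Qed.

Lemma reflex_turn P k : pi < interior_angle P k ->
  orientation P * turn (P (ord_pred k)) (P k) (P (ordS k)) < 0.
Proof.
rewrite interior_angleE; case: ifPn => [_|]; last by rewrite -ltNge.
by have /andP[_ +] := ang_pi P k; rewrite leNgt => /negbTE ->.
Qed.

Lemma perimeter_ge0 P : 0 <= perimeter P.
Proof. by apply: sumr_ge0 => k _; exact: enorm_ge0. Qed.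

(** A vertex in the hull of the others would leave a quadrilateral or triangle containing area 1,
    and 4 is the perimeter of the unit square, the best quadrilateral; triangles do worse. *)
Lemma short_pentagon_convex P : simple_polygon P -> area P = 1%:E -> perimeter P < 4 ->
  exists s, sconvex s P.
Proof.
move=> sP aP p4; have p0 := perimeter_ge0 P.
have [[m hm]|H] := pselect (exists m, in_hull_of_others P m); last first.
  by apply: simple_extreme_convex => // m hm; apply: H; exists m.
have p2 : perimeter P ^+ 2 < 16.
  have -> : 16 = 4 ^+ 2 :> R by ring.
  by rewrite ltr_pXn2r // nnegrE.
have p4' : perimeter P ^+ 4 < 256.
  have -> : 256 = 4 ^+ 4 :> R by ring.
  by rewrite ltr_pXn2r // nnegrE.
by exfalso; have [|[+ _]] := reducible_pentagon sP aP hm; lra.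
Qed.

(** Two reflex corners rule out both strict convexity and a quadrilateral hull with a single
    exceptional corner. What is left is the triangle bound, and [(9 / 2) ^+ 4] is just below 432. *)
Lemma type2_perimeter P : type2_nonconvex P -> area P = 1%:E -> 9 / 2 <= perimeter P.
Proof.
move=> [sP [k [l [kl hk hl]]]] aP; have p0 := perimeter_ge0 P.
have rk := reflex_turn hk; have rl := reflex_turn hl.
have big : 432 <= perimeter P ^+ 4 -> 9 / 2 <= perimeter P.
  move=> h; rewrite leNgt; apply/negP => hp.
  have : perimeter P ^+ 4 < (9 / 2) ^+ 4.
    rewrite ltr_pXn2r // nnegrE; lra.
  have -> : (9 / 2) ^+ 4 = 6561 / 16 :> R by field.
  lra.
have [[m hm]|H] := pselect (exists m, in_hull_of_others P m).
  case: (reducible_pentagon sP aP hm) => [/big //|[_ [s [ss sa h]]]].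
  rewrite (orientationP ss sa) in rk rl.
  have km : k = m by apply/eqP; apply: contraT => /h; rewrite leNgt rk.
  have lm : l = m by apply/eqP; apply: contraT => /h; rewrite leNgt rl.
  by exfalso; apply: kl; rewrite km lm.
have [s cv] : exists s, sconvex s P.
  by apply: simple_extreme_convex => // m hm; apply: H; exists m.
have [ss _] := cv.
have sa : 0 < s * signed_area P.
  have := area_convex cv; rewrite aP => -[<-]; exact: ltr01.
rewrite (orientationP ss sa) in rk.
have := turn_corner_gt0 k cv; move: rk; rewrite /turn /cross /=; lra.
Qed.

End Reflex.

(** * Cairo and Prismatic pentagons *)

Section Circumscribed.
Context {R : realType}.
Implicit Types (u w c x : plane R) (s r : R) (P C : polygon R 5).

(** Doubling [pi / 3] gives its supplement, so the cosine is the positive root of a quadratic. *)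
Lemma cos_pi3 : cos (pi / 3) = 2^-1 :> R.
Proof.
have p0 := @pi_gt0 R.
set t : R := pi / 3.
have e : cos (t *+ 2) = - cos t.
  by rewrite -(cosN t) -cosDpi; congr cos; rewrite /t mulr2n; field.
have : (2 * cos t - 1) * (cos t + 1) = 0.
  by move: e; rewrite cos_mulr2n mulr2n => e; lra.
have c0 : 0 < cos t by apply: cos_gt0_pihalf; rewrite /t; apply/andP; split; lra.
move=> /eqP; rewrite mulf_eq0 => /orP[/eqP h|/eqP h]; last by exfalso; lra.
lra.
Qed.

Let sqr_inj_ge0 (a b : R) : 0 <= a -> 0 <= b -> a ^+ 2 = b ^+ 2 -> a = b.
Proof. by move=> a0 b0 /eqP; rewrite eqf_sqr => /orP[/eqP//|/eqP e]; lra. Qed.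

Lemma sin_pi3 : sin (pi / 3) = Num.sqrt 3 / 2 :> R.
Proof.
have p0 := @pi_gt0 R.
have s0 : 0 <= sin (pi / 3) :> R by apply: sin_ge0_pi; apply/andP; split; lra.
have h : sin (pi / 3) ^+ 2 = (Num.sqrt 3 / 2) ^+ 2 :> R.
  by rewrite sin2cos2 cos_pi3 expr_div_n (sqr_sqrtr (ler0n _ 3)); field.
have s1 : 0 <= Num.sqrt 3 / 2 :> R by rewrite divr_ge0 ?sqrtr_ge0.
exact: (sqr_inj_ge0 s0 s1 h).
Qed.

Lemma hcot_pihalf : hcot (pi / 2) = 1 :> R.
Proof. by rewrite /hcot cos_pihalf sin_pihalf; field. Qed.

Lemma hcot_2pi3 : hcot (2 * pi / 3) = Num.sqrt 3 / 3 :> R.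
Proof.
have s3 : Num.sqrt 3 != 0 :> R by rewrite gt_eqF // sqrtr_gt0.
have ss : Num.sqrt 3 * Num.sqrt 3 = 3 :> R by rewrite -expr2 sqr_sqrtr.
have -> : 2 * pi / 3 = - (pi / 3) + pi :> R by field.
rewrite /hcot cosDpi sinDpi cosN sinN opprK cos_pi3 sin_pi3.
have -> : (1 - 2^-1) / (Num.sqrt 3 / 2) = Num.sqrt 3 / (Num.sqrt 3 * Num.sqrt 3) :> R.
  by field.
by rewrite ss.
Qed.

(** Exterior angles are at most [pi / 2], so two consecutive ones turn by at most [pi]. This settles
    the vertex opposite to side [k]; the other two vertices are handled by the corners at the ends
    of the side. *)
Lemma sconvex_of_angles s P : s * s = 1 -> simple_polygon P ->
  (forall k, 0 <= s * turn (P (ord_pred k)) (P k) (P (ordS k))) ->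
  (forall k, pi / 2 <= ang P k < pi) -> sconvex s P.
Proof.
move=> ss [inj _] ht ha; split=> //.
pose e k := P (ordS k) - P k; pose l k := enorm (e k).
have l0 k : 0 < l k.
  rewrite lt_neqAle enorm_ge0 andbT eq_sym; apply/eqP => h.
  have := enorm_sqr (e k); rewrite -/(l k) h mul0r => /esym/dot_eq0[].
  rewrite /e /= => h1 h2; have /inj : P (ordS k) = P k by apply: plane_eqP; lra.
  by move/eqP; apply/negP; move: k {h h1 h2}; apply: I5P.
have ca k : dot (e (ord_pred k)) (e k) = l (ord_pred k) * l k * - cos (ang P k).
  have -> : dot (e (ord_pred k)) (e k) = - dot (P (ordS k) - P k) (P (ord_pred k) - P k).
    by rewrite /e ord_predK /dot /=; ring.
  have := cosine_itv (P (ordS k) - P k) (P (ord_pred k) - P k) => h.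
  rewrite /ang /vangle acosK ?in_itv //= mulrN; congr (- _).
  have -> : enorm (P (ord_pred k) - P k) = l (ord_pred k).
    by rewrite /l /e ord_predK -enormN opprB.
  rewrite -/(e k) -/(l k); field.
  by rewrite !gt_eqF.
have sa k : s * cross (e (ord_pred k)) (e k) = l (ord_pred k) * l k * sin (ang P k).
  have p0 := @pi_gt0 R.
  have h0 : 0 <= s * cross (e (ord_pred k)) (e k).
    by have := ht k; rewrite /e ord_predK /turn /cross /=; lra.
  have h1 : 0 <= l (ord_pred k) * l k * sin (ang P k).
    apply: mulr_ge0; first by rewrite mulr_ge0 // ltW.
    by have /andP[? ?] := ha k; apply: sin_ge0_pi; apply/andP; split; lra.
  apply: sqr_inj_ge0 => //.
  have := dot_cross_sqr (e (ord_pred k)) (e k); rewrite ca -!/(l _).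
  rewrite !exprMn sqrrN sin2cos2 [s ^+ 2]expr2 ss mul1r; lra.
have sin_pos k : 0 < sin (ang P k).
  by have p0 := @pi_gt0 R; have /andP[? ?] := ha k; apply: sin_gt0_pi; apply/andP; split; lra.
have c1 k : 0 < s * cross (e (ord_pred k)) (e k).
  by rewrite sa !mulr_gt0.
have c1' k : 0 < s * cross (e k) (e (ordS k)) by have := c1 (ordS k); rewrite ordSK.
have c2 k : 0 <= s * cross (e k) (e (ordS2 k)).
  have E : s * cross (e k) (e (ordS2 k)) * (l (ordS k) * l (ordS k)) =
      l k * l (ordS k) * (l (ordS k) * l (ordS2 k)) *
      (- cos (ang P (ordS k)) * sin (ang P (ordS2 k)) +
       sin (ang P (ordS k)) * - cos (ang P (ordS2 k))).
    rewrite /l enorm_sqr -!/(l _).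
    have -> : s * cross (e k) (e (ordS2 k)) * dot (e (ordS k)) (e (ordS k)) =
        dot (e k) (e (ordS k)) * (s * cross (e (ordS k)) (e (ordS2 k))) +
        (s * cross (e k) (e (ordS k))) * dot (e (ordS k)) (e (ordS2 k)).
      by rewrite /cross /dot; ring.
    have := ca (ordS k); have := sa (ordS k); have := ca (ordS2 k); have := sa (ordS2 k).
    rewrite !ordSK => -> -> -> ->; ring.
  rewrite -(pmulr_lge0 _ (mulr_gt0 (l0 (ordS k)) (l0 (ordS k)))) E.
  apply: mulr_ge0; first by rewrite !mulr_ge0 // ltW.
  set x := ang P _; set y := ang P _.
  have -> : - cos x * sin y + sin x * - cos y = sin (x + y - pi).
    have := sinDpi (x + y - pi); rewrite subrK sinD => h.
    by rewrite -[RHS]opprK -h; ring.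
  have p0 := @pi_gt0 R; have /andP[? ?] := ha (ordS k); have /andP[? ?] := ha (ordS2 k).
  by apply: sin_ge0_pi; rewrite /x /y; apply/andP; split; lra.
move=> k j jk jk'; have [e0|e1|e2|e3] := others jk.
- by rewrite e0 eqxx in jk'.
- rewrite e1 (_ : turn _ _ _ = cross (e k) (e (ordS k))) //.
  by rewrite /turn /cross /e /=; ring.
- rewrite e2 (_ : turn _ _ _ = cross (e k) (e (ordS k)) + cross (e k) (e (ordS2 k))).
    by rewrite mulrDr; have := c1' k; have := c2 k; lra.
  by rewrite /turn /cross /e /=; ring.
- rewrite e3 -ord_pred_ordS4 (_ : turn _ _ _ = cross (e (ord_pred k)) (e k)) //.
  by rewrite /turn /cross /e ord_predK /=; ring.
Qed.

(** The triangles from [c] over the sides all have height [r], and each side is the sum of the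
    tangent lengths [r * hcot] at its two ends. This is the equality case of Lhuilier's
    inequality. *)
Lemma tangent_area s P c r : sconvex s P ->
  (forall k, s * cross (unit_edge P k) (c - P k) = r) ->
  s * signed_area P = r * perimeter P / 2 /\
  perimeter P = 2 * r * \sum_k hcot (ang P k).
Proof.
move=> cv d; have [ss _] := cv.
have step k := unit_edge_step k cv.
split.
  rewrite /signed_area /perimeter !sum5 mulrA -sum5; congr (_ / 2).
  rewrite sum5 mulrDr !mulrDr.
  have tri k : s * cross (P k - c) (P (ordS k) - c) = r * edge_length P k.
    by rewrite -(d k) {1}step /cross /=; ring.
  rewrite -!tri; case: ordS5 => -> -> -> -> ->.
  by rewrite /cross /=; ring.
have side k : edge_length P k = r * hcot (ang P k) + r * hcot (ang P (ordS k)).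
  have [p1 q1 w1 t1] := hcot_unit_edge k cv.
  have [p2 q2 w2 t2] := hcot_unit_edge (ordS k) cv.
  rewrite -t1 -t2 ordSK.
  have diff : (P (ordS k)).1 - (P k).1 = edge_length P k * (unit_edge P k).1 /\
    (P (ordS k)).2 - (P k).2 = edge_length P k * (unit_edge P k).2.
    by rewrite (step k) /=; split; ring.
  have [d1 d2] := diff.
  have dp : s * cross (unit_edge P (ord_pred k)) (c - P k) = r.
    rewrite -(d (ord_pred k)); have := step (ord_pred k); rewrite ord_predK => ->.
    by rewrite /cross /=; ring.
  have := side_length ss (dot_unit_edge k cv) (lt0r_neq0 p1) _ d1 d2 dp (d k) (d (ordS k)).
  by rewrite ordSK in p2 *; move=> -> //; [ring|exact: lt0r_neq0].
rewrite /perimeter !sum5 !side; case: ordS5 => -> -> -> -> ->; ring.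
Qed.

Let sum_two_values (x y : R) (k l : 'I_5) : k <> l ->
  \sum_j (if (j == k) || (j == l) then x else y) = 2 * x + 3 * y.
Proof. by rewrite sum5; move: k l; apply: I5P; apply: I5P => // _ /=; ring. Qed.

Lemma right_angles_sconvex C k l : simple_polygon C -> right_angles_at C k l ->
  sconvex (orientation C) C /\
  forall j, ang C j = if (j == k) || (j == l) then pi / 2 else 2 * pi / 3.
Proof.
move=> sC hC; have p0 := @pi_gt0 R.
have ha j : pi / 2 <= interior_angle C j < pi.
  by rewrite hC; case: ifP => _; apply/andP; split; lra.
have [ht ea] : (forall j, 0 <= orientation C * turn (C (ord_pred j)) (C j) (C (ordS j))) /\
    (forall j, interior_angle C j = ang C j).
  have h j : 0 <= orientation C * turn (C (ord_pred j)) (C j) (C (ordS j)) /\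
      interior_angle C j = ang C j.
    have := ha j; rewrite interior_angleE; case: ifPn => // _ /andP[_ h].
    by have /andP[_ ?] := ang_pi C j; exfalso; lra.
  by split=> j; have [] := h j.
split; last by move=> j; rewrite -ea hC.
apply: sconvex_of_angles => //; first exact: orientation_sqr.
by move=> j; rewrite -ea.
Qed.

Lemma circumscribed_perimeter C k l : simple_polygon C -> circumscribed C ->
  k <> l -> right_angles_at C k l -> area C = 1%:E ->
  perimeter C = 2 * Num.sqrt (2 + Num.sqrt 3).
Proof.
move=> sC [c [r [r0 hx]]] kl hC aC.
have [cv ea] := right_angles_sconvex sC hC.
set s := orientation C in cv; have ss := orientation_sqr C.
have cos_le j : - cos (ang C j) = 0 \/ - cos (ang C j) = 2^-1.
  rewrite ea; case: ifP => _; first by left; rewrite cos_pihalf oppr0.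
  right; rewrite (_ : 2 * pi / 3 = - (pi / 3) + pi); last by field.
  by rewrite cosDpi opprK cosN cos_pi3.
(* Tangency fixes the distance from the centre to each side line only up to sign; that the centre is
   on the inner side of every line has to be derived. *)
pose d j := s * cross (unit_edge C j) (c - C j).
have d2 j : d j ^+ 2 = r ^+ 2 /\ 0 <= dot (unit_edge C j) (c - C j).
  have [x [/segmentP[t [t0 t1 x1 x2]] xr xo]] := hx j.
  have l0 := edge_length_gt0 j cv; have ln : edge_length C j != 0 by rewrite gt_eqF.
  have uu := dot_unit_edge j cv; have st := unit_edge_step j cv.
  rewrite st /= in x1 x2.
  have xo' : dot (unit_edge C j) (x - c) = 0.
    apply: (mulfI ln); rewrite mulr0 -[RHS]xo st /dot /=; ring.
  have xd : dot (x - c) (x - c) = r ^+ 2 by rewrite -enorm_sqr -xr expr2.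
  split.
    have := dot_cross_sqr (unit_edge C j) (x - c).
    rewrite xo' exprMn !expr2 !enorm_sqr uu -/(r * r) xd.
    have -> : d j = - (s * cross (unit_edge C j) (x - c)).
      by rewrite /d /cross /= x1 x2; ring.
    by rewrite mulrNN mulrACA ss; lra.
  have -> : dot (unit_edge C j) (c - C j) = t * edge_length C j * dot (unit_edge C j) (unit_edge C j)
      - dot (unit_edge C j) (x - c).
    by rewrite /dot /= x1 x2; ring.
  by rewrite xo' uu mulr1 subr0 mulr_ge0 // ltW.
have dpm j : d j = r \/ d j = - r.
  by have [/eqP + _] := d2 j; rewrite eqf_sqr => /orP[/eqP->|/eqP->]; [left|right].
(* By the sine addition formula, the signed distance to the previous side is the cosine of the
   exterior angle, 0 or 1/2, times a number at least [- r], plus a nonnegative term because the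
   tangency point lies on side [j]. Hence it exceeds [- r]. *)
have dprev j : d (ord_pred j) = r.
  have [p1 q1 _ _] := hcot_unit_edge j cv.
  have dp : s * cross (unit_edge C (ord_pred j)) (c - C j) = d (ord_pred j).
    rewrite /d; have := unit_edge_step (ord_pred j) cv; rewrite ord_predK => ->.
    by rewrite /cross /=; ring.
  have := cross_unit s (unit_edge C (ord_pred j)) (c - C j) (dot_unit_edge j cv).
  rewrite dp q1 -/(d j).
  have : 0 <= s * cross (unit_edge C (ord_pred j)) (unit_edge C j) * dot (unit_edge C j) (c - C j).
    by rewrite mulr_ge0 // ?(ltW p1) //; have [] := d2 j.
  case: (dpm (ord_pred j)) => // -> h.
  by case: (cos_le j) => ->; case: (dpm j) => ->; lra.
have dr j : s * cross (unit_edge C j) (c - C j) = r.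
  by rewrite -/(d j) -[j]ordSK.
have [A1 A2] := tangent_area cv dr.
have := area_convex cv; rewrite aC => -[A0]; rewrite A1 in A0.
have S : \sum_j hcot (ang C j) = 2 + Num.sqrt 3.
  have -> : \sum_j hcot (ang C j) = \sum_j (if (j == k) || (j == l) then 1 else Num.sqrt 3 / 3).
    by apply: eq_bigr => j _; rewrite ea; case: ifP => _; rewrite ?hcot_pihalf ?hcot_2pi3.
  by rewrite sum_two_values //; field.
rewrite S in A2.
have S0 : 0 <= 2 + Num.sqrt 3 :> R by rewrite addr_ge0 ?sqrtr_ge0.
apply: sqr_inj_ge0; [exact: perimeter_ge0|by rewrite mulr_ge0 ?sqrtr_ge0|].
rewrite exprMn sqr_sqrtr // expr2 {1}A2.
have -> : 2 * r * (2 + Num.sqrt 3) * perimeter C = 4 * (2 + Num.sqrt 3) * (r * perimeter C / 2) by field.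
by rewrite -A0; ring.
Qed.

Lemma cairo_prismatic_perimeter C : cairo C \/ prismatic C -> area C = 1%:E ->
  perimeter C = 2 * Num.sqrt (2 + Num.sqrt 3).
Proof.
by move=> [] [sC cC [k [l [kl _ hC]]]]; exact: (circumscribed_perimeter sC cC kl hC).
Qed.

End Circumscribed.

(** * Sides of the tiling *)

Section Parity.
Context {R : realType} {n : nat}.
Implicit Types (z w q u : plane R) (P : polygon R n) (k j : 'I_n).

Lemma near_affine_gt0 a b c z : affine a b c z != 0 ->
  \forall w \near z, (0 < affine a b c w) = (0 < affine a b c z).
Proof.
have pos a' b' c' : 0 < affine a' b' c' z -> \forall w \near z, 0 < affine a' b' c' w.
  by move=> h; apply: open_nbhs_nbhs; split => //; exact: open_affine_gt0.
move=> nz; have [h|h] := ltP 0 (affine a b c z).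
  by near=> w; near: w; exact: pos.
have h' : 0 < affine (- a) (- b) (- c) z.
  have -> : affine (- a) (- b) (- c) z = - affine a b c z by rewrite /affine; ring.
  by rewrite oppr_gt0 lt_neqAle nz.
near=> w; apply/negbTE; rewrite -leNgt.
have : 0 < affine (- a) (- b) (- c) w by near: w; exact: pos.
have -> : affine (- a) (- b) (- c) w = - affine a b c w by rewrite /affine; ring.
by rewrite oppr_gt0 => /ltW.
Unshelve. all: by end_near. Qed.

Lemma near_turn_gt0 (s : R) u q z : s * turn u q z != 0 ->
  \forall w \near z, (0 < s * turn u q w) = (0 < s * turn u q z).
Proof.
rewrite scaled_turnE => h; have := near_affine_gt0 h; apply: filterS => w.
by rewrite -!scaled_turnE.
Qed.

Lemma cross_affine u q z : cross u (z - q) = affine (- u.2) u.1 (u.2 * q.1 - u.1 * q.2) z.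
Proof. by rewrite /cross /affine /=; ring. Qed.

Lemma near_cross_gt0 u q z : cross u (z - q) != 0 ->
  \forall w \near z, (0 < cross u (w - q)) = (0 < cross u (z - q)).
Proof.
rewrite cross_affine => h; have := near_affine_gt0 h; apply: filterS => w.
by rewrite -!cross_affine.
Qed.

Context (P : polygon R n) (d : plane R).
Hypothesis generic : forall k, cross d (P (ordS k) - P k) != 0.

Let len k : R := cross d (P (ordS k) - P k).

(** A point on the line counts as not left. This half-open convention makes a line through a vertex
    count consistently for both sides at that vertex. *)
Let left k z : bool := 0 < cross d (z - P k).

(* The line through z in direction d meets side k ahead of z. *)
Let ahead k z : bool := 0 < len k * turn (P k) (P (ordS k)) z.

Let crossing k z : bool := left k z (+) left (ordS k) z.

(** The even-odd rule for the ray from [z] in the direction [d]. *)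
Definition parity z : bool := \big[addb/false]_k (crossing k z && ahead k z).

Let cross_ratio k z : crossing k z ->
  0 <= cross d (z - P k) / len k /\ cross d (z - P k) / len k <= 1.
Proof.
rewrite /crossing /left => c; pose t := cross d (z - P k) / len k.
have h1 : cross d (z - P k) = t * len k by rewrite /t divfK ?generic.
have h2 : cross d (z - P (ordS k)) = - ((1 - t) * len k).
  have -> : cross d (z - P (ordS k)) = cross d (z - P k) - len k by rewrite /len /cross /=; ring.
  by rewrite h1; ring.
rewrite -/t; split.
- rewrite leNgt; apply/negP => t1; move: c; rewrite h1 h2.
  have t2 : 0 < 1 - t by lra.
  rewrite oppr_gt0 (nmulr_rgt0 _ t1) (pmulr_rlt0 _ t2).
  by case: ltP.
- rewrite leNgt; apply/negP => t1; move: c; rewrite h1 h2.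
  have t2 : 1 - t < 0 by lra.
  have t3 : 0 < t by lra.
  rewrite oppr_gt0 (pmulr_rgt0 _ t3) (nmulr_rlt0 _ t2).
  by case: ltP.
Qed.

Let on_side k z : turn (P k) (P (ordS k)) z = 0 -> crossing k z -> edge P k z.
Proof.
move=> t0 /cross_ratio c; pose t := cross d (z - P k) / len k.
have z1 : z.1 - (P k).1 = t * ((P (ordS k)).1 - (P k).1).
  apply: (mulfI (generic k)); rewrite -/(len k) mulrA [len k * t]mulrC divfK ?generic //.
  have : len k * (z.1 - (P k).1) - cross d (z - P k) * ((P (ordS k)).1 - (P k).1) =
    - turn (P k) (P (ordS k)) z * d.1 by rewrite /len /turn /cross /=; ring.
  by rewrite t0 oppr0 mul0r => /eqP; rewrite subr_eq0 => /eqP.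
have z2 : z.2 - (P k).2 = t * ((P (ordS k)).2 - (P k).2).
  apply: (mulfI (generic k)); rewrite -/(len k) mulrA [len k * t]mulrC divfK ?generic //.
  have : len k * (z.2 - (P k).2) - cross d (z - P k) * ((P (ordS k)).2 - (P k).2) =
    - turn (P k) (P (ordS k)) z * d.2 by rewrite /len /turn /cross /=; ring.
  by rewrite t0 oppr0 mul0r => /eqP; rewrite subr_eq0 => /eqP.
by case: c => c0 c1; apply/segmentP; exists t; split=> //; lra.
Qed.

Let vertex_line k z : cross d (z - P k) = 0 -> z <> P k -> exists2 t : R, t != 0 &
  z.1 = (P k).1 + t * d.1 /\ z.2 = (P k).2 + t * d.2.
Proof.
move=> h zk; have dn : dot d d != 0.
  apply/eqP => /dot_eq0[d1 d2]; have := generic k.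
  by rewrite /cross d1 d2 !mul0r subrr eqxx.
pose t := dot d (z - P k) / dot d d.
have z1 : z.1 = (P k).1 + t * d.1.
  have : dot d d * (z.1 - (P k).1) = dot d (z - P k) * d.1 - d.2 * cross d (z - P k).
    by rewrite /dot /cross /=; ring.
  rewrite h mulr0 subr0 => e; have -> : z.1 = (P k).1 + dot d d * (z.1 - (P k).1) / dot d d by field.
  by rewrite e /t; field.
have z2 : z.2 = (P k).2 + t * d.2.
  have : dot d d * (z.2 - (P k).2) = dot d (z - P k) * d.2 + d.1 * cross d (z - P k).
    by rewrite /dot /cross /=; ring.
  rewrite h mulr0 addr0 => e; have -> : z.2 = (P k).2 + dot d d * (z.2 - (P k).2) / dot d d by field.
  by rewrite e /t; field.
exists t => //; apply/eqP => t0; apply: zk; apply: plane_eqP.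
  by rewrite z1 t0 mul0r addr0.
by rewrite z2 t0 mul0r addr0.
Qed.

Let vertex_on_boundary k : boundary P (P k).
Proof.
by exists k => //; apply/segmentP; exists 0; split; rewrite ?subr0 ?mul1r ?mul0r ?addr0.
Qed.

Let ahead_vertex j z : cross d (z - P (ordS j)) = 0 -> ~ boundary P z ->
  [/\ turn (P j) (P (ordS j)) z != 0, turn (P (ordS j)) (P (ordS2 j)) z != 0 &
      ahead j z = ahead (ordS j) z].
Proof.
move=> h nb; have zk : z <> P (ordS j) by move=> e; apply: nb; rewrite e; exact: vertex_on_boundary.
have [t tn [z1 z2]] := vertex_line h zk.
have e1 : turn (P j) (P (ordS j)) z = - (t * len j).
  by rewrite /len /turn /cross /= z1 z2; ring.
have e2 : turn (P (ordS j)) (P (ordS2 j)) z = - (t * len (ordS j)).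
  by rewrite /len /turn /cross /= z1 z2; ring.
split; rewrite ?e1 ?e2 ?oppr_eq0 ?mulf_neq0 ?generic //.
have sq k : 0 < len k * len k by rewrite lt_neqAle eq_sym mulf_neq0 ?generic //= -expr2 sqr_ge0.
rewrite /ahead e1 e2 !mulrN !oppr_gt0 !(mulrCA _ t).
by rewrite !(pmulr_llt0 _ (sq _)).
Qed.

Let near_left k z : cross d (z - P k) != 0 -> \forall w \near z, left k w = left k z.
Proof. exact: near_cross_gt0. Qed.

Let near_ahead k z : turn (P k) (P (ordS k)) z != 0 -> \forall w \near z, ahead k w = ahead k z.
Proof. by move=> h; apply: near_turn_gt0; rewrite mulf_neq0 ?generic. Qed.

(** The terms that may jump near [z] come from vertices on its line in the direction [d]. Such a
    vertex flips the crossings of both its sides, which are both ahead or both behind; so the change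
    is a difference of consecutive terms and cancels around the polygon. *)
Lemma parity_locally_constant z : ~ boundary P z -> \forall w \near z, parity w = parity z.
Proof.
move=> nb.
have A k : \forall w \near z, cross d (z - P k) != 0 -> left k w = left k z.
  have [h|h] := eqVneq (cross d (z - P k)) 0; first by near=> w.
  by have := near_left h; apply: filterS.
have B k : \forall w \near z, turn (P k) (P (ordS k)) z != 0 -> ahead k w = ahead k z.
  have [h|h] := eqVneq (turn (P k) (P (ordS k)) z) 0; first by near=> w.
  by have := near_ahead h; apply: filterS.
have A' := filter_forall _ A; have B' := filter_forall _ B.
near=> w.
have Aw : forall k, cross d (z - P k) != 0 -> left k w = left k z by near: w; exact: A'.
have Bw : forall k, turn (P k) (P (ordS k)) z != 0 -> ahead k w = ahead k z by near: w; exact: B'.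
pose eps k := left k w (+) left k z.
have D k : (crossing k w && ahead k w) (+) (crossing k z && ahead k z) =
    (eps k && ahead k z) (+) (eps (ordS k) && ahead (ordS k) z).
  (* If [z] is on the line of side [k] but off the boundary, neither [z] nor a nearby point crosses
     that side, so the unstable value of [ahead] is masked. *)
  have [t0|tn] := eqVneq (turn (P k) (P (ordS k)) z) 0; last first.
    rewrite (Bw _ tn) /crossing /eps.
    have -> : ((left (ordS k) w (+) left (ordS k) z) && ahead (ordS k) z) =
       ((left (ordS k) w (+) left (ordS k) z) && ahead k z).
      have [h|h] := eqVneq (cross d (z - P (ordS k))) 0.
        by have [_ _ ->] := ahead_vertex h nb.
      by rewrite (Aw _ h) addbb.
    by case: (left k w); case: (left k z); case: (left _ w); case: (left _ z); case: (ahead k z).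
  have h1 : cross d (z - P k) != 0.
    apply/eqP; rewrite -{1}(ord_predK k) => h; have [_ + _] := ahead_vertex h nb.
    by rewrite ord_predK t0 eqxx.
  have h2 : cross d (z - P (ordS k)) != 0.
    by apply/eqP => h; have [+ _ _] := ahead_vertex h nb; rewrite t0 eqxx.
  have c0 : crossing k z = false.
    by apply/negP => /(on_side t0) e; apply: nb; exists k.
  have c1 : crossing k w = false by rewrite /crossing (Aw _ h1) (Aw _ h2).
  by rewrite c0 c1 /eps (Aw _ h1) (Aw _ h2) !addbb.
have : parity w (+) parity z = false.
  rewrite /parity -big_split /= (eq_bigr _ (fun k _ => D k)) big_split /=.
  rewrite [X in _ (+) X](_ : _ = \big[addb/false]_k (eps k && ahead k z)) ?addbb //.
  by rewrite [RHS](reindex_inj (@ordS_inj _)).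
by case: (parity w); case: (parity z).
Unshelve. all: by end_near. Qed.

(** A closed polygon crosses a line an even number of times. An odd count ahead therefore forces an
    odd count behind, and [z] lies between two boundary points, which bounds it. *)
Let parity_ahead z : parity z -> exists k l, [/\ crossing k z, ahead k z, crossing l z & ~~ ahead l z].
Proof.
move=> pz.
have [k /andP[ck ak]] : exists k, crossing k z && ahead k z.
  apply: contrapT => H; move: pz; rewrite /parity big1 // => k _.
  by apply/negP => h; apply: H; exists k.
have [l /andP[cl al]] : exists l, crossing l z && ~~ ahead l z.
  apply: contrapT => H; move: pz; rewrite /parity.
  have E k' : crossing k' z && ahead k' z = left k' z (+) left (ordS k') z.
    rewrite -/(crossing k' z); case c: (crossing k' z) => //=; apply: contrapT => a.
    by apply: H; exists k'; rewrite c; apply/negP.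
  rewrite (eq_bigr _ (fun k' _ => E k')) big_split /=.
  by rewrite -(reindex_inj (P := xpredT) (F := fun k' => left k' z) (@ordS_inj _)) addbb.
by exists k, l.
Qed.

Let crossing_point k z : crossing k z -> exists t y : R, [/\ 0 <= y, y <= 1,
  z.1 + t * d.1 = (1 - y) * (P k).1 + y * (P (ordS k)).1 /\
  z.2 + t * d.2 = (1 - y) * (P k).2 + y * (P (ordS k)).2 &
  (0 < t) = ahead k z].
Proof.
move=> /cross_ratio[y0 y1]; set y := _ / _ in y0 y1.
have ln : len k != 0 := generic k.
exists (turn (P k) (P (ordS k)) z / len k), y; split=> //.
  split; apply: (mulfI ln).
    have -> : len k * ((1 - y) * (P k).1 + y * (P (ordS k)).1) =
      len k * (P k).1 + (len k * y) * ((P (ordS k)).1 - (P k).1) by ring.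
    rewrite /y [len k * (_ / _)]mulrC divfK // mulrDr mulrA [len k * (_ / _)]mulrC divfK //.
    by rewrite /len /turn /cross /=; ring.
  have -> : len k * ((1 - y) * (P k).2 + y * (P (ordS k)).2) =
    len k * (P k).2 + (len k * y) * ((P (ordS k)).2 - (P k).2) by ring.
  rewrite /y [len k * (_ / _)]mulrC divfK // mulrDr mulrA [len k * (_ / _)]mulrC divfK //.
  by rewrite /len /turn /cross /=; ring.
have sq : 0 < len k * len k by rewrite lt_neqAle eq_sym mulf_neq0 //= -expr2 sqr_ge0.
rewrite /ahead -(pmulr_rgt0 _ sq); congr (0 < _).
by rewrite -mulrA [len k * (_ / _)]mulrC divfK.
Qed.

Let between (x t1 t2 e M : R) : `|x + t1 * e| <= M -> `|x + t2 * e| <= M ->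
  0 < t1 -> t2 <= 0 -> `|x| <= M.
Proof.
rewrite !ler_norml => /andP[a1 b1] /andP[a2 b2] t10 t20.
have [e0|e0] := leP 0 e.
  have h1 : 0 <= t1 * e by apply: mulr_ge0 => //; exact: ltW.
  have h2 : t2 * e <= 0 by rewrite mulr_le0_ge0.
  by apply/andP; split; lra.
have h1 : t1 * e <= 0 by rewrite mulr_ge0_le0 // ltW.
have h2 : 0 <= t2 * e by rewrite mulr_le0 // ltW.
by apply/andP; split; lra.
Qed.

Lemma parity_bounded : exists M, forall z, parity z -> `|z.1| <= M /\ `|z.2| <= M.
Proof.
pose M := \sum_k (`|(P k).1| + `|(P k).2|).
have b k : `|(P k).1| <= M /\ `|(P k).2| <= M.
  rewrite /M (bigD1 k) //=.
  have : 0 <= \sum_(i < n | i != k) (`|(P i).1| + `|(P i).2|).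
    by apply: sumr_ge0 => i _; rewrite addr_ge0.
  by have := normr_ge0 (P k).1; have := normr_ge0 (P k).2; split; lra.
have conv (y a a' : R) : 0 <= y -> y <= 1 -> `|a| <= M -> `|a'| <= M ->
    `|(1 - y) * a + y * a'| <= M.
  move=> y0 y1 h h'; apply: (le_trans (ler_normD _ _)).
  have -> : M = (1 - y) * M + y * M by ring.
  by apply: lerD; rewrite normrM ger0_norm ?ler_wpM2l //; lra.
exists M => z /parity_ahead[k [l [ck ak cl al]]].
have [t1 [y1 [y10 y11 [k1 k2] kt]]] := crossing_point ck.
have [t2 [y2 [y20 y21 [l1 l2] lt]]] := crossing_point cl.
have t10 : 0 < t1 by rewrite kt.
have t20 : t2 <= 0 by rewrite leNgt lt.
have [bk bk'] := b k; have [bs bs'] := b (ordS k).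
have [bl bl'] := b l; have [bt bt'] := b (ordS l).
split.
  apply: (@between _ t1 t2 d.1) => //; first by rewrite k1; exact: conv.
  by rewrite l1; exact: conv.
apply: (@between _ t1 t2 d.2) => //; first by rewrite k2; exact: conv.
by rewrite l2; exact: conv.
Qed.

(** Odd parity is open and closed off the boundary, so it holds throughout the component of [z]; and
    the set of points of odd parity is bounded. *)
Lemma parity_inside z : ~ boundary P z -> parity z -> inside P z.
Proof.
move=> nb pz; split=> //.
set C := connected_component _ _.
have CB : C `<=` ~` boundary P by exact: connected_component_sub.
have CN : C `&` [set w | parity w] = C.
  apply: component_connected.
  - by exists z; split=> //; exact: connected_component_refl.
  - exists (interior [set w | parity w]); first exact: open_interior.
    apply/seteqP; split=> w [Cw hw]; split=> //; last exact: interior_subset.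
    by have := parity_locally_constant (CB _ Cw); apply: filterS => v /= ->.
  - exists (~` interior [set w | ~~ parity w]).
      by apply: open_closedC; exact: open_interior.
    apply/seteqP; split=> w [Cw hw]; split=> //.
      by move=> /interior_subset /=; rewrite hw.
    apply: contrapT => hw'; apply: hw.
    have := parity_locally_constant (CB _ Cw); apply: filterS => v /= ->.
    exact/negP.
have [M HM] := parity_bounded.
by apply/bounded_setP; exists M => w; rewrite -CN => -[_ /HM].
Qed.

Hypothesis simple : simple_polygon P.

(** Near an interior point of side [j], every term but that of side [j] is constant, and [b] is
    their sum. The remaining term [ahead j] changes exactly when the side is traversed. *)
Lemma parity_near_side j q (t : R) : 0 < t < 1 ->
  q.1 = (1 - t) * (P j).1 + t * (P (ordS j)).1 ->
  q.2 = (1 - t) * (P j).2 + t * (P (ordS j)).2 ->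
  (forall k, cross d (q - P k) != 0) ->
  exists b : bool, \forall z \near q, turn (P j) (P (ordS j)) z != 0 ->
    ~ boundary P z /\ parity z = ahead j z (+) b.
Proof.
move=> /andP[t0 t1] q1 q2 gq.
have qj : edge P j q by apply/segmentP; exists t; split=> //; exact: ltW.
have qv k : q <> P k.
  move=> e; have := gq k; rewrite e /cross /= !subrr !mulr0 subrr eqxx.
  by [].
have off k : k != j -> crossing k q -> turn (P k) (P (ordS k)) q != 0.
  move=> kj ck; apply/eqP => /on_side /(_ ck) ek.
  have [_ h] := simple.
  by have [[_ e]|[_ e]] := h k j q kj ek qj; exact: (qv _ e).
have cj : crossing j q.
  rewrite /crossing /left.
  have -> : cross d (q - P j) = t * len j by rewrite /len /cross /= q1 q2; ring.
  have -> : cross d (q - P (ordS j)) = - ((1 - t) * len j).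
    by rewrite /len /cross /= q1 q2; ring.
  rewrite oppr_gt0 (pmulr_rgt0 _ t0) (pmulr_rlt0 _ (_ : 0 < 1 - t)); last lra.
  by have := generic j; rewrite -/(len j) neq_lt => /orP[] h; rewrite h ltNge (ltW h).
have A k : \forall w \near q, left k w = left k q by exact: near_left.
have B k : \forall w \near q, k != j -> crossing k q ->
   ahead k w = ahead k q /\ turn (P k) (P (ordS k)) w != 0.
  have [h|h] := boolP ((k != j) && crossing k q); last first.
    by near=> w => h1 h2; rewrite h1 h2 in h.
  move/andP: h => [h1 h2]; have tn := off k h1 h2.
  have h3 := near_ahead tn.
  have h4 : \forall w \near q, 0 < turn (P k) (P (ordS k)) q * turn (P k) (P (ordS k)) w.
    have := near_turn_gt0 (mulf_neq0 tn tn); apply: filterS => w ->.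
    by rewrite lt_neqAle eq_sym mulf_neq0 //= -expr2 sqr_ge0.
  near=> w => _ _; split; first by near: w.
  have : 0 < turn (P k) (P (ordS k)) q * turn (P k) (P (ordS k)) w by near: w.
  by apply: contraTneq => ->; rewrite mulr0 ltxx.
have N k : \forall w \near q, cross d (w - P k) != 0.
  have c2 : 0 < cross d (q - P k) * cross d (q - P k).
    by rewrite lt_neqAle eq_sym mulf_neq0 //= -expr2 sqr_ge0.
  have [h|h] := ltP 0 (cross d (q - P k)).
    have := near_cross_gt0 (gq k); apply: filterS => w; rewrite h => h'.
    by apply/eqP => e; rewrite e ltxx in h'.
  have ng : cross (- d) (q - P k) != 0.
    by rewrite (_ : cross _ _ = - cross d (q - P k)) ?oppr_eq0 // /cross /=; ring.
  have := near_cross_gt0 ng; apply: filterS => w.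
  have -> : cross (- d) (q - P k) = - cross d (q - P k) by rewrite /cross /=; ring.
  have -> : cross (- d) (w - P k) = - cross d (w - P k) by rewrite /cross /=; ring.
  rewrite !oppr_gt0 (lt_neqAle (cross d (q - P k))) gq h => h'.
  by apply/eqP => e; rewrite e ltxx in h'.
have A' := filter_forall _ A; have B' := filter_forall _ B; have N' := filter_forall _ N.
exists (\big[addb/false]_(k | k != j) (crossing k q && ahead k q)).
near=> z => tz.
have Az : forall k, left k z = left k q by near: z; exact: A'.
have Bz : forall k, k != j -> crossing k q -> ahead k z = ahead k q /\
  turn (P k) (P (ordS k)) z != 0 by near: z; exact: B'.
have Nz : forall k, cross d (z - P k) != 0 by near: z; exact: N'.
have Cz k : crossing k z = crossing k q by rewrite /crossing !Az.
split; last first.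
  rewrite /parity (bigD1 j) //= Cz cj; congr (_ (+) _).
  apply: eq_bigr => k kj; rewrite Cz; case c: (crossing k q) => //=.
  by have [] := Bz k kj c.
move=> [k _ ek].
have t0' : turn (P k) (P (ordS k)) z = 0.
  by case/segmentP: ek => y [_ _ e1 e2]; rewrite /turn /cross /= e1 e2; ring.
have [kj|kj] := eqVneq k j; first by move: tz; rewrite -kj t0' eqxx.
case c: (crossing k q); first by have [_] := Bz k kj c; rewrite t0' eqxx.
case/segmentP: ek => y [y0 y1 e1 e2].
have h1 : cross d (z - P k) = y * len k by rewrite /len /cross /= e1 e2; ring.
have h2 : cross d (z - P (ordS k)) = - ((1 - y) * len k).
  by rewrite /len /cross /= e1 e2; ring.
have y0' : 0 < y.
  by rewrite lt_neqAle y0 andbT eq_sym; apply: contra_neq (Nz k) => e; rewrite h1 e mul0r.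
have y1' : 0 < 1 - y.
  have : 1 - y != 0 by apply: contra_neq (Nz (ordS k)) => e; rewrite h2 e mul0r oppr0.
  by move=> ne; rewrite lt_neqAle eq_sym ne /=; lra.
move: c; rewrite -Cz /crossing /left h1 h2 oppr_gt0 (pmulr_rgt0 _ y0') (pmulr_rlt0 _ y1').
by have := generic k; rewrite -/(len k) neq_lt => /orP[] h; rewrite h ltNge (ltW h).
Unshelve. all: by end_near. Qed.

End Parity.

(** * The inner side of an edge *)

Section EdgeSide.
Context {R : realType} {n : nat}.
Implicit Types (z w q u d : plane R) (P : polygon R n) (k j : 'I_n).

(** A slope larger than all the finitely many given slopes avoids them all. *)
Let generic_direction (I : finType) (v : I -> plane R) : (forall i, v i <> 0) ->
  exists d : plane R, forall i, cross d (v i) != 0.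
Proof.
move=> vn; pose t : R := 1 + \sum_i `|(v i).2 / (v i).1|.
exists (1, t) => i; rewrite /cross /= mul1r; apply/eqP => e.
have [v1|v1] := eqVneq (v i).1 0.
  by apply: (vn i); apply: plane_eqP => //=; move: e; rewrite v1 mulr0 subr0.
have : t = (v i).2 / (v i).1.
  by apply: (mulIf v1); rewrite divfK //; lra.
have : `|(v i).2 / (v i).1| <= \sum_i `|(v i).2 / (v i).1|.
  by rewrite (bigD1 i) //= lerDl sumr_ge0.
by have := ler_norm ((v i).2 / (v i).1); rewrite /t; lra.
Qed.

Lemma edge_side P j q (t : R) : simple_polygon P -> (forall k, ordS k != k) -> 0 < t < 1 ->
  q.1 = (1 - t) * (P j).1 + t * (P (ordS j)).1 ->
  q.2 = (1 - t) * (P j).2 + t * (P (ordS j)).2 ->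
  exists2 s : R, s * s = 1 &
    \forall z \near q, 0 < s * turn (P j) (P (ordS j)) z -> inside P z.
Proof.
move=> sP nS t01 q1 q2.
have qj : edge P j q.
  by case/andP: t01 => t0 t1; apply/segmentP; exists t; split=> //; exact: ltW.
have vertex_edge k : edge P k (P k) /\ edge P (ord_pred k) (P k).
  split; apply/segmentP; first by exists 0; split; rewrite ?subr0 ?mul1r ?mul0r ?addr0.
  by exists 1; split; rewrite ?ord_predK ?subrr ?mul1r ?mul0r ?add0r.
have [inj h] := sP.
have nj : P (ordS j) <> P j by move=> /inj e; have := nS j; rewrite e eqxx.
have qP k : q <> P k.
  move=> qk; case/andP: t01 => t0 t1.
  have [kj|kj] := eqVneq j k.
    apply: nj; rewrite -kj in qk; have e1 := congr1 fst qk; have e2 := congr1 snd qk.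
    move: e1 e2 => /= e1 e2; apply: plane_eqP; apply: (mulfI (lt0r_neq0 t0)).
      by move: e1; rewrite q1; lra.
    by move: e2; rewrite q2; lra.
  have [kj'|kj'] := eqVneq (ordS j) k.
    apply: nj; rewrite -kj' in qk; have e1 := congr1 fst qk; have e2 := congr1 snd qk.
    have t1' : 1 - t != 0 by rewrite subr_eq0 eq_sym (lt_eqF t1).
    move: e1 e2 => /= e1 e2; apply: plane_eqP; apply: (mulfI t1').
      by move: e1; rewrite q1; lra.
    by move: e2; rewrite q2; lra.
  have ek : edge P k q by rewrite qk; have [] := vertex_edge k.
  have [[e _]|[_ e]] := h j k q kj qj ek; first by rewrite e eqxx in kj'.
  by move: kj; rewrite (inj j k) ?eqxx // -e -qk.
(* The direction must avoid the sides, for the even-odd rule, and also the lines from [q] to the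
   vertices, so that the sides crossed do not change near [q]. *)
pose v (i : 'I_n + 'I_n) := match i with inl k => P (ordS k) - P k | inr k => q - P k end.
have [d hd] : exists d : plane R, forall i, cross d (v i) != 0.
  apply: generic_direction => -[k|k] /= e.
    have /inj e' : P (ordS k) = P k.
      have e1 := congr1 fst e; have e2 := congr1 snd e.
      by move: e1 e2 => /= e1 e2; apply: plane_eqP; lra.
    by have := nS k; rewrite e' eqxx.
  apply: (qP k); have e1 := congr1 fst e; have e2 := congr1 snd e.
  by move: e1 e2 => /= e1 e2; apply: plane_eqP; lra.
have g1 k : cross d (P (ordS k) - P k) != 0 := hd (inl k).
have g2 k : cross d (q - P k) != 0 := hd (inr k).
have [b hb] := parity_near_side g1 sP t01 q1 q2 g2.
pose l := cross d (P (ordS j) - P j).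
exists (if (0 < l) (+) b then 1 else -1); first by case: ifP => _; ring.
apply: filterS hb => z hz st.
have tn : turn (P j) (P (ordS j)) z != 0.
  by apply: contraTneq st => ->; rewrite mulr0 ltxx.
have [nb pz] := hz tn; apply: (parity_inside g1 nb); rewrite pz -/l.
move: st; have := g1 j; rewrite -/l neq_lt => /orP[l0|l0].
  rewrite (nmulr_rgt0 _ l0) [0 < l]ltNge (ltW l0) /=.
  by case: b {hz pz}; rewrite ?mul1r ?mulN1r ?oppr_gt0 => h0; rewrite ?h0 // ltNge ltW.
rewrite (pmulr_rgt0 _ l0) l0 /=.
by case: b {hz pz}; rewrite ?mul1r ?mulN1r ?oppr_gt0 => h0; rewrite ?h0 // ltNge ltW.
Qed.

End EdgeSide.

(** * Translates of polygons, and segments with their ends *)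

Section Translate.
Context {R : realType} {n : nat}.
Implicit Types (z w q u t : plane R) (P : polygon R n) (k j : 'I_n).

Lemma segment_translate (p q z t : plane R) : segment (p + t) (q + t) (z + t) <-> segment p q z.
Proof.
split=> /segmentP[y [y0 y1 e1 e2]]; apply/segmentP; exists y; split=> //=;
  rewrite /= in e1 e2; lra.
Qed.

Lemma edge_translate P t k z : edge (translate P t) k (z + t) <-> edge P k z.
Proof. exact: segment_translate. Qed.

Lemma subtK z t : z - t + t = z.
Proof. by apply: plane_eqP => /=; ring. Qed.

Lemma boundary_translate P t z : boundary (translate P t) (z + t) <-> boundary P z.
Proof. by split=> -[k _ /edge_translate h]; exists k. Qed.

Lemma translateK P t : translate (translate P t) (- t) = P.
Proof. by apply/funext => k; rewrite /translate; apply: plane_eqP => /=; ring. Qed.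

Let inside_translate_sub P t z : inside P z -> inside (translate P t) (z + t).
Proof.
move=> [nb hb]; split; first by move=> /boundary_translate.
have [M HM] := (bounded_setP _).1 hb; apply/bounded_setP.
exists (M + `|t.1| + `|t.2|) => w Cw.
have : connected_component (~` boundary P) z (w - t).
  have sub : (fun v : plane R => v - t) @` connected_component (~` boundary (translate P t)) (z + t)
      `<=` connected_component (~` boundary P) z.
    apply: connected_component_max.
    - exists (z + t); last by apply: plane_eqP => /=; ring.
      by apply: connected_component_refl => /boundary_translate.
    - move=> _ [v /connected_component_sub nv <-] /(boundary_translate _ t).
      by rewrite subtK.
    - apply: connected_continuous_connected; first exact: component_connected.
      apply: continuous_subspaceT => v.
      have h1 : (x.1 - t.1) @[x --> v] --> v.1 - t.1 by apply: cvgB; [exact: cvg_fst|exact: cvg_cst].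
      have h2 : (x.2 - t.2) @[x --> v] --> v.2 - t.2 by apply: cvgB; [exact: cvg_snd|exact: cvg_cst].
      exact: (cvg_pair h1 h2).
  by apply: sub; exists w.
move=> /HM[/= h1 h2]; split.
  have := ler_normD (w.1 - t.1) t.1; rewrite subrK; have := normr_ge0 t.2; lra.
have := ler_normD (w.2 - t.2) t.2; rewrite subrK; have := normr_ge0 t.1; lra.
Qed.

Lemma inside_translate P t z : inside (translate P t) (z + t) <-> inside P z.
Proof.
split; last exact: inside_translate_sub.
move=> /(@inside_translate_sub _ (- t)); rewrite translateK.
by rewrite (_ : z + t - t = z) //; apply: plane_eqP => /=; ring.
Qed.

Lemma simple_translate P t : simple_polygon P -> simple_polygon (translate P t).
Proof.
move=> [inj h]; split.
  move=> k j e; apply: inj; have e1 := congr1 fst e; have e2 := congr1 snd e.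
  by move: e1 e2 => /= e1 e2; apply: plane_eqP; lra.
move=> k j z kj; rewrite -(subtK z t) => /edge_translate ek /edge_translate ej.
have [[e1 e2]|[e1 e2]] := h k j _ kj ek ej; [left|right]; split=> //;
  by rewrite /translate e2.
Qed.

Lemma segment_ends (p q : plane R) : segment p q p /\ segment p q q.
Proof.
split; apply/segmentP; first by exists 0; split; rewrite ?subr0 ?mul1r ?mul0r ?addr0.
by exists 1; split; rewrite ?subrr ?mul1r ?mul0r ?add0r.
Qed.

Let unit_interval_ends (a b c e : R) : 0 <= a -> a <= 1 -> 0 <= b -> b <= 1 ->
  0 <= c -> c <= 1 -> 0 <= e -> e <= 1 ->
  a + c * (b - a) = 0 -> a + e * (b - a) = 1 -> (a = 0 /\ b = 1) \/ (a = 1 /\ b = 0).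
Proof.
move=> a0 a1 b0 b1 c0 c1 e0 e1 h1 h2.
have [ab|ab] := leP a b.
  have : 0 <= c * (b - a) by apply: mulr_ge0; lra.
  have : 0 <= (1 - e) * (b - a) by apply: mulr_ge0; lra.
  by left; split; lra.
have : 0 <= (1 - c) * (a - b) by apply: mulr_ge0; lra.
have : 0 <= e * (a - b) by apply: mulr_ge0; lra.
by right; split; lra.
Qed.

(** Each pair of ends is a pair of convex combinations of the other. Composing the two gives an
    affine parameter that takes the values 0 and 1 within the unit interval, so the combinations are
    trivial; a degenerate segment is treated apart. *)
Lemma segment_eq (p q p' q' : plane R) : segment p q = segment p' q' ->
  (p' = p /\ q' = q) \/ (p' = q /\ q' = p).
Proof.
move=> E.
have [hp hq] := segment_ends p q; have [hp' hq'] := segment_ends p' q'.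
rewrite E in hp hq; rewrite -E in hp' hq'.
case/segmentP: hp' => a [a0 a1 pa1 pa2]; case/segmentP: hq' => b [b0 b1 qb1 qb2].
case/segmentP: hp => c [c0 c1 pc1 pc2]; case/segmentP: hq => e [e0 e1 qe1 qe2].
have key : (a + c * (b - a)) * (q.1 - p.1) = 0 /\ (a + c * (b - a)) * (q.2 - p.2) = 0.
  by rewrite pa1 qb1 in pc1; rewrite pa2 qb2 in pc2; split; lra.
have key' : (a + e * (b - a) - 1) * (q.1 - p.1) = 0 /\ (a + e * (b - a) - 1) * (q.2 - p.2) = 0.
  by rewrite pa1 qb1 in qe1; rewrite pa2 qb2 in qe2; split; lra.
have [k1 k2] := key; have [k1' k2'] := key'.
have [d1|d1] := eqVneq (q.1 - p.1) 0; have [d2|d2] := eqVneq (q.2 - p.2) 0.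
- left; split; apply: plane_eqP; rewrite ?pa1 ?pa2 ?qb1 ?qb2.
  + by rewrite (_ : q.1 = p.1); [ring|lra].
  + by rewrite (_ : q.2 = p.2); [ring|lra].
  + by rewrite (_ : q.1 = p.1); [ring|lra].
  + by rewrite (_ : q.2 = p.2); [ring|lra].
all: have h1 : a + c * (b - a) = 0 by first [by apply: (mulIf d2); rewrite mul0r|by apply: (mulIf d1); rewrite mul0r].
all: have h2 : a + e * (b - a) = 1 by apply/eqP; rewrite -subr_eq0; apply/eqP; first [by apply: (mulIf d2); rewrite mul0r|by apply: (mulIf d1); rewrite mul0r].
all: have [[ea eb]|[ea eb]] := unit_interval_ends a0 a1 b0 b1 c0 c1 e0 e1 h1 h2;
  [left|right]; split; apply: plane_eqP; rewrite ?pa1 ?pa2 ?qb1 ?qb2 ?ea ?eb; ring.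
Qed.

Lemma near_ray q w (A : set (plane R)) : (\forall z \near q, A z) ->
  exists2 e : R, 0 < e & forall y, 0 < y -> y < e -> A (q.1 + y * w.1, q.2 + y * w.2).
Proof.
move=> hA; have c := @continuous_line R q w 0.
have : \forall y \near (0 : R), A (q.1 + y * w.1, q.2 + y * w.2).
  apply: c; rewrite (_ : (_, _) = q) //.
  by apply: plane_eqP; rewrite /= mul0r addr0.
move=> /nbhs_ballP[e /= e0 he]; exists e => // y y0 ye; apply: he.
by rewrite /ball /= sub0r normrN gtr0_norm.
Qed.

End Translate.

(** * Sides that represent the same edge of the torus *)

Section Edges.
Context {R : realType} {N : nat} (u v : plane R) (T : 'I_N -> polygon R 5).
Hypothesis hT : torus_tiling u v T.
Implicit Types (i j : 'I_N) (t : plane R) (e f : 'I_N * 'I_5).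

Lemma lattice0 : lattice u v 0.
Proof. by exists 0, 0; apply: plane_eqP => /=; ring. Qed.

Lemma latticeN t : lattice u v t -> lattice u v (- t).
Proof.
move=> [a [b ->]]; exists (- a), (- b); apply: plane_eqP => /=; rewrite !mulrNz; ring.
Qed.

Lemma latticeD t t' : lattice u v t -> lattice u v t' -> lattice u v (t + t').
Proof.
move=> [a [b ->]] [c [d ->]]; exists (a + c), (b + d).
by apply: plane_eqP => /=; rewrite !mulrzDr; ring.
Qed.

(** The tiling axiom compares a tile with the lifts of another one; translating by [- t] brings two
    arbitrary lifts to that form. *)
Lemma lifts_disjoint i j t t' z : lattice u v t -> lattice u v t' ->
  inside (translate (T i) t) z -> inside (translate (T j) t') z -> i = j /\ t = t'.
Proof.
move=> lt lt'; rewrite -(subtK z t) => /inside_translate h1.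
have -> : z - t + t = (z - t - (t' - t)) + t' by apply: plane_eqP => /=; ring.
move=> /inside_translate h2; have [_ _ _ dis] := hT.
apply: contrapT => ne; have lt2 := latticeD lt' (latticeN lt).
have hI : (inside (T i) `&` inside (translate (T j) (t' - t))) (z - t).
  split=> //; rewrite -[z - t](subtK _ (t' - t)).
  by apply/inside_translate.
have {}dis := dis i j _ lt2.
suff h : (i, 0) <> (j, t' - t) by move: hI; rewrite (dis h).
move=> E; have ij := congr1 fst E; have e := congr1 snd E.
have e1 := congr1 fst e; have e2 := congr1 snd e; apply: ne; split=> //.
by move: e1 e2 => /= e1 e2; apply: plane_eqP; lra.
Qed.

Let edge_same e f t : edge (T e.1) e.2 = edge (translate (T f.1) t) f.2 ->
  (T f.1 f.2 + t = T e.1 e.2 /\ T f.1 (ordS f.2) + t = T e.1 (ordS e.2)) \/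
  (T f.1 f.2 + t = T e.1 (ordS e.2) /\ T f.1 (ordS f.2) + t = T e.1 e.2).
Proof. exact: segment_eq. Qed.

Let shift (a b c : plane R) : a + b = c -> c - b = a.
Proof. by move=> <-; apply: plane_eqP => /=; ring. Qed.

Let segmentC (p q : plane R) : segment p q = segment q p.
Proof.
have sub (a b : plane R) : segment a b `<=` segment b a.
  move=> z /segmentP[y [y0 y1 e1 e2]]; apply/segmentP; exists (1 - y).
  by split; lra.
by apply/seteqP; split; exact: sub.
Qed.

Let same_edgeP e f : reflect (exists2 t, lattice u v t &
    (T f.1 f.2 + t = T e.1 e.2 /\ T f.1 (ordS f.2) + t = T e.1 (ordS e.2)) \/
    (T f.1 f.2 + t = T e.1 (ordS e.2) /\ T f.1 (ordS f.2) + t = T e.1 e.2))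
  (same_edge u v T e f).
Proof.
apply: (iffP idP) => [/asboolP[t lt h]|[t lt h]]; first by exists t => //; exact: edge_same.
apply/asboolP; exists t => //; rewrite /edge /translate.
by case: h => -[-> ->] //; rewrite segmentC.
Qed.

Lemma same_edge_equivalence : {in finset.setT & &, equivalence_rel (same_edge u v T)}.
Proof.
have sym e f : same_edge u v T e f -> same_edge u v T f e.
  move=> /same_edgeP[t lt h]; apply/same_edgeP; exists (- t); first exact: latticeN.
  by case: h => -[/shift h1 /shift h2]; [left|right].
have trans e f g : same_edge u v T e f -> same_edge u v T f g -> same_edge u v T e g.
  move=> /same_edgeP[t lt h] /same_edgeP[t' lt' h']; apply/same_edgeP.
  exists (t' + t); first exact: latticeD.
  have A (a : plane R) : a + (t' + t) = a + t' + t by apply: plane_eqP => /=; ring.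
  rewrite !A; case: h' => -[-> ->]; case: h => -[h1 h2]; by [left|right].
move=> e f g _ _ _; split.
  apply/same_edgeP; exists 0; first exact: lattice0.
  by left; split; apply: plane_eqP => /=; ring.
move=> ef; apply/idP/idP => h; last exact: trans ef h.
exact: trans (sym _ _ ef) h.
Qed.

Let nS (k : 'I_5) : ordS k != k.
Proof. by move: k; apply: I5P. Qed.

Let mid (p q : plane R) : plane R := ((p.1 + q.1) / 2, (p.2 + q.2) / 2).

Let midC p q : mid p q = mid q p.
Proof. by apply: plane_eqP; rewrite /mid /= addrC. Qed.

Let side_of e t p q : lattice u v t ->
  (T e.1 e.2 + t = p /\ T e.1 (ordS e.2) + t = q) \/
  (T e.1 e.2 + t = q /\ T e.1 (ordS e.2) + t = p) ->
  exists2 s : R, s * s = 1 &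
    \forall z \near mid p q, 0 < s * turn p q z -> inside (translate (T e.1) t) z.
Proof.
move=> lt h; have [_ sT _ _] := hT.
have sP := simple_translate t (sT e.1).
have half : 0 < (2^-1 : R) < 1 by apply/andP; split; lra.
have gen a b : T e.1 e.2 + t = a -> T e.1 (ordS e.2) + t = b -> exists2 s : R, s * s = 1 &
    \forall z \near mid a b, 0 < s * turn a b z -> inside (translate (T e.1) t) z.
  move=> <- <-; apply: (edge_side sP nS half); rewrite /mid /translate /=; lra.
case: h => -[h1 h2]; first exact: gen.
have [s ss hs] := gen _ _ h1 h2.
exists (- s); first by rewrite mulrNN.
rewrite midC; apply: filterS hs => z h s0; apply: h.
by move: s0; rewrite (turn_swap p q) mulrNN.
Qed.

Let ends e t p q :=
  (T e.1 e.2 + t = p /\ T e.1 (ordS e.2) + t = q) \/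
  (T e.1 e.2 + t = q /\ T e.1 (ordS e.2) + t = p).

Let addIr (a b c : plane R) : a + c = b + c -> a = b.
Proof.
move=> e; have e1 := congr1 fst e; have e2 := congr1 snd e.
by move: e1 e2 => /= e1 e2; apply: plane_eqP; lra.
Qed.

Let ends_inj i k k' t p q : ends (i, k) t p q -> ends (i, k') t p q -> k = k'.
Proof.
have [_ sT _ _] := hT; have [inj _] := sT i.
have two (l : 'I_5) : ordS2 l != l by move: l; apply: I5P.
case=> -[/= h1 h2] [] [/= h3 h4].
- by apply: inj; apply: (@addIr _ _ t); rewrite h1 h3.
- have e1 : k = ordS k' by apply: inj; apply: (@addIr _ _ t); rewrite h1 h4.
  have e2 : ordS k = k' by apply: inj; apply: (@addIr _ _ t); rewrite h2 h3.
  by have := two k; rewrite e2 -e1 eqxx.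
- have e1 : k = ordS k' by apply: inj; apply: (@addIr _ _ t); rewrite h1 h4.
  have e2 : ordS k = k' by apply: inj; apply: (@addIr _ _ t); rewrite h2 h3.
  by have := two k; rewrite e2 -e1 eqxx.
- by apply: inj; apply: (@addIr _ _ t); rewrite h1 h3.
Qed.

Let side_unique e f t t' p q (s : R) : p <> q -> s * s = 1 ->
  lattice u v t -> lattice u v t' -> ends e t p q -> ends f t' p q ->
  (\forall z \near mid p q, 0 < s * turn p q z -> inside (translate (T e.1) t) z) ->
  (\forall z \near mid p q, 0 < s * turn p q z -> inside (translate (T f.1) t') z) ->
  e = f.
Proof.
move=> pq ss lt lt' he hf se sf.
(* The normal to the edge on its positive side: moving from the midpoint along [w] by a small amount
   reaches a point inside both lifts. *)
pose w : plane R := (- (s * (q.2 - p.2)), s * (q.1 - p.1)).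
have [d d0 hd] := near_ray w se; have [d' d'0 hd'] := near_ray w sf.
pose y := Num.min d d' / 2.
have m0 : 0 < Num.min d d' by rewrite lt_min d0 d'0.
have y0 : 0 < y by rewrite divr_gt0.
have ym : y < Num.min d d' by rewrite /y; lra.
have yd : y < d by apply: lt_le_trans ym _; rewrite ge_min lexx.
have yd' : y < d' by apply: lt_le_trans ym _; rewrite ge_min lexx orbT.
have pos : 0 < s * turn p q ((mid p q).1 + y * w.1, (mid p q).2 + y * w.2).
  have -> : s * turn p q ((mid p q).1 + y * w.1, (mid p q).2 + y * w.2) =
      s * s * (y * dot (q - p) (q - p)) by rewrite /turn /cross /dot /mid /w /=; field.
  rewrite ss mul1r mulr_gt0 // lt_neqAle dot_ge0 andbT; apply/eqP => /esym /dot_eq0[/= d1 d2].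
  by apply: pq; apply: plane_eqP; lra.
have h1 := hd y y0 yd pos; have h2 := hd' y y0 yd' pos.
have [ef tt] := lifts_disjoint lt lt' h1 h2.
case: e f he hf ef {se sf hd hd' h1 h2} => [i k] [j l] he hf /= ef; subst j t'.
by rewrite (ends_inj he hf).
Qed.

Lemma same_edge_length e f : same_edge u v T e f ->
  edge_length (T e.1) e.2 = edge_length (T f.1) f.2.
Proof.
have dC (a b : plane R) : Defs.edist a b = Defs.edist b a.
  by rewrite /Defs.edist /enorm /dot; congr Num.sqrt => /=; ring.
have dD (a b t : plane R) : Defs.edist (a + t) (b + t) = Defs.edist a b.
  by rewrite /Defs.edist /enorm /dot; congr Num.sqrt => /=; ring.
by move=> /same_edgeP[t _ []] [h1 h2]; rewrite /edge_length -h1 -h2 dD // dC.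
Qed.

(** Pigeonhole: three lifted sides lie along one segment, each has its tile on one of two sides of
    it near the midpoint, and tiles on the same side coincide. *)
Lemma same_edge_le2 e f g : same_edge u v T e f -> same_edge u v T e g ->
  [\/ e = f, e = g | f = g].
Proof.
move=> /same_edgeP[t lt hf] /same_edgeP[t' lt' hg].
have [_ sT _ _] := hT.
pose p := T e.1 e.2; pose q := T e.1 (ordS e.2).
have pq : p <> q.
  have [inj _] := sT e.1; move=> /inj h; have := nS e.2; by rewrite -h eqxx.
have he : ends e 0 p q by left; split; apply: plane_eqP; rewrite /= addr0.
have [s1 ss1 h1] := side_of lattice0 he.
have [s2 ss2 h2] := side_of lt hf.
have [s3 ss3 h3] := side_of lt' hg.
have pm (s : R) : s * s = 1 -> s = 1 \/ s = - 1.
  by move=> ss; have /eqP := ss; rewrite -expr2 sqrf_eq1 => /orP[] /eqP; [left|right].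
have U12 : s1 = s2 -> e = f.
  by move=> E; subst s2; apply: (side_unique pq ss1 lattice0 lt he hf).
have U13 : s1 = s3 -> e = g.
  by move=> E; subst s3; apply: (side_unique pq ss1 lattice0 lt' he hg).
have U23 : s2 = s3 -> f = g.
  by move=> E; subst s3; apply: (side_unique pq ss2 lt lt' hf hg).
case: (pm _ ss1) (pm _ ss2) (pm _ ss3) => [e1|e1] [e2|e2] [e3|e3];
  first [by apply: Or31; apply: U12; rewrite e1 e2
        |by apply: Or32; apply: U13; rewrite e1 e3
        |by apply: Or33; apply: U23; rewrite e2 e3].
Qed.

Lemma sum_perimeter_le :
  \sum_i perimeter (T i) <= 2 * \sum_(e in torus_edges u v T) edge_length (T e.1) e.2.
Proof.
pose S := equivalence_partition (same_edge u v T) finset.setT.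
have pS : finset.partition S finset.setT.
  by apply: equivalence_partitionP; exact: same_edge_equivalence.
have trX := transversalP pS; set X := transversal _ _ in trX.
have -> : \sum_i perimeter (T i) = \sum_(e in [set: ('I_N * 'I_5)%type]%SET) edge_length (T e.1) e.2.
  rewrite (eq_bigl (fun e => true)); last by move=> e; rewrite finset.in_setT.
  by rewrite -(pair_bigA _ (fun i k => edge_length (T i) k)).
rewrite (finset.set_partition_big _ pS) /= -/S -(finset.pblock_transversal trX).
rewrite finset.big_imset /=; last exact: (finset.pblock_inj trX).
rewrite mulr_sumr; apply: ler_sum => x _.
have inB e : (e \in finset.pblock S x) = same_edge u v T x e.
  by rewrite finset.pblock_equivalence_partition ?finset.in_setT //; exact: same_edge_equivalence.
rewrite (eq_bigr (fun _ => edge_length (T x.1) x.2)); last first.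
  by move=> e; rewrite inB => /same_edge_length.
(* All sides in a class have equal length, so it remains to see that a class has at most two
   elements. *)
rewrite sumr_const -[leLHS]mulr_natl ler_wpM2r ?sqrtr_ge0 // ler_nat leqNgt.
apply/negP => /card_gt2P[e [f [g [[eB fB gB] [ef fg ge]]]]].
rewrite !inB in eB fB gB.
have Rx a b : same_edge u v T x a -> same_edge u v T x b -> same_edge u v T a b.
  move=> xa xb; have [_ H] := same_edge_equivalence (finset.in_setT x) (finset.in_setT a) (finset.in_setT b).
  by rewrite -H.
have [h|h|h] := same_edge_le2 (Rx e f eB fB) (Rx e g eB gB).
- by rewrite h eqxx in ef.
- by rewrite h eqxx in ge.
- by rewrite h eqxx in fg.
Qed.

End Edges.

(** * Vertices of the tiling *)

Section Rays.
Context {R : realType}.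
Implicit Types (z w x t : plane R).

Definition ray x w (y : R) : plane R := (x.1 + y * w.1, x.2 + y * w.2).

Lemma ray0 x w : ray x w 0 = x.
Proof. by apply: plane_eqP; rewrite /= mul0r addr0. Qed.

Lemma closed_segment x z : closed (segment x z).
Proof.
have -> : segment x z = ray x (z - x) @` `[0, 1].
  apply/seteqP; split=> w.
    move=> /segmentP[y [y0 y1 e1 e2]]; exists y; first by rewrite /= in_itv /= y0.
    by apply: plane_eqP; rewrite /= ?e1 ?e2; ring.
  move=> [y /=]; rewrite in_itv /= => /andP[y0 y1] <-; apply/segmentP; exists y.
  by split=> //=; ring.
apply: compact_closed; first exact: norm_hausdorff.
apply: continuous_compact; last exact: segment_compact.
by apply: continuous_subspaceT; exact: continuous_line.
Qed.

Lemma closed_boundary n (P : polygon R n) : closed (boundary P).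
Proof.
apply: closed_bigcup; first exact: finite_finset.
by move=> k _; exact: closed_segment.
Qed.

(** If [x] is off the closed boundary, a short initial piece of the ray avoids the boundary too and
    lies in a single component, so [x] and the nearby points of the region are inside together. *)
Lemma region_ray_limit n (P : polygon R n) x w :
  (forall d : R, 0 < d -> exists y, [/\ 0 < y, y < d & region P (ray x w y)]) -> region P x.
Proof.
move=> h; have [bx|nx] := pselect (boundary P x); first by right.
have : \forall z \near x, ~ boundary P z.
  by apply: open_nbhs_nbhs; split => //; apply: closed_openC; exact: closed_boundary.
move=> /(near_ray w)[d d0 hd]; have [y [y0 yd ry]] := h d d0.
have nb (z : R) : 0 <= z -> z < d -> ~ boundary P (ray x w z).
  rewrite le_eqVlt => /orP[/eqP <- _|z0 zd]; first by rewrite ray0.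
  exact: hd.
case: ry => [[_ hb]|]; last by move=> /nb h'; case: h' => //; exact: ltW.
left; split=> //.
suff -> : connected_component (~` boundary P) x = connected_component (~` boundary P) (ray x w y) by [].
apply: same_connected_component.
have sub : ray x w @` `[0, y] `<=` connected_component (~` boundary P) x.
  apply: connected_component_max.
  - by exists 0; rewrite ?ray0 //= in_itv /= lexx ltW.
  - move=> _ [t0 t0y <-]; move: t0y; rewrite /= in_itv /= => /andP[z0 zy]; apply: nb => //.
    exact: le_lt_trans zy yd.
  - apply: connected_continuous_connected.
      by apply/connected_intervalP; exact: interval_is_interval.
    by apply: continuous_subspaceT; exact: continuous_line.
by apply: sub; exists y => //=; rewrite in_itv /= lexx andbT ltW.
Qed.

Lemma region_translate n (P : polygon R n) t z : region (translate P t) (z + t) <-> region P z.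
Proof.
by split; (case=> h; [left; move: h => /inside_translate|right; move: h => /boundary_translate]).
Qed.

Lemma region_bounded n (P : polygon R n.+1) : exists K : R, forall z, region P z ->
  `|z.1| <= K /\ `|z.2| <= K.
Proof.
pose K := \sum_k (`|(P k).1| + `|(P k).2|).
have b k : `|(P k).1| <= K /\ `|(P k).2| <= K.
  rewrite /K (bigD1 k) //=.
  have : 0 <= \sum_(i < n.+1 | i != k) (`|(P i).1| + `|(P i).2|).
    by apply: sumr_ge0 => i _; rewrite addr_ge0.
  by have := normr_ge0 (P k).1; have := normr_ge0 (P k).2; split; lra.
exists K => z rz.
have H (m1 m2 : R) : (forall k, m1 * (P k).1 + m2 * (P k).2 <= K) -> m1 * z.1 + m2 * z.2 <= K.
  by move=> h; exact: (@region_halfplane _ _ P (m1, m2) K h z rz).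
have B k : [/\ - K <= (P k).1, (P k).1 <= K, - K <= (P k).2 & (P k).2 <= K].
  by have [] := b k; rewrite !ler_norml => /andP[-> ->] /andP[-> ->].
have h1 := H 1 0; have h2 := H (-1) 0; have h3 := H 0 1; have h4 := H 0 (-1).
rewrite !ler_norml; split; apply/andP; split.
- suff : (-1) * z.1 + 0 * z.2 <= K by lra.
  by apply: h2 => k; have [] := B k; lra.
- suff : 1 * z.1 + 0 * z.2 <= K by lra.
  by apply: h1 => k; have [] := B k; lra.
- suff : 0 * z.1 + (-1) * z.2 <= K by lra.
  by apply: h4 => k; have [] := B k; lra.
- suff : 0 * z.1 + 1 * z.2 <= K by lra.
  by apply: h3 => k; have [] := B k; lra.
Qed.

Lemma frequent (F : finType) (f : nat -> F) : exists a, forall m, exists2 k, (m <= k)%N & f k = a.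
Proof.
apply: contrapT => /forallNP h.
have /choice[g hg] : forall a, exists m, forall k, (m <= k)%N -> f k <> a.
  move=> a; have /existsNP[m hm] := h a; exists m => k mk fk; apply: hm; by exists k.
pose M := \max_a g a.
by apply: (hg (f M) M) => //; exact: leq_bigmax.
Qed.

End Rays.

(** * Local finiteness of the tiling *)

Section LocalFiniteness.
Context {R : realType} {N : nat} (u v : plane R) (T : 'I_N -> polygon R 5).
Hypothesis hT : torus_tiling u v T.
Implicit Types (x w : plane R).

(** A code with finitely many values, faithful on integers of absolute value at most [M], as the
    pigeonhole argument requires. *)
Let code (M : nat) (a : int) : 'I_M.+1 * bool := (inord `|a|%N, 0 <= a).

Let code_inj M (a b : int) : (`|a| <= M)%N -> (`|b| <= M)%N -> code M a = code M b -> a = b.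
Proof.
move=> aM bM [/(congr1 (@nat_of_ord _))]; rewrite !inordK ?ltnS // => e s.
have [a0|a0] := boolP (0 <= a).
  have b0 : 0 <= b by rewrite -s.
  by rewrite -(gez0_abs a0) -(gez0_abs b0) e.
have b0 : ~~ (0 <= b) by rewrite -s.
rewrite -ltNge in a0; rewrite -ltNge in b0.
have ea := ltz0_abs a0; have eb := ltz0_abs b0.
by apply: oppr_inj; rewrite -ea -eb e.
Qed.

(** Cramer's rule expresses the coefficients through the lattice vector, with the nonzero
    determinant [cross u v]. *)
Lemma lattice_bounded (D : R) : exists M : nat, forall a b : int,
  `|a%:~R * u.1 + b%:~R * v.1| <= D -> `|a%:~R * u.2 + b%:~R * v.2| <= D ->
  (`|a| <= M)%N /\ (`|b| <= M)%N.
Proof.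
have [/eqP c0 _ _ _] := hT; have c1 : 0 < `|cross u v| by rewrite normr_gt0.
pose E := D * (`|u.1| + `|u.2| + `|v.1| + `|v.2|) / `|cross u v|.
exists (Num.bound E) => a b; set t1 := (X in `|X|); move=> h1; set t2 := (X in `|X|); move=> h2.
have D0 : 0 <= D := le_trans (normr_ge0 _) h1.
have E0 : 0 <= E by rewrite divr_ge0 // mulr_ge0 // !addr_ge0.
have gen (n : int) (p1 p2 : R) : n%:~R * cross u v = t1 * p2 - t2 * p1 ->
    `|p1| + `|p2| <= `|u.1| + `|u.2| + `|v.1| + `|v.2| -> (`|n| <= Num.bound E)%N.
  move=> e hp; have h : `|n%:~R : R| * `|cross u v| <= D * (`|p1| + `|p2|).
    rewrite -normrM e; apply: (le_trans (ler_normB _ _)); rewrite !normrM mulrDr addrC.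
    by apply: lerD; apply: ler_wpM2r.
  have h' : `|n%:~R : R| <= E.
    rewrite /E ler_pdivlMr //; apply: (le_trans h); exact: ler_wpM2l.
  have := le_lt_trans h' (archi_boundP E0).
  by rewrite -intr_norm -natr_absz ltr_nat => /ltnW.
have [n1 n2 n3 n4] : [/\ 0 <= `|u.1|, 0 <= `|u.2|, 0 <= `|v.1| & 0 <= `|v.2|] by rewrite !normr_ge0.
split.
- by apply: (gen a v.1 v.2); [rewrite /t1 /t2 /cross; ring|lra].
- by apply: (gen b (- u.1) (- u.2)); [rewrite /t1 /t2 /cross; ring|rewrite !normrN; lra].
Qed.

(** The points of the ray at parameters [1 / (m + 1)] are covered by lifts from a finite list,
    because tiles are bounded and lattice coefficients are controlled. One lift therefore occurs for
    infinitely many [m]. *)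
Lemma ray_tile x w : exists i t, lattice u v t /\
  forall d : R, 0 < d -> exists y, [/\ 0 < y, y < d & region (translate (T i) t) (ray x w y)].
Proof.
pose L (a b : int) : plane R := (a%:~R * u.1 + b%:~R * v.1, a%:~R * u.2 + b%:~R * v.2).
pose y (m : nat) : R := m.+1%:R^-1.
have y0 m : 0 < y m by rewrite invr_gt0.
have y1 m : y m <= 1 by rewrite invf_le1 // ler1n.
have [_ _ cov _] := hT.
have /choice[f hf] : forall m, exists q : 'I_N * (int * int),
    region (translate (T q.1) (L q.2.1 q.2.2)) (ray x w (y m)).
  by move=> m; have [i [t [a [b ->]] r]] := cov (ray x w (y m)); exists (i, (a, b)).
have /choice[K hK] : forall i, exists K : R, forall z, region (T i) z -> `|z.1| <= K /\ `|z.2| <= K.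
  by move=> i; exact: region_bounded.
pose D := \sum_i `|K i| + `|x.1| + `|x.2| + `|w.1| + `|w.2|.
have [M HM] := lattice_bounded D.
have fM m : (`|(f m).2.1| <= M)%N /\ (`|(f m).2.2| <= M)%N.
  have := hf m; case: (f m) => i [a b] /=.
  rewrite -(subtK (ray _ _ _) (L a b)) => /region_translate /hK[].
  have Ki : K i <= \sum_i `|K i|.
    rewrite (bigD1 i) //= (le_trans (ler_norm _)) // lerDl; exact: sumr_ge0.
  have bd (c d e k : R) : `|c + y m * d - e| <= k -> `|e| <= k + `|c| + `|d|.
    move=> h; have -> : e = (c + y m * d) - (c + y m * d - e) by ring.
    apply: (le_trans (ler_normB _ _)); have := ler_normD c (y m * d).
    have : `|y m * d| <= `|d| by rewrite normrM gtr0_norm // ler_piMl.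
    lra.
  have [n1 n2 n3 n4] : [/\ 0 <= `|x.1|, 0 <= `|x.2|, 0 <= `|w.1| & 0 <= `|w.2|] by rewrite !normr_ge0.
  move=> /= /bd h1 /bd h2; apply: HM; rewrite /D; lra.
pose g m := ((f m).1, (code M (f m).2.1, code M (f m).2.2)).
have [q hq] := frequent g; have [m0 _ gm0] := hq 0%N.
exists (f m0).1, (L (f m0).2.1 (f m0).2.2); split; first by exists (f m0).2.1, (f m0).2.2.
move=> d d0; have [m mb gm] := hq (Num.bound d^-1).
exists (y m); split => //.
  rewrite /y invf_plt ?posrE //; apply: lt_le_trans (archi_boundP _) _; first by rewrite invr_ge0 ltW.
  by rewrite ler_nat; exact: leqW.
have := hf m; have : g m = g m0 by rewrite gm gm0.
move=> E; have e1 := congr1 (fun z => z.1) E; have e2 := congr1 (fun z => z.2.1) E.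
have e3 := congr1 (fun z => z.2.2) E; rewrite /g /= in e1 e2 e3.
have [a1 a2] := fM m; have [b1 b2] := fM m0.
by rewrite e1 (code_inj a1 b1 e2) (code_inj a2 b2 e3).
Qed.

End LocalFiniteness.

Section Corner.
Context {R : realType}.
Implicit Types (s : R) (P : polygon R 5) (w : plane R).

Let corner_turn P k w (y : R) :
  turn (P k) (P (ordS k)) (ray (P k) w y) = y * cross (P (ordS k) - P k) w /\
  turn (P (ord_pred k)) (P k) (ray (P k) w y) = y * cross w (P (ord_pred k) - P k).
Proof. by rewrite /turn /cross /ray /=; split; ring. Qed.

Lemma corner_inside s P k w : sconvex s P ->
  cone s (P (ordS k) - P k) (P (ord_pred k) - P k) w ->
  exists2 d : R, 0 < d & forall y, 0 < y -> y < d -> inside P (ray (P k) w y).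
Proof.
move=> cv [h1 h2]; rewrite (inside_openhull cv).
have hj j : exists2 d : R, 0 < d & forall y, 0 < y -> y < d ->
    0 < s * turn (P j) (P (ordS j)) (ray (P k) w y).
  have [->|jk] := eqVneq j k.
    exists 1 => // y y0 _; have [-> _] := corner_turn P k w y.
    by rewrite mulrCA mulr_gt0.
  have [jk'|jk'] := eqVneq j (ord_pred k).
    exists 1 => // y y0 _; have [_] := corner_turn P k w y.
    by rewrite jk' ord_predK => ->; rewrite mulrCA mulr_gt0.
  have pos : 0 < s * turn (P j) (P (ordS j)) (P k).
    have [_] := cv; apply; first by rewrite eq_sym.
    by apply: contra jk' => /eqP ->; rewrite ordSK.
  apply: (near_ray w (A := fun z => 0 < s * turn (P j) (P (ordS j)) z)).
  have := near_turn_gt0 (negbT (gt_eqF pos)); apply: filterS => z ->.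
  exact: pos.
have /choice[d hd] : forall j, exists d : R, 0 < d /\ forall y, 0 < y -> y < d ->
    0 < s * turn (P j) (P (ordS j)) (ray (P k) w y).
  by move=> j; have [d d0 h] := hj j; exists d.
pose m := \big[Num.min/1]_j d j; exists m.
  by rewrite /m; apply: (big_ind (fun z => 0 < z)) => // [a b|j _]; [rewrite lt_min => -> ->|have [] := hd j].
move=> y y0 ym j; have [_ h] := hd j; apply: h => //.
apply: (lt_le_trans ym); rewrite /m; exact: bigmin_le.
Qed.

Lemma corner_region s P k w (y : R) : sconvex s P -> 0 < y -> region P (ray (P k) w y) ->
  ccone s (P (ordS k) - P k) (P (ord_pred k) - P k) w.
Proof.
move=> cv y0; rewrite (region_convex cv) => h.
have := h (ord_pred k); have := h k; rewrite ord_predK.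
have [-> ->] := corner_turn P k w y.
by rewrite ![s * (y * _)]mulrCA !(pmulr_rge0 _ y0).
Qed.

End Corner.

Section Vertex.
Context {R : realType} {N : nat} (u v : plane R) (T : 'I_N -> polygon R 5).
Hypothesis hT : torus_tiling u v T.
Hypothesis hE : edge_to_edge u v T.
Implicit Types (c d : 'I_N * 'I_5) (i : 'I_N).

Let pt c : plane R := T c.1 c.2.

Definition same_vertex : rel ('I_N * 'I_5) := fun c d => `[< lattice u v (T c.1 c.2 - T d.1 d.2) >].

Lemma same_vertex_equivalence : {in finset.setT & &, equivalence_rel same_vertex}.
Proof.
have sym c d : same_vertex c d -> same_vertex d c.
  by move=> /asboolP /latticeN h; apply/asboolP; rewrite -opprB.
have trans c d b : same_vertex c d -> same_vertex d b -> same_vertex c b.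
  move=> /asboolP h /asboolP h'; apply/asboolP; have := latticeD h h'.
  by rewrite addrA subrK.
move=> c d b _ _ _; split; first by apply/asboolP; rewrite subrr; exact: lattice0.
by move=> cd; apply/idP/idP => h; [exact: trans (sym _ _ cd) h|exact: trans cd h].
Qed.

Let inj i : injective (T i). Proof. by have [_ sT _ _] := hT; have [] := sT i. Qed.

Let lift c d := translate (T d.1) (pt c - pt d).

Let liftE c d w (y : R) : ray (pt c) w y = ray (pt d) w y + (pt c - pt d).
Proof. by apply: plane_eqP; rewrite /ray /=; ring. Qed.

(** Edge-to-edge gives either a common vertex or a common edge through the point. In the second case
    the point is a vertex of its own simple tile, hence an end of that edge, and the two edges have
    the same ends. *)
Let touching c i t : lattice u v t -> region (translate (T i) t) (pt c) ->
  exists l, T i l + t = pt c.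
Proof.
move=> lt rt; have [_ sT _ _] := hT.
have [e|ne] := pselect ((c.1, 0) = (i, t)).
  have e1 := congr1 fst e; have e2 := congr1 snd e; rewrite /= in e1 e2.
  by exists c.2; rewrite -e1 -e2 addr0.
have rc : region (T c.1) (pt c).
  by right; exists c.2 => //; have [] := segment_ends (pt c) (T c.1 (ordS c.2)).
have [k [l [[_ h]|[ek hk]]]] := hE lt ne rc rt; first by exists l; rewrite h.
have ec : edge (T c.1) c.2 (pt c) by have [] := segment_ends (pt c) (T c.1 (ordS c.2)).
have end_k : c.2 = k \/ c.2 = ordS k.
  have [->|kc] := eqVneq c.2 k; first by left.
  have [_ h] := sT c.1; rewrite eq_sym in kc.
  have [[<- _]|[_ /inj e]] := h _ _ _ kc ek ec; first by right.
  by rewrite e eqxx in kc.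
have [[h1 h2]|[h1 h2]] := segment_eq hk; case: end_k => e; rewrite /pt e.
- by exists l.
- by exists (ordS l).
- by exists (ordS l).
- by exists l.
Qed.

Context (A : {set 'I_N}) (s : 'I_N -> R).
Hypothesis convex : forall i, i \in A -> sconvex (s i) (T i).

Let proper d : d.1 \in A -> s d.1 * s d.1 = 1 /\
  0 < s d.1 * cross (T d.1 (ordS d.2) - pt d) (T d.1 (ord_pred d.2) - pt d).
Proof.
move=> /convex cv; have [ss _] := cv; split=> //.
have := turn_corner_gt0 d.2 cv.
have -> : cross (pt d - T d.1 (ord_pred d.2)) (T d.1 (ordS d.2) - pt d) =
  cross (T d.1 (ordS d.2) - pt d) (T d.1 (ord_pred d.2) - pt d) by rewrite /cross /=; ring.
by [].
Qed.

(** Only the corners of the convex tiles are counted, so the bound is available at every vertex.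
    Short segments into two overlapping corners would give a common interior point of two lifts. *)
Lemma vertex_angles_le c :
  \sum_(d in [set d | same_vertex c d && (d.1 \in A)]%SET) ang (T d.1) d.2 <= 2 * pi.
Proof.
apply: (cone_sum_le (s := fun d => s d.1)).
  by move=> d; rewrite finset.inE => /andP[_]; exact: proper.
move=> d b w; rewrite !finset.inE => /andP[/asboolP ld dA] /andP[/asboolP lb bA].
move=> /(corner_inside (convex dA))[e e0 he] /(corner_inside (convex bA))[e' e'0 he'].
pose y := Num.min e e' / 2.
have m0 : 0 < Num.min e e' by rewrite lt_min e0 e'0.
have y0 : 0 < y by rewrite divr_gt0.
have ym : y < Num.min e e' by rewrite /y; lra.
have ye : y < e by apply: lt_le_trans ym _; rewrite ge_min lexx.
have ye' : y < e' by apply: lt_le_trans ym _; rewrite ge_min lexx orbT.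
have h1 : inside (lift c d) (ray (pt c) w y).
  by rewrite (liftE c d); apply/inside_translate/he.
have h2 : inside (lift c b) (ray (pt c) w y).
  by rewrite (liftE c b); apply/inside_translate/he'.
have [e1 e2] := lifts_disjoint hT ld lb h1 h2.
case: d b ld lb dA bA he he' h1 h2 e1 e2 => [i k] [j l] /= _ _ _ _ _ _ _ _ ij e2; subst j.
have e3 := congr1 fst e2; have e4 := congr1 snd e2; rewrite /pt /= in e3 e4.
by rewrite (@inj i k l) //; apply: plane_eqP; lra.
Qed.

(** In each direction the ray from the vertex starts in some lift, which contains the vertex by
    closedness and so has a corner there by [touching]; that corner's closed sector contains the
    direction. *)
Lemma vertex_angles_ge c : (forall d, same_vertex c d -> d.1 \in A) ->
  2 * pi <= \sum_(d in [set d | same_vertex c d]%SET) ang (T d.1) d.2.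
Proof.
move=> hA; apply: (cone_sum_ge (s := fun d => s d.1)).
  by move=> d; rewrite finset.inE => /hA; exact: proper.
move=> y; have [i [t [lt ht]]] := ray_tile hT (pt c) (circle y).
have [l hl] := touching lt (region_ray_limit ht).
have E : t = pt c - pt (i, l).
  have e1 := congr1 fst hl; have e2 := congr1 snd hl; rewrite /= in e1 e2.
  by apply: plane_eqP; rewrite /= -?e1 -?e2 /pt /=; ring.
have cd : same_vertex c (i, l) by apply/asboolP; rewrite -/(pt _) -/(pt _) -E.
exists (i, l); first by rewrite finset.inE.
have [z [z0 _]] := ht 1 ltr01; rewrite (liftE c (i, l)) E => /region_translate.
exact: corner_region (convex (hA _ cd)) z0.
Qed.

End Vertex.

(** * Excess of angles *)

Section Tangent.
Context {R : realType}.
Implicit Types (a x y : R).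

Let cos_lt1 x : 0 < x < pi -> 0 < 1 - cos x.
Proof.
move=> h; have s0 := sin_gt0_pi h; have c2 := cos2Dsin2 x.
rewrite subr_gt0 lt_neqAle cos_le1 andbT; apply/eqP => e.
have : 0 < sin x ^+ 2 by rewrite exprn_gt0.
by move: c2; rewrite e expr1n; lra.
Qed.

Let derive_hcot x : 0 < x < pi -> is_derive x 1 (@hcot R) (- (1 - cos x)^-1).
Proof.
move=> h; have s0 := sin_gt0_pi h; have sn : sin x != 0 by rewrite gt_eqF.
have c2 := cos2Dsin2 x.
have c1 : 1 - cos x != 0 by rewrite gt_eqF // cos_lt1.
rewrite /hcot; apply: trigger_derive.
rewrite /GRing.scale /=.
have -> : (1 - cos x)^-1 = (sin x ^+ 2 + cos x ^+ 2 + cos x) / sin x ^+ 2.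
  rewrite [sin x ^+ 2 + _]addrC c2.
  have -> : sin x ^+ 2 = (1 - cos x) * (1 + cos x) by move: c2; rewrite !expr2; lra.
  have c3 : 1 + cos x != 0.
    apply/eqP => e; move/eqP: sn; apply; apply/eqP; rewrite -sqrf_eq0; apply/eqP.
    have ec : cos x = - 1 by lra.
    by move: c2; rewrite ec sqrrN expr1n; lra.
  by field; apply/andP.
by field.
Qed.

Let cos_dec x y : 0 < x < pi -> 0 < y < pi -> x < y -> cos y < cos x.
Proof.
move=> /andP[x0 xp] /andP[y0 yp] xy.
by rewrite ltr_cos // in_itv /= !ltW.
Qed.

(** Convexity by the mean value theorem: the derivative [- (1 - cos x)^-1] increases on the interval
    from 0 to [pi]. *)
Lemma hcot_tangent a x : 0 < a < pi -> 0 < x < pi ->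
  hcot a - (x - a) / (1 - cos a) <= hcot x.
Proof.
move=> ha hx.
have cont y z : 0 < y -> z < pi -> {within `[y, z], continuous (@hcot R)}.
  move=> y0 zp; apply: derivable_within_continuous => w; rewrite in_itv /= => /andP[yw wz].
  by have [] : is_derive w 1 (@hcot R) (- (1 - cos w)^-1) by
    apply: derive_hcot; rewrite (lt_le_trans y0) //= (le_lt_trans wz).
have itv y z w : 0 < y -> z < pi -> w \in `]y, z[ -> 0 < w < pi.
  by move=> y0 zp; rewrite in_itv /= => /andP[yw wz]; rewrite (lt_trans y0) //= (lt_trans wz).
have [a0 ap] := andP ha; have [x0 xp] := andP hx.
have ca := cos_lt1 ha.
have [xa|ax|->] := ltgtP x a; last by rewrite subrr mul0r subr0.
- have [w hw e] := MVT xa (fun w hw => derive_hcot (itv x a w x0 ap hw)) (cont x a x0 ap).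
  have hw' := itv x a w x0 ap hw; have cw := cos_lt1 hw'.
  have : (1 - cos a)^-1 <= (1 - cos w)^-1.
    rewrite lef_pV2 ?posrE // lerD2l lerN2 ltW //; apply: cos_dec => //.
    by move: hw; rewrite in_itv /= => /andP[].
  have xa' : 0 <= a - x by lra.
  move=> /(ler_wpM2r xa'); move: e; rewrite mulNr; lra.
- have [w hw e] := MVT ax (fun w hw => derive_hcot (itv a x w a0 xp hw)) (cont a x a0 xp).
  have hw' := itv a x w a0 xp hw; have cw := cos_lt1 hw'.
  have : (1 - cos w)^-1 <= (1 - cos a)^-1.
    rewrite lef_pV2 ?posrE // lerD2l lerN2 ltW //; apply: cos_dec => //.
    by move: hw; rewrite in_itv /= => /andP[].
  have xa' : 0 <= x - a by lra.
  move=> /(ler_wpM2r xa'); move: e; rewrite mulNr; lra.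
Qed.

Let p0 : 0 < (pi : R).
Proof. exact: pi_gt0. Qed.

Lemma hcot_tangent_pihalf x : 0 < x < pi -> 1 - (x - pi / 2) <= hcot x.
Proof.
move=> hx; have p := p0; have h : 0 < (pi / 2 : R) < pi by apply/andP; split; lra.
have := hcot_tangent h hx; rewrite hcot_pihalf cos_pihalf subr0 divr1; lra.
Qed.

Lemma hcot_tangent_2pi3 x : 0 < x < pi ->
  Num.sqrt 3 / 3 - 2 / 3 * (x - 2 * pi / 3) <= hcot x.
Proof.
move=> hx; have p := p0; have h : 0 < (2 * pi / 3 : R) < pi by apply/andP; split; lra.
have := hcot_tangent h hx; rewrite hcot_2pi3.
have -> : cos (2 * pi / 3) = - 2^-1 :> R.
  have -> : 2 * pi / 3 = - (pi / 3) + pi :> R by field.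
  by rewrite cosDpi cosN cos_pi3.
have -> : (x - 2 * pi / 3) / (1 - - 2^-1) = 2 / 3 * (x - 2 * pi / 3) by field.
lra.
Qed.

(** The tangents at [pi / 2] and at [2 * pi / 3], each evaluated at the other point. These bounds
    say exactly that the slope of the chord lies between those of the two tangents. *)
Lemma pi_bounds : 6 - 2 * Num.sqrt 3 <= (pi : R) <= 9 - 3 * Num.sqrt 3.
Proof.
have p := p0; have h1 : 0 < (2 * pi / 3 : R) < pi by apply/andP; split; lra.
have h2 : 0 < (pi / 2 : R) < pi by apply/andP; split; lra.
have := hcot_tangent_pihalf h1; have := hcot_tangent_2pi3 h2.
by rewrite hcot_2pi3 hcot_pihalf => t1 t2; apply/andP; split; lra.
Qed.

(** Minus the slope of the chord of [hcot] between [pi / 2] and [2 * pi / 3]. *)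
Definition slope : R := (6 - 2 * Num.sqrt 3) / pi.

(* Normalized so that the excesses of a convex pentagon add up to the sum of
   the [hcot] of its angles minus that of a Cairo pentagon. *)
Definition excess x : R := hcot x - (4 - Num.sqrt 3) + slope * x.

Lemma slope_pi : slope * pi = 6 - 2 * Num.sqrt 3.
Proof. by rewrite /slope divfK // gt_eqF. Qed.

Let slope_bounds : 2 / 3 <= slope <= 1.
Proof.
by have /andP[b1 b2] := pi_bounds; rewrite /slope ler_pdivlMr // ler_pdivrMr //; apply/andP; split; lra.
Qed.

(** The two tangents give two linear lower bounds for the excess. The weights [slope - 2 / 3] and
    [1 - slope], of sum [1 / 3], eliminate [x]. *)
Lemma excess_ge x : 0 < x < pi -> - (pi / 72) * (pi / 2 < x)%R%:R <= excess x.
Proof.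
move=> hx; have p := p0; have /andP[k1 k2] := slope_bounds.
have t1 : (1 - slope) * (pi / 2 - x) <= excess x.
  by have := hcot_tangent_pihalf hx; have := slope_pi; rewrite /excess; lra.
have t2 : (slope - 2 / 3) * (x - 2 * pi / 3) <= excess x.
  by have := hcot_tangent_2pi3 hx; have := slope_pi; rewrite /excess; lra.
have [h|h] := ltP (pi / 2) x; last first.
  have : 0 <= (1 - slope) * (pi / 2 - x) by apply: mulr_ge0; lra.
  by rewrite mulr0; lra.
rewrite mulr1.
have h1 : (slope - 2 / 3) * ((1 - slope) * (pi / 2 - x)) <= (slope - 2 / 3) * excess x.
  by apply: ler_wpM2l => //; lra.
have h2 : (1 - slope) * ((slope - 2 / 3) * (x - 2 * pi / 3)) <= (1 - slope) * excess x.
  by apply: ler_wpM2l => //; lra.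
(* Two nonnegative numbers of sum [1 / 3] have product at most [1 / 36], with equality at
   [slope = 5 / 6]; hence the constant [pi / 72 = 3 * (pi / 6) / 36]. *)
have h3 : 0 <= pi * (slope - 5 / 6) ^+ 2 by apply: mulr_ge0; [exact: ltW|exact: sqr_ge0].
rewrite expr2 in h3; lra.
Qed.

Section ExcessSum.
Context (I : finType) (A : {set I}) (x : I -> R).
Hypothesis angle : forall i, i \in A -> 0 < x i < pi.

Let sum_affine (a b : R) : \sum_(i in A) (a + b * x i) = #|A|%:R * a + b * \sum_(i in A) x i.
Proof. by rewrite big_split /= sumr_const mulr_natl -mulr_sumr. Qed.

Let card_large : (\sum_(i in A) x i <= 2 * pi) -> \sum_(i in A) (pi / 2 < x i)%R%:R <= (4 : R).
Proof.
move=> h; have p := p0; rewrite -(ler_pM2l (divr_gt0 p (ltr0Sn R 1))) mulr_sumr.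
apply: (@le_trans _ _ (\sum_(i in A) x i)); last lra.
apply: ler_sum => i /angle /andP[x0 _].
by have [/ltW|_] := ltP (pi / 2) (x i); rewrite ?mulr1 ?mulr0 // ltW.
Qed.

(** At most four angles above [pi / 2] fit into [2 * pi], and each of them contributes at least
    [- (pi / 72)]. *)
Lemma sum_excess_ge : \sum_(i in A) x i <= 2 * pi ->
  - (pi / 18) <= \sum_(i in A) excess (x i).
Proof.
move=> /card_large h; have p := p0.
have : \sum_(i in A) (- (pi / 72) * (pi / 2 < x i)%R%:R) <= \sum_(i in A) excess (x i).
  by apply: ler_sum => i /angle; exact: excess_ge.
apply: le_trans; rewrite -mulr_sumr mulNr lerN2.
have : pi / 72 * (\sum_(i in A) (pi / 2 < x i)%R%:R) <= pi / 72 * (4 : R) by apply: ler_wpM2l => //; lra.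
by move=> h2; apply: (le_trans h2); lra.
Qed.

(** Angles below [pi] with sum [2 * pi] are at least three. The tangent at [2 * pi / 3] gives
    exactly 0 for three angles and the tangent at [pi / 2] exactly 0 for four. *)
Lemma sum_excess_ge0 : \sum_(i in A) x i = 2 * pi -> 0 <= \sum_(i in A) excess (x i).
Proof.
move=> h; have p := p0; have /andP[b1 b2] := pi_bounds; have sp := slope_pi.
have k3 : (2 < #|A|)%N.
  have [e|[i iA]] := set_0Vmem A.
    by move: h; rewrite e big_set0; lra.
  have /andP[_ xi] := angle iA.
  have : \sum_(j in A) x j < #|A|%:R * pi.
    rewrite (bigD1 i) //= [ltRHS]mulr_natl -sumr_const (bigD1 i (F := fun=> pi)) //=.
    apply: ltr_leD => //; apply: ler_sum => j /andP[/angle /andP[_ ?] _].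
    exact: ltW.
  by rewrite h ltr_pM2r // (ltr_nat R 2).
have lower a b : (forall i, i \in A -> a + b * x i <= hcot (x i)) ->
    #|A|%:R * (a - (4 - Num.sqrt 3)) + (b * pi + (6 - 2 * Num.sqrt 3)) * 2 <= \sum_(i in A) excess (x i).
  move=> H; apply: (@le_trans _ _ (\sum_(i in A) (a - (4 - Num.sqrt 3) + (b + slope) * x i))).
    by rewrite sum_affine h -sp le_eqVlt; apply/orP; left; apply/eqP; ring.
  apply: ler_sum => i /H; rewrite /excess; lra.
have [e3|n3] := eqVneq #|A| 3.
  apply: le_trans (lower (Num.sqrt 3 / 3 + 4 * pi / 9) (- (2 / 3)) _).
    by rewrite e3; lra.
  by move=> i /angle /hcot_tangent_2pi3; lra.
have k4 : (4 : R) <= #|A|%:R by rewrite (ler_nat R 4) ltn_neqAle eq_sym n3.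
apply: le_trans (lower (1 + pi / 2) (- 1) _); last first.
  by move=> i /angle /hcot_tangent_pihalf; lra.
(* Each angle beyond the fourth adds [pi / 2 - 3 + Num.sqrt 3] to the bound, which is nonnegative by
   the lower bound on [pi]. *)
have : (0 : R) <= (#|A|%:R - 4) * (1 + pi / 2 - 4 + Num.sqrt 3) by apply: mulr_ge0; lra.
lra.
Qed.

End ExcessSum.

End Tangent.

(** * Balance of perimeters between the two kinds of tiles *)

Section Balance.
Context {R : realType}.
Implicit Types (P A B : polygon R 5).

Lemma sum_excess_pentagon s P : sconvex s P ->
  \sum_k excess (ang P k) = \sum_k hcot (ang P k) - (2 + Num.sqrt 3).
Proof.
move=> cv; have sp := @slope_pi R.
rewrite /excess !big_split /= -mulr_sumr (sum_ang cv) sumr_const card_ord.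
rewrite -[_ *+ 5]mulr_natl; have -> : slope * (3 * pi) = 3 * (6 - 2 * Num.sqrt 3) :> R by rewrite -sp; ring.
by ring.
Qed.

(** Summing the tangent at [pi / 2] over angles of total [3 * pi]. This crude bound keeps the
    perimeter away from 0 when the loss is linearized. *)
Lemma sum_hcot_ge s P : sconvex s P -> 5 - pi / 2 <= \sum_k hcot (ang P k).
Proof.
move=> cv.
have : \sum_k (1 - (ang P k - pi / 2)) <= \sum_k hcot (ang P k).
  by apply: ler_sum => k _; apply: hcot_tangent_pihalf; exact: ang_itv cv.
apply: le_trans; have -> : \sum_k (1 - (ang P k - pi / 2)) = \sum_(k < 5) (1 + pi / 2) - \sum_k ang P k.
  by rewrite -sumrB; apply: eq_bigr => k _; ring.
rewrite (sum_ang cv) sumr_const card_ord -[_ *+ 5]mulr_natl; lra.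
Qed.

Let le_sqr (x y : R) : 0 <= x -> 0 <= y -> x * x <= y * y -> x <= y.
Proof. by move=> x0 y0; rewrite -!expr2 ler_sqr ?nnegrE. Qed.

Let sqrt_bounds (r b : R) : 0 <= r -> r * r = 3 -> 0 <= b -> b * b = 2 + r ->
  19 / 10 <= b /\ b <= 97 / 50.
Proof.
move=> r0 rr b0 bb.
have r1 : 17 / 10 <= r by apply: le_sqr; rewrite ?rr; lra.
have r2 : r <= 87 / 50 by apply: le_sqr; rewrite ?rr; lra.
by split; apply: le_sqr; rewrite ?bb; lra.
Qed.

Lemma cairo_bounds : let b := Num.sqrt (2 + Num.sqrt 3) : R in
  19 / 10 <= b /\ b <= 97 / 50.
Proof.
have h (x : R) : 0 <= x -> Num.sqrt x * Num.sqrt x = x by move=> x0; rewrite -expr2 sqr_sqrtr.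
apply: (@sqrt_bounds (Num.sqrt 3)); rewrite ?sqrtr_ge0 ?h // addr_ge0 // sqrtr_ge0.
Qed.

(* The loss [2 b - p] per convex tile is at most [2 (b ^+ 2 - S) / 3.6], because
   [3.6 <= b + p / 2]; type 2 tiles gain at least [0.62] each. *)
Lemma perimeter_balance (S p q x y : R) : let b := Num.sqrt (2 + Num.sqrt 3) in
  5 - pi / 2 <= S -> 4 * S <= p ^+ 2 -> 0 <= p -> 9 / 2 <= q -> 0 <= x -> 0 <= y ->
  0 <= x * (S - (2 + Num.sqrt 3)) + y * (5 * (pi / 18)) ->
  2 * b * (x + y) <= x * p + y * q.
Proof.
move=> b hS hp p0 hq x0 y0; have [b1 b2] := cairo_bounds; rewrite -/b in b1 b2.
have p4 := @pihalf_lt2 R.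
have -> : 2 + Num.sqrt 3 = b ^+ 2 by rewrite sqr_sqrtr // addr_ge0 // sqrtr_ge0.
move: (pi : R) p4 hS => t p4 hS h; clearbody b.
(* As [pi / 2 < 2], the sum [S] exceeds 3 and [p ^ 2] exceeds 12, which is more than the square of
   [34 / 10]. With [19 / 10 <= b] this gives [18 / 5 <= b + p / 2]. *)
have p3 : 34 / 10 <= p.
  by rewrite expr2 in hp; apply: le_sqr; lra.
have h5 : 0 <= y * (q - 2 * b - 31 / 50) by apply: mulr_ge0 => //; lra.
have [pb|pb] := leP (2 * b) p.
  have : 0 <= x * (p - 2 * b) by apply: mulr_ge0 => //; lra.
  by rewrite !(mulrBr, mulrDr) in h5 *; lra.
have h1 : x * S <= x * (p ^+ 2 / 4) by apply: ler_wpM2l => //; lra.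
(* By [pi < 4], five corners are charged at most [10 / 9]. Twice this over [18 / 5] is [50 / 81],
   just below the gain [31 / 50]. *)
have h2 : y * (5 * (t / 18)) <= y * (10 / 9) by apply: ler_wpM2l => //; lra.
have h4 : 0 <= x * ((b - p / 2) * (b + p / 2 - 18 / 5)).
  by apply: mulr_ge0 => //; clear - b1 p3 pb; apply: mulr_ge0; lra.
have : x * ((b - p / 2) * (b + p / 2 - 18 / 5)) =
    x * b ^+ 2 - x * (p ^+ 2 / 4) - 18 / 5 * (x * b - x * p / 2) by field.
rewrite !(mulrBr, mulrDr) in h h5 *; lra.
Qed.

End Balance.

Theorem theorem4p6 (R : realType) (u v : plane R) (N : nat)
    (T : 'I_N -> polygon R 5) (A B : polygon R 5)
    (hT : torus_tiling u v T) (hE : edge_to_edge u v T)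
    (hA : efficient A)
    (hB : type2_nonconvex B) (hB1 : area B = 1%:E)
    (hAB : dihedral A B T) :
  Num.sqrt (2 + Num.sqrt 3) <= perimeter_per_tile u v T /\
  (forall C : polygon R 5, cairo C \/ prismatic C -> area C = 1%:E ->
     perimeter C / 2 <= perimeter_per_tile u v T).
Proof.
pose b : R := Num.sqrt (2 + Num.sqrt 3).
suff key : b <= perimeter_per_tile u v T.
  split=> // C hC aC; rewrite (cairo_prismatic_perimeter hC aC) -/b.
  by have -> : 2 * b / 2 = b by field.
have [sA aA [C [cC aC pAC]]] := hA.
have [_ b2] := @cairo_bounds R; rewrite -/b in b2.
have [s0 cvA] : exists s, sconvex s A.
  apply: short_pentagon_convex => //; apply: (le_lt_trans pAC).
  by rewrite (cairo_prismatic_perimeter (or_introl cC) aC) -/b; lra.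
have [dAB [i0 A0] _] := hAB.
pose isA : {set 'I_N} := [set i | `[< congruent A (T i) >]]%SET.
have isAP i : i \in isA -> congruent A (T i) by rewrite finset.inE => /asboolP.
have notA i : i \notin isA -> congruent B (T i).
  rewrite finset.inE => /asboolP nA; by have [/nA|] := dAB i.
move: isA isAP notA => isA isAP notA.
have /choice[s hs] : forall i, exists s : R, i \in isA -> sconvex s (T i).
  move=> i; have [iA|iA] := boolP (i \in isA); last by exists 0.
  have [t ht] := congruent_sconvex (congruent_edist (isAP i iA)) cvA.
  by exists t.
(* The charge of a corner: its excess in a convex tile, and in a nonconvex tile the constant that
   compensates the worst sum of excesses at a vertex. *)
pose F (c : 'I_N * 'I_5) : R := if c.1 \in isA then excess (ang (T c.1) c.2) else pi / 18.
have p0 := @pi_gt0 R.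
have angle c : c.1 \in isA -> 0 < ang (T c.1) c.2 < pi by move=> /hs; exact: ang_itv.
have Fge0 : 0 <= \sum_c F c.
  have pS := equivalence_partitionP (same_vertex_equivalence u v T).
  have -> : \sum_c F c = \sum_(c in [set: ('I_N * 'I_5)%type]%SET) F c.
    by apply: eq_bigl => c; rewrite finset.in_setT.
  rewrite (finset.set_partition_big _ pS); apply: sumr_ge0 => X /finset.imsetP[c _ ->].
  rewrite (eq_bigl (fun d => same_vertex u v T c d)); last by move=> d; rewrite !finset.inE.
  have le := vertex_angles_le hT hs c.
  have [allA|] := pselect (forall d, same_vertex u v T c d -> d.1 \in isA).
    have ge := vertex_angles_ge hT hE hs allA.
    have E : [set d | same_vertex u v T c d && (d.1 \in isA)]%SET = [set d | same_vertex u v T c d]%SET.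
      by apply/setP => d; rewrite !finset.inE; case: (boolP (same_vertex _ _ _ _ _)) => // /allA ->.
    rewrite E in le.
    have eq : \sum_(d in [set d | same_vertex u v T c d]%SET) ang (T d.1) d.2 = 2 * pi.
      by apply/eqP; rewrite eq_le le ge.
    have ang_cls d : d \in [set d | same_vertex u v T c d]%SET -> 0 < ang (T d.1) d.2 < pi.
      by rewrite finset.inE => /allA; exact: angle.
    have H := sum_excess_ge0 ang_cls eq; apply: (le_trans H); rewrite le_eqVlt; apply/orP; left; apply/eqP.
    by apply: eq_big => [d|d]; rewrite finset.inE // => /allA dA; rewrite /F dA.
  (* A single corner of a nonconvex tile at this vertex already outweighs the possible deficit of
     the convex corners there, and further ones only help. *)
  move=> /existsNP[d /not_implyP[cd /negP dA]].
  rewrite (bigID (fun d : 'I_N * 'I_5 => d.1 \in isA)) /=.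
  have h1 : - (pi / 18) <= \sum_(d | same_vertex u v T c d && (d.1 \in isA)) F d.
    have ang_cls d' : d' \in [set d | same_vertex u v T c d && (d.1 \in isA)]%SET ->
        0 < ang (T d'.1) d'.2 < pi.
      by rewrite finset.inE => /andP[_]; exact: angle.
    have H := sum_excess_ge ang_cls le; apply: (le_trans H); rewrite le_eqVlt; apply/orP; left; apply/eqP.
    by apply: eq_big => [d'|d']; rewrite finset.inE // => /andP[_ d'A]; rewrite /F d'A.
  have h2 : pi / 18 <= \sum_(d | same_vertex u v T c d && (d.1 \notin isA)) F d.
    rewrite (bigD1 d) ?cd ?dA //= {1}/F (negbTE dA) lerDl; apply: sumr_ge0 => d' /andP[/andP[_ d'A] _].
    by rewrite /F (negbTE d'A); lra.
  lra.
pose S := \sum_k hcot (ang A k).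
have split_sum (G : 'I_N -> R) (x y : R) : (forall i, i \in isA -> G i = x) ->
    (forall i, i \notin isA -> G i = y) -> \sum_i G i = #|isA|%:R * x + #|~: isA|%:R * y.
  move=> hx hy; rewrite (bigID (mem isA)) /= (eq_bigr (fun=> x)) // [X in _ + X](eq_bigr (fun=> y)) //.
  rewrite !sumr_const !mulr_natl; congr (_ *+ _ + _ *+ _).
  by apply: eq_card => i; rewrite !finset.inE.
have FE : \sum_c F c = #|isA|%:R * (S - (2 + Num.sqrt 3)) + #|~: isA|%:R * (5 * (pi / 18)).
  rewrite -(pair_bigA _ (fun i k => F (i, k))) /=; apply: split_sum => i iA.
    rewrite -(sum_excess_pentagon cvA); apply: eq_bigr => k _; rewrite /F /= iA.
    by rewrite (congruent_ang (congruent_edist (isAP i iA))).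
  rewrite (eq_bigr (fun=> pi / 18)); last by move=> k _; rewrite /F /= (negbTE iA).
  by rewrite sumr_const card_ord mulr_natl.
have PE : \sum_i perimeter (T i) = #|isA|%:R * perimeter A + #|~: isA|%:R * perimeter B.
  apply: split_sum => i iA; apply: congruent_perimeter; apply: congruent_edist.
    exact: isAP.
  exact: notA.
have lh : 4 * S <= perimeter A ^+ 2.
  have := lhuilier cvA; have := area_convex cvA; rewrite aA => -[<-].
  by rewrite mulr1.
have := perimeter_balance (sum_hcot_ge cvA) lh (perimeter_ge0 A) (type2_perimeter hB hB1)
  (ler0n R #|isA|) (ler0n R #|~: isA|).
rewrite -FE -PE => /(_ Fge0).
have -> : #|isA|%:R + #|~: isA|%:R = N%:R :> R by rewrite -natrD finset.cardsC card_ord.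
move=> h; have := sum_perimeter_le hT => h'.
(* The tile [i0] exists, so the division by the number of tiles is a genuine one. *)
have N0 : 0 < N%:R :> R by rewrite ltr0n (leq_ltn_trans _ (ltn_ord i0)).
rewrite /perimeter_per_tile ler_pdivlMr //; rewrite -/b in h; lra.
Qed.
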